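(* Let $a_0,a_1,b_0,b_1,c_0,c_1,d_0,d_1,e_0,e_1,z_0,z_1$ be non-negative integers such that for $i=0,1$: $b_i+c_i=e_i+z_i$, $a_i+b_i=d_i+e_i$, $c_i+d_i=z_i+a_i$. Let $\alpha\in\binom{[a_0+a_1]}{a_1}$, $\beta\in\binom{[b_0+b_1]}{b_1}$, $\gamma\in\binom{[c_0+c_1]}{c_1}$, $\delta\in\binom{[d_0+d_1]}{d_1}$, $\epsilon\in\binom{[e_0+e_1]}{e_1}$, $\zeta\in\binom{[z_0+z_1]}{z_1}$. Then the number of hexagonal puzzles with boundary labels $\alpha,\beta,\gamma,\delta,\epsilon,\zeta$ is $$\mathrm{Hex}(\alpha,\beta,\gamma,\delta,\epsilon,\zeta)=\sum_{\substack{\mu,\theta\text{ such that}\\0^{a_0}\mu1^{a_1}=0^{c_0}\theta1^{e_1}}}c_{0^{b_0}\alpha^\vee1^{z_1},\,\theta}^{1^{c_1}\delta0^{e_0}}\cdot c_{\beta\gamma,\,\mu}^{(\epsilon\zeta)^\vee},$$ where the sum is over pairs of binary strings $\mu\in\binom{[b_0+b_1+c_0+c_1]}{b_1+c_1}$ and $\theta\in\binom{[a_0+b_0+a_1+z_1]}{a_1+z_1}$ satisfying the displayed condition.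
   Context: Strings: $\binom{[n]}{k}$ denotes the set of binary strings (words in $0,1$) of length $n$ with exactly $k$ ones; juxtaposition is concatenation; $0^m,1^m$ are constant strings of length $m$; $\lambda^\vee$ is the reversal of $\lambda$. Littlewood-Richardson numbers: for $\lambda,\mu,\nu\in\binom{[n]}{k}$, $c_{\lambda,\mu}^\nu$ is defined by $[X_\lambda][X_\mu]=\sum_{\nu\in\binom{[n]}{k}}c_{\lambda,\mu}^\nu[X_\nu]$ in $H^*(\mathrm{Gr}(k;\mathbb{C}^n))$, where $X_\lambda=\{V:\dim(V\cap\langle e_1,\dots,e_i\rangle)\ge\lambda_1+\dots+\lambda_i\ \forall i\}$ is a Schubert variety. Equivalently it is the usual Littlewood-Richardson coefficient of the partitions attached to the strings, the partition of $\lambda$ having as its $j$-th part the number of $0$s to the right of the $j$-th $1$ in $\lambda$. Puzzles: work in the triangular lattice in the plane, whose unit edges make angles $0^\circ,60^\circ,120^\circ$ with the $x$-axis. Edge labels are the three symbols $0$, $1$, $10$ (where $10$ is a single symbol). A unit triangle (upward- or downward-pointing) with labeled edges is an allowed piece if its three labels read clockwise are $(0,0,0)$, $(1,1,1)$, or a cyclic rotation of $(1,0,10)$. Given a convex lattice polygon (sides along lattice directions, some sides possibly of length $0$) each of whose sides is labeled by a binary string, one symbol per unit edge, read clockwise around the polygon, a puzzle with this boundary is an assignment of labels to all unit lattice edges in the polygon which agrees with the prescribed labels on the boundary and for which every unit triangle in the polygon is an allowed piece. $\mathrm{Hex}(\alpha,\beta,\gamma,\delta,\epsilon,\zeta)$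 is the number of puzzles on the convex hexagon (all angles $120^\circ$, some sides possibly of length $0$) whose sides, in clockwise order SW, NW, North, NE, SE, South, are labeled respectively $\alpha,\beta,\gamma,\delta,\epsilon,\zeta$, each read clockwise; the side lengths are the lengths of the strings. *)

(* Defs.v *)
From HB Require Import structures.
From mathcomp Require Import all_boot all_order all_algebra finmap mpoly.
From Stdlib Require ClassicalEpsilon.

Set Implicit Arguments.
Unset Strict Implicit.
Unset Printing Implicit Defensive.

Import GRing.Theory.
Local Open Scope ring_scope.

(* Binary strings are sequences of booleans, with 1 = true and 0 = false. *)

Definition binstr (n k : nat) : pred (seq bool) :=
  [pred s | (size s == n) && (count_mem true s == k)].

Fixpoint string_part (s : seq bool) : seq nat :=
  if s is b :: s' then
    if b then count_mem false s' :: string_part s' else string_part s'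
  else [::].

(* Partitions with at most k parts, padded with zeros to length exactly k. *)
Definition is_part (k : nat) (l : seq nat) : bool :=
  (size l == k) && sorted geq l.

(* det (x_i ^ (l_j + k - j)) with j = 1, ..., k; the index j starts at 0 here *)
Definition alternant (k : nat) (l : seq nat) : {mpoly int[k]} :=
  \det (\matrix_(i < k, j < k) ('X_i ^+ (nth 0 l j + (k.-1 - j))%N)).

(* The Schur polynomial s_l(x_1, ..., x_k), as a quotient of alternants. The
   division is exact, but is written in the field of fractions. *)
Definition schur (k : nat) (l : seq nat) : {fraction {mpoly int[k]}} :=
  tofrac (alternant k l) / tofrac (alternant k (nseq k 0%N)).

(* s_l s_m = \sum_nu c_nu s_nu. Setting x_i = 0 for i > k kills exactly the
   Schur functions s_nu for which nu has more than k parts and keeps the others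
   linearly independent. *)
Definition lr_expansion (k : nat) (l m : seq nat)
    (c : {fsfun seq nat -> int with 0}) : Prop :=
  (forall nu, nu \in finsupp c -> is_part k nu) /\
  schur k l * schur k m = \sum_(nu <- finsupp c) schur k nu *~ c nu.

(* Schur polynomials of partitions with at most k parts form a basis of the
   symmetric polynomials in k variables, so that exactly one c satisfies
   [lr_expansion k l m c]. *)
Definition lr_coef (k : nat) (l m : seq nat) : {fsfun seq nat -> int with 0} :=
  ClassicalEpsilon.epsilon (inhabits [fsfun]) (lr_expansion k l m).

(* c_{s,t}^u for strings s, t, u with the same length and number of ones *)
Definition LR (s t u : seq bool) : int :=
  lr_coef (count_mem true s) (string_part s) (string_part t) (string_part u).

Inductive label := L0 | L1 | L10.

Definition label_code (l : label) : option bool :=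
  match l with L0 => Some false | L1 => Some true | L10 => None end.
Definition label_decode (o : option bool) : label :=
  match o with Some false => L0 | Some true => L1 | None => L10 end.
Lemma label_codeK : cancel label_code label_decode. Proof. by case. Qed.
HB.instance Definition _ := Finite.copy label (can_type label_codeK).

Definition label_of_bit (b : bool) : label := if b then L1 else L0.

(* The point (x, y) is x u + y v with u = (1, 0) and v = (1/2, sqrt 3 / 2). *)
Definition point : Type := (nat * nat)%type.

Inductive dir := D0 | D60 | D120.

Definition dir_code (d : dir) : option bool :=
  match d with D0 => None | D60 => Some false | D120 => Some true end.
Definition dir_decode (o : option bool) : dir :=
  match o with None => D0 | Some false => D60 | Some true => D120 end.
Lemma dir_codeK : cancel dir_code dir_decode. Proof. by case. Qed.
HB.instance Definition _ := Finite.copy dir (can_type dir_codeK).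

Definition edge : Type := (dir * (nat * nat))%type.

Definition edge_ends (e : edge) : seq point :=
  let: (d, (x, y)) := e in
  match d with
  | D0 => [:: (x, y); (x.+1, y)]
  | D60 => [:: (x, y); (x, y.+1)]
  | D120 => [:: (x.+1, y); (x, y.+1)]
  end.

(* The edges of a unit triangle are listed clockwise. *)
Definition up_triangle (p : point) : seq edge :=
  let: (x, y) := p in [:: (D60, (x, y)); (D120, (x, y)); (D0, (x, y))].
Definition down_triangle (p : point) : seq edge :=
  let: (x, y) := p in [:: (D0, (x, y.+1)); (D60, (x.+1, y)); (D120, (x, y))].

Definition allowed_pieces : seq (seq label) :=
  [:: [:: L0; L0; L0]; [:: L1; L1; L1];
      [:: L1; L0; L10]; [:: L0; L10; L1]; [:: L10; L1; L0]].

(* The lattice points of the hexagon whose SW, NW, North and NE sides have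
   lengths A, B, C, D; its vertices are, clockwise from the corner between the
   South and SW sides,
     (A, 0), (0, A), (0, A+B), (C, A+B), (C+D, A+B-D), (C+D, 0). *)
Definition in_hex (A B C D : nat) (p : point) : bool :=
  [&& (p.1 <= C + D)%N, (p.2 <= A + B)%N & (A <= p.1 + p.2 <= A + B + C)%N].

(* All points of the hexagon, hence all the anchors (x, y) of its edges and of
   its triangles, are in this box. *)
Definition hex_box (A B C D : nat) : seq point :=
  [seq (x, y) | x <- iota 0 (C + D).+1, y <- iota 0 (A + B).+1].

(* By convexity, an edge or a triangle lies in the hexagon if and only if its
   vertices do. *)
Definition hex_edges (A B C D : nat) : seq edge :=
  [seq e <- [seq (d, p) | d <- [:: D0; D60; D120], p <- hex_box A B C D]
     | all (in_hex A B C D) (edge_ends e)].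

Definition hex_triangles (A B C D : nat) : seq (seq edge) :=
  [seq t <- [seq up_triangle p | p <- hex_box A B C D] ++
            [seq down_triangle p | p <- hex_box A B C D]
     | all (in_hex A B C D) (flatten (map edge_ends t))].

(* Clockwise: SW, NW, North, NE, SE, South. No subtraction is truncated, as
   A + B = D + E and C + D = Z + A in a closed hexagon. *)
Definition hex_boundary (A B C D E Z : nat) : seq edge :=
  mkseq (fun i => (D120, (A - i.+1, i)%N)) A ++
  mkseq (fun i => (D60, (0, A + i)%N)) B ++
  mkseq (fun i => (D0, (i, A + B)%N)) C ++
  mkseq (fun i => (D120, (C + i, A + B - i.+1)%N)) D ++
  mkseq (fun i => (D60, (C + D, E - i.+1)%N)) E ++
  mkseq (fun i => (D0, (C + D - i.+1, 0)%N)) Z.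

Definition label_at (es : seq edge) (f : {ffun seq_sub es -> label})
    (e : edge) : option label :=
  omap f (insub e).

Definition is_puzzle (es : seq edge) (ts : seq (seq edge)) (bd : seq edge)
    (w : seq bool) (f : {ffun seq_sub es -> label}) : bool :=
  ([seq label_at f e | e <- bd] == [seq Some (label_of_bit b) | b <- w]) &&
  all (fun t => [seq label_at f e | e <- t] \in
                [seq map Some p | p <- allowed_pieces]) ts.

Definition Hex (al be ga de ep ze : seq bool) : nat :=
  let A := size al in let B := size be in let C := size ga in
  let D := size de in let E := size ep in let Z := size ze in
  #|[set f : {ffun seq_sub (hex_edges A B C D) -> label} |
      is_puzzle (hex_triangles A B C D) (hex_boundary A B C D E Z)
        (al ++ be ++ ga ++ de ++ ep ++ ze) f]|.

(* Main.v *)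
(* Triangular puzzles multiply Schur polynomials: a line weighted by a variable
   can be moved from the NW side of the puzzle to its South side, one rhombus at
   a time, and on binary words it adds a horizontal or a vertical strip to a
   partition. Horizontal strips generate the
   Schur polynomials and vertical strips give their products with elementary
   symmetric polynomials; since both are compatible with puzzles, the number of
   triangular puzzles is the Littlewood-Richardson number.

   Gluing to the hexagon three corner triangles whose outer sides are sorted
   words, each of which has a single filling, turns it into a triangle. Its
   Littlewood-Richardson number splits into the stated sum of products, because
   a skew Schur polynomial whose two words are cut at the same place is a
   product. *)

Require Import Defs.
From HB Require Import structures.
From mathcomp Require Import finmap.
From mathcomp Require Import all_boot all_order all_algebra.
From mathcomp Require Import all_fingroup mpoly.
From mathcomp Require Import ring zify.

Set Implicit Arguments.
Unset Strict Implicit.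
Unset Printing Implicit Defensive.

Import GRing.Theory.
Local Open Scope ring_scope.

(** * Moving a line across a puzzle *)

(** A product of Schur polynomials is an identity between polynomials, whereas a puzzle of size n
    only knows words of length n: a 1 pushed past the left end is lost. The rule for multiplication
    by an elementary polynomial therefore holds on words only modulo the powers [X_i ^ n]
    ([overflow]), and it becomes exact once the words are padded on the left with enough zeros. Two
    families of strips occur because no scalar product on symmetric polynomials is introduced.
    Horizontal strips show that puzzle numbers are the coefficients of skew Schur polynomials;
    vertical strips show that the same numbers are the structure constants of the product. The
    second description gives commutativity, which also moves the sorted side of a corner triangle
    from NW to NE. In the final formula [mu] indexes the expansion of a skew factor. The string
    [theta] appears because two of the words of the remaining coefficient have the same zeros in
    front and the same ones behind: such a coefficient vanishes unless the third word,
    [0^{a0} mu 1^{a1}], has the form [0^{c0} theta 1^{e1}] as well. *)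

Definition piece (a b c : label) : bool :=
  match a, b, c with
  | L0, L0, L0 | L1, L1, L1 | L1, L0, L10 | L0, L10, L1 | L10, L1, L0 => true
  | _, _, _ => false
  end.

Lemma pieceE a b c : ([:: a; b; c] \in allowed_pieces) = piece a b c.
Proof. by case: a; case: b; case: c. Qed.

Definition labels : seq label := [:: L0; L1; L10].

Lemma mem_labels l : l \in labels. Proof. by case: l. Qed.

(* The lists below enumerate the fillings of a triangle from its NW side, one
   strip parallel to it after another; [rhombi x t] lists the pairs (right side, bottom side) of the rhombi with
   left side [x] and top side [t], whatever the label of the inner edge. *)
Definition up_bottoms (x m : label) : seq label := [seq s <- labels | piece x m s].

Definition rhombi (x t : label) : seq (label * label) :=
  [seq ys <- [seq (y, s) | y <- labels, s <- labels]
     | has (fun d => piece x d ys.2 && piece t ys.1 d) labels].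

Definition next_columns (x : label) (vt : seq label * label) :=
  [seq (ys.1 :: vt.1, ys.2) | ys <- rhombi x vt.2].

(* The pairs (right column, bottom label) of the fillings of a strip with left
   column [u], read upwards, and upper right edge [m]. *)
Fixpoint columns (u : seq label) (m : label) : seq (seq label * label) :=
  match u with
  | [::] => [::]
  | [:: x] => [seq ([::], s) | s <- up_bottoms x m]
  | x :: v => flatten [seq next_columns x vt | vt <- columns v m]
  end.

(* The South sides, read from left to right, of the puzzles with NW side [u], read
   upwards, and NE side [mu], read downwards. *)
Fixpoint triangles (u mu : seq label) : seq (seq label) :=
  match mu with
  | [::] => if u is [::] then [:: [::]] else [::]
  | m :: mu' =>
      flatten [seq [seq us.2 :: w | w <- triangles us.1 mu'] | us <- columns u m]
  end.

(** In state [CX] the line carries nothing. On binary words a carried 1 travels as [CY] along the NW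
    side and as [CZ] along the South side. *)
Inductive carry := CX | CY | CZ.

Definition carry_code (h : carry) : option bool :=
  match h with CX => None | CY => Some false | CZ => Some true end.
Definition carry_decode (o : option bool) : carry :=
  match o with None => CX | Some false => CY | Some true => CZ end.
Lemma carry_codeK : cancel carry_code carry_decode. Proof. by case. Qed.
HB.instance Definition _ := Equality.copy carry (can_type carry_codeK).

(* A line in state [h] meeting an edge labeled [x] replaces this label by [l] and
   goes on in state [h'] with weight [t ^+ a], for every [(a, (l, h'))] in the
   list. The two tables were found by solving [rhombus_exchange] and
   [top_exchange], which have a solution for each value of [e]. *)
Definition cross_left (e : bool) (h : carry) (x : label)
    : seq (nat * (label * carry)) :=
  match h, x with
  | CX, L0 => [:: (0, (L0, CX))]
  | CX, L1 => [:: (0, (L1, CX)); (0, (L0, CY)); (0, (L10, CZ))]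
  | CX, L10 => [:: (0, (L10, CX))]
  | CY, L0 => if e then [:: (1, (L1, CX))]
              else [:: (1, (L1, CX)); (1, (L0, CY)); (1, (L10, CZ))]
  | CY, L1 => if e then [:: (1, (L1, CY))] else [::]
  | CY, L10 => [::]
  | CZ, L0 => [:: (0, (L0, CZ))]
  | CZ, L1 => if e then [:: (1, (L1, CZ))] else [::]
  | CZ, L10 => if e then [:: (1, (L1, CX))]
               else [:: (1, (L1, CX)); (1, (L0, CY)); (1, (L10, CZ))]
  end%N.

Definition cross_bottom (e : bool) (h : carry) (s : label)
    : seq (nat * (label * carry)) :=
  match h, s with
  | CX, L0 => [:: (0, (L0, CX))]
  | CX, L1 => [:: (0, (L1, CX)); (0, (L0, CZ))]
  | CX, L10 => [:: (0, (L10, CX)); (0, (L0, CY))]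
  | CY, L0 => if e then [:: (1, (L10, CX))] else [:: (1, (L10, CX)); (1, (L0, CY))]
  | CY, L1 => if e then [:: (0, (L1, CY)); (1, (L10, CZ))] else [:: (0, (L1, CY))]
  | CY, L10 => if e then [:: (1, (L10, CY))] else [::]
  | CZ, L0 => if e then [:: (1, (L1, CX))] else [:: (1, (L1, CX)); (1, (L0, CZ))]
  | CZ, L1 => if e then [:: (1, (L1, CZ))] else [::]
  | CZ, L10 => if e then [:: (1, (L1, CY))] else [::]
  end%N.

Section Rhombus.
Variables (R : comPzRingType) (t : R) (e : bool).

(** An exchange relation of Yang-Baxter type: the line crosses the top and left edges of a rhombus,
    or else its right and bottom edges. The arbitrary [K] encodes an equality of weighted multisets
    of outcomes, which leaves a finite check. *)
Lemma rhombus_exchange h x l (K : label -> label -> carry -> R) :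
  \sum_(p <- cross_bottom e h l) t ^+ p.1 *
    (\sum_(q <- cross_left e p.2.2 x) t ^+ q.1 *
      (\sum_(r <- rhombi q.2.1 p.2.1) K r.1 r.2 q.2.2)) =
  \sum_(r <- rhombi x l)
    (\sum_(q <- cross_left e h r.1) t ^+ q.1 *
      (\sum_(p <- cross_bottom e q.2.2 r.2) t ^+ p.1 * K q.2.1 p.2.1 p.2.2)).
Proof.
case: e; case: h; case: x; case: l; rewrite /= ?(big_cons, big_nil) /=
 ?(big_cons, big_nil) /= ?(big_cons, big_nil) /= ?(big_cons, big_nil) /=; ring.
Qed.

(** The line enters a strip through its top triangle without crossing the NE edge. For [m] equal to
    [L10] this fails: with [x] equal to [L1] the left side keeps the term [K L1 CY] while the right
    side is empty. *)
Lemma top_exchange x m (K : label -> carry -> R) : m != L10 ->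
  \sum_(q <- cross_left e CX x) t ^+ q.1 *
    (\sum_(s <- up_bottoms q.2.1 m) K s q.2.2) =
  \sum_(s <- up_bottoms x m)
    (\sum_(p <- cross_bottom e CX s) t ^+ p.1 * K p.2.1 p.2.2).
Proof.
case: m => // _; case: e; case: x; rewrite /= ?(big_cons, big_nil) /=
 ?(big_cons, big_nil) /= ?(big_cons, big_nil) /= ?(big_cons, big_nil) /=; ring.
Qed.
End Rhombus.

(** The tail is treated first, so the line enters in state [CX] at the end of the word: at the top
    of a column read upwards, at the right end of a South side. *)
Fixpoint line (cr : carry -> label -> seq (nat * (label * carry))) (w : seq label)
    : seq (nat * (seq label * carry)) :=
  match w with
  | [::] => [:: (0%N, ([::], CX))]
  | x :: v =>
      flatten [seq [seq ((p.1 + q.1)%N, (q.2.1 :: p.2.1, q.2.2)) | q <- cr p.2.2 x]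
              | p <- line cr v]
  end.

Lemma size_line cr w p : p \in line cr w -> size p.2.1 = size w.
Proof.
elim: w p => [|x v IH] p /=; first by rewrite inE => /eqP ->.
by case/flatten_mapP=> q /IH qv /mapP [r _ ->] /=; rewrite qv.
Qed.

Section LineSweep.
Variables (R : comPzRingType) (t : R).

Lemma sum_line_cons cr x v (K : seq label -> carry -> R) :
  \sum_(p <- line cr (x :: v)) t ^+ p.1 * K p.2.1 p.2.2 =
  \sum_(p <- line cr v) t ^+ p.1 *
    (\sum_(q <- cr p.2.2 x) t ^+ q.1 * K (q.2.1 :: p.2.1) q.2.2).
Proof.
rewrite /= big_flatten big_map; apply: eq_bigr => p _.
by rewrite big_map mulr_sumr; apply: eq_bigr => q _; rewrite /= exprD mulrA.
Qed.

Lemma sum_columns_cons x v m (K : seq label -> label -> R) : v != [::] ->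
  \sum_(c <- columns (x :: v) m) K c.1 c.2 =
  \sum_(c <- columns v m) (\sum_(r <- rhombi x c.2) K (r.1 :: c.1) r.2).
Proof.
case: v => // y v _; rewrite [columns _ _]/= big_flatten big_map.
by apply: eq_bigr => c _; rewrite big_map.
Qed.

Lemma sum_triangles_cons u m mu (K : seq label -> R) :
  \sum_(w <- triangles u (m :: mu)) K w =
  \sum_(c <- columns u m) (\sum_(w <- triangles c.1 mu) K (c.2 :: w)).
Proof.
rewrite /= big_flatten big_map; apply: eq_bigr => c _.
by rewrite big_map.
Qed.

Variable e : bool.
Notation left := (line (cross_left e)).
Notation bottom := (line (cross_bottom e)).

Lemma column_sweep u m (K : seq label -> label -> carry -> R) : m != L10 ->
  \sum_(p <- left u) t ^+ p.1 * (\sum_(c <- columns p.2.1 m) K c.1 c.2 p.2.2) =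
  \sum_(c <- columns u m) (\sum_(p <- left c.1) t ^+ p.1 *
    (\sum_(q <- cross_bottom e p.2.2 c.2) t ^+ q.1 * K p.2.1 q.2.1 q.2.2)).
Proof.
move=> m10; elim: u K => [|x v IH] K.
  by rewrite /= !(big_cons, big_nil) mulr0 add0r.
rewrite (sum_line_cons _ _ _ (fun w h => \sum_(c <- columns w m) K c.1 c.2 h)).
have [->|v0] := eqVneq v [::].
  rewrite [left [::]]/= big_cons big_nil addr0 mul1r /=.
  under eq_bigr do rewrite big_map.
  rewrite (top_exchange t e x (fun s h => K [::] s h) m10) big_map.
  by apply: eq_bigr => s _; rewrite big_cons big_nil mul1r addr0.
rewrite (sum_columns_cons _ _ (fun u2 s2 => \sum_(p <- left u2) t ^+ p.1 *
    (\sum_(q <- cross_bottom e p.2.2 s2) t ^+ q.1 * K p.2.1 q.2.1 q.2.2))) //.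
transitivity (\sum_(p <- left v) t ^+ p.1 * \sum_(c <- columns p.2.1 m)
   \sum_(q <- cross_left e p.2.2 x) t ^+ q.1 *
     \sum_(r <- rhombi q.2.1 c.2) K (r.1 :: c.1) r.2 q.2.2).
  rewrite big_seq [RHS]big_seq; apply: eq_bigr => p pv.
  have {}pv : p.2.1 != [::] by move: v0; rewrite -!size_eq0 (size_line pv).
  rewrite exchange_big /=; congr (_ * _); apply: eq_bigr => q _.
  rewrite -mulr_sumr.
  by rewrite (sum_columns_cons _ _ (fun c s => K c s q.2.2)).
rewrite (IH (fun w l h => \sum_(q <- cross_left e h x) t ^+ q.1 *
     \sum_(r <- rhombi q.2.1 l) K (r.1 :: w) r.2 q.2.2)).
apply: eq_bigr => c _.
transitivity (\sum_(p <- left c.1) t ^+ p.1 * \sum_(r <- rhombi x c.2)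
   \sum_(q <- cross_left e p.2.2 r.1) t ^+ q.1 *
      \sum_(b <- cross_bottom e q.2.2 r.2) t ^+ b.1 *
        K (q.2.1 :: p.2.1) b.2.1 b.2.2).
  apply: eq_bigr => p _; congr (_ * _).
  by rewrite (rhombus_exchange t e _ _ _ (fun y s h => K (y :: p.2.1) s h)).
under eq_bigr do rewrite mulr_sumr.
rewrite exchange_big /=; apply: eq_bigr => r _.
by rewrite (sum_line_cons _ _ _ (fun w h => \sum_(b <- cross_bottom e h r.2)
  t ^+ b.1 * K w b.2.1 b.2.2)).
Qed.

Lemma triangle_sweep u mu (K : seq label -> carry -> R) : L10 \notin mu ->
  \sum_(p <- left u) t ^+ p.1 * (\sum_(w <- triangles p.2.1 mu) K w p.2.2) =
  \sum_(w <- triangles u mu) (\sum_(p <- bottom w) t ^+ p.1 * K p.2.1 p.2.2).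
Proof.
elim: mu u K => [|m mu IH] u K.
  move=> _; case: u => [|x v].
    by rewrite /= !(big_cons, big_nil) /= !addr0.
  rewrite [RHS]big_nil big_seq big1 // => p /size_line /=.
  by case: p.2.1 => //= *; rewrite big_nil mulr0.
rewrite inE negb_or eq_sym => /andP [m10 mu10].
rewrite (sum_triangles_cons _ _ _ (fun w => \sum_(p <- bottom w) _)).
under eq_bigr do rewrite (sum_triangles_cons _ _ _ (fun w => K w _)).
rewrite (column_sweep _ (fun v s h => \sum_(w <- triangles v mu) K (s :: w) h)) //.
apply: eq_bigr => c _.
under [RHS]eq_bigr do rewrite sum_line_cons.
rewrite -(IH c.1 (fun w h => \sum_(q <- cross_bottom e h c.2) t ^+ q.1 *
  K (q.2.1 :: w) q.2.2)) //.
apply: eq_bigr => p _; congr (_ * _).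
by rewrite exchange_big /=; apply: eq_bigr => q _; rewrite mulr_sumr.
Qed.
End LineSweep.

(** * Restriction to binary words *)

Definition bits (w : seq bool) : seq label := map label_of_bit w.

Definition is_one (l : label) : bool := if l is L1 then true else false.

Definition on_bits (R : nmodType) (F : seq bool -> R) (v : seq label) : R :=
  if L10 \in v then 0 else F (map is_one v).

Lemma map_is_one_bits w : map is_one (bits w) = w.
Proof. by elim: w => //= -[] w ->. Qed.

Lemma bits_binary w : L10 \notin bits w.
Proof. by elim: w => //= -[] w IH; rewrite inE negb_or IH. Qed.

Lemma on_bits_bits (R : nmodType) (F : seq bool -> R) w : on_bits F (bits w) = F w.
Proof. by rewrite /on_bits (negbTE (bits_binary w)) map_is_one_bits. Qed.

Lemma bits_is_one v : L10 \notin v -> bits (map is_one v) = v.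
Proof.
elim: v => //= x v IH; rewrite inE negb_or => /andP [x10 /IH ->].
by case: x x10.
Qed.

Lemma bits_inj : injective bits.
Proof. by move=> v w /(congr1 (map is_one)); rewrite !map_is_one_bits. Qed.

(* What remains of the two tables on binary words: each 1 moves to the left,
   which adds boxes to the partition. They form a vertical strip if [e], and a
   horizontal one otherwise; [c] tells whether a 1 is being carried. *)
Definition hop (e c b : bool) : seq (nat * (bool * bool)) :=
  match c, b with
  | false, false => [:: (0, (false, false))]
  | false, true => [:: (0, (true, false)); (0, (false, true))]
  | true, false => if e then [:: (1, (true, false))]
                   else [:: (1, (true, false)); (1, (false, true))]
  | true, true => if e then [:: (1, (true, true))] else [::]
  end%N.

Fixpoint strips (e c : bool) (w : seq bool) : seq (nat * (seq bool * bool)) :=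
  match w with
  | [::] => [:: (0%N, ([::], c))]
  | b :: v =>
      flatten [seq [seq ((p.1 + q.1)%N, (q.2.1 :: p.2.1, q.2.2)) | q <- hop e p.2.2 b]
              | p <- strips e c v]
  end.

Section Strips.
Variables (R : comPzRingType) (t : R) (e : bool).

Lemma sum_strips_cons c b v (K : seq bool -> bool -> R) :
  \sum_(p <- strips e c (b :: v)) t ^+ p.1 * K p.2.1 p.2.2 =
  \sum_(p <- strips e c v) t ^+ p.1 *
    (\sum_(q <- hop e p.2.2 b) t ^+ q.1 * K (q.2.1 :: p.2.1) q.2.2).
Proof.
rewrite /= big_flatten big_map; apply: eq_bigr => p _.
by rewrite big_map mulr_sumr; apply: eq_bigr => q _; rewrite /= exprD mulrA.
Qed.

(** On a binary word [L10] is written only on entering [CZ], and [CZ] is never left afterwards.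
    Discarding the final state [CZ] therefore keeps only binary outcomes, with [CY] as the carrying
    state. *)
Lemma left_line_bits w (K : seq label -> carry -> R) :
  \sum_(p <- line (cross_left e) (bits w)) t ^+ p.1 *
    (if p.2.2 is CZ then 0 else K p.2.1 p.2.2) =
  \sum_(p <- strips e false w) t ^+ p.1 *
    K (bits p.2.1) (if p.2.2 then CY else CX).
Proof.
elim: w K => [|b w IH] K; first by rewrite /= !(big_cons, big_nil).
rewrite (sum_strips_cons _ _ _ (fun w c => K (bits w) (if c then CY else CX))).
rewrite (sum_line_cons _ _ _ _ (fun w h => if h is CZ then 0 else K w h)).
transitivity (\sum_(p <- line (cross_left e) (bits w)) t ^+ p.1 *
    (if p.2.2 is CZ then 0 else
     \sum_(q <- cross_left e p.2.2 (label_of_bit b)) t ^+ q.1 *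
       (if q.2.2 is CZ then 0 else K (q.2.1 :: p.2.1) q.2.2))).
  apply: eq_bigr => -[n [v h]] _ /=; congr (_ * _).
  case: h => //; case: b; case: e;
    by rewrite /= !(big_cons, big_nil) /= ?mulr0 ?addr0.
rewrite (IH (fun v h => \sum_(q <- cross_left e h (label_of_bit b)) t ^+ q.1 *
       (if q.2.2 is CZ then 0 else K (q.2.1 :: v) q.2.2))).
apply: eq_bigr => -[n [v h]] _ /=; congr (_ * _).
by case: h; case: b; case: e; rewrite /= !(big_cons, big_nil) /= ?mulr0 ?addr0.
Qed.

(** State [CY] is left only by writing [L10], and an [L10] of the input is either kept or leads to
    [CY]. Binary outcomes with another final state thus come from binary words, with [CZ] as the
    carrying state. *)
Lemma bottom_line_bits v (K : seq bool -> bool -> R) :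
  \sum_(p <- line (cross_bottom e) v) t ^+ p.1 *
    (if p.2.2 is CY then 0 else
     on_bits (fun w => K w (if p.2.2 is CZ then true else false)) p.2.1) =
  on_bits (fun w => \sum_(p <- strips e false w) t ^+ p.1 * K p.2.1 p.2.2) v.
Proof.
elim: v K => [|s v IH] K; first by rewrite /on_bits /= !(big_cons, big_nil).
rewrite (sum_line_cons _ _ _ _ (fun w h => if h is CY then 0 else
  on_bits (fun w => K w (if h is CZ then true else false)) w)).
transitivity (\sum_(p <- line (cross_bottom e) v) t ^+ p.1 *
    (if p.2.2 is CY then 0 else on_bits (fun w => if s == L10 then 0 else
     \sum_(q <- hop e (if p.2.2 is CZ then true else false) (is_one s))
       t ^+ q.1 * K (q.2.1 :: w) q.2.2) p.2.1)).
  apply: eq_bigr => -[n [w h]] _ /=; congr (_ * _).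
  rewrite /on_bits; case Hw: (L10 \in w); case: h; case: s; case: e;
    rewrite /= ?(big_cons, big_nil) /= ?inE ?Hw /= ?mulr0 ?addr0
      ?(big_cons, big_nil) ?mulr0 ?addr0 //.
rewrite (IH (fun w c => if s == L10 then 0 else
     \sum_(q <- hop e c (is_one s)) t ^+ q.1 * K (q.2.1 :: w) q.2.2)).
rewrite /on_bits inE; case: eqVneq => [<-|s10] /=.
  by case: ifP => // _; rewrite big1 // => p _; rewrite mulr0.
case: ifP => // _; rewrite [map _ _]/= sum_strips_cons.
by [].
Qed.

(** Outcomes that still carry a 1 are the strips that do not fit in words of this length; they are
    dropped, so the number of ones is kept. *)
Definition strip_sum (K : seq bool -> R) (w : seq bool) : R :=
  \sum_(p <- strips e false w) t ^+ p.1 * (if p.2.2 then 0 else K p.2.1).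

Definition puzzle_sum (l m : seq bool) (K : seq bool -> R) : R :=
  \sum_(w <- triangles (bits l) (bits m)) on_bits K w.

(** This is [triangle_sweep] tested on the final state [CX]: a strip added to the NW word becomes a
    strip added to the South word, for a fixed NE word. *)
Lemma puzzle_strip_sum l m K :
  strip_sum (fun l' => puzzle_sum l' m K) l = puzzle_sum l m (strip_sum K).
Proof.
have := triangle_sweep t e (bits l)
  (fun w h => if h is CX then on_bits K w else 0) (bits_binary m).
rewrite /strip_sum /puzzle_sum => E; transitivity
 (\sum_(p <- line (cross_left e) (bits l)) t ^+ p.1 *
   (\sum_(w <- triangles p.2.1 (bits m))
      (if p.2.2 is CX then on_bits K w else 0))).
  apply: etrans (etrans (esym (left_line_bits l (fun v h =>
    if h is CX then \sum_(w <- triangles v (bits m)) on_bits K w else 0))) _).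
    by apply: eq_bigr => -[n [v []]].
  by apply: eq_bigr => -[n [v []]] _ //=; rewrite big1.
rewrite {}E; apply: eq_bigr => w _.
apply: etrans (bottom_line_bits w (fun w c => if c then 0 else K w)).
by apply: eq_bigr => -[n [v []]] _ //=; rewrite /on_bits; case: ifP.
Qed.
End Strips.

(** * Triangles whose NW side is the word of the empty partition *)

Definition sorted_word (i j : nat) : seq bool := nseq i false ++ nseq j true.

Lemma columns_cons x y v m : columns [:: x, y & v] m =
  flatten [seq next_columns x vt | vt <- columns (y :: v) m].
Proof. by []. Qed.

Lemma columns_ones j m : columns (nseq j.+1 L1) m =
  match m with
  | L0 => [:: (nseq j L1, L10)] | L1 => [:: (nseq j L1, L1)] | L10 => [::]
  end.
Proof.
elim: j => [|j IH]; first by case: m.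
rewrite columns_cons -/(nseq j.+1 L1) IH.
by case: m {IH}.
Qed.

Lemma bits_sorted_word i j : bits (sorted_word i j) = nseq i L0 ++ nseq j L1.
Proof. by rewrite /bits map_cat !map_nseq. Qed.

Lemma columns_sorted i j m : columns (bits (sorted_word i.+1 j)) m =
  match m, j with
  | L0, _ => [:: (bits (sorted_word i j), L0)]
  | L1, j'.+1 => [:: (bits (sorted_word i.+1 j'), L1)]
  | L1, 0 => [::]
  | L10, 0 => [:: (bits (sorted_word i j), L1)]
  | L10, _ => [::]
  end.
Proof.
elim: i => [|i IH].
  case: j => [|j]; first by case: m.
  rewrite bits_sorted_word columns_cons -/(nseq j.+1 L1) columns_ones.
  by case: m; rewrite ?bits_sorted_word.
rewrite [bits _]/= columns_cons -/(bits (sorted_word i.+1 j)) IH.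
by case: m {IH} => //; case: j.
Qed.

Arguments columns : simpl never.
Arguments sorted_word : simpl never.

(** Every strip is forced: a 0 of [m] removes a 0 from the sorted column, a 1 removes a 1. The empty
    partition is thus the unit for puzzles. *)
Lemma triangles_sorted m : triangles
  (bits (sorted_word (count_mem false m) (count_mem true m))) (bits m) = [:: bits m].
Proof.
elim: m => //= b m IH.
case: b; rewrite /= ?add0n ?add1n; last by rewrite columns_sorted /= IH ?cats0.
case E: (count_mem false m) IH => [|i] IH.
  rewrite bits_sorted_word columns_ones /= cats0.
  by move: IH; rewrite bits_sorted_word => ->.
by rewrite columns_sorted /= IH.
Qed.

(** The NE side is an arbitrary label word here, since it becomes an inner side when the triangle is
    glued to a hexagon. *)
Lemma count_triangles_sorted nu mu :
  count_mem (bits nu) (triangles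
    (bits (sorted_word (count_mem false nu) (count_mem true nu))) mu) = (mu == bits nu).
Proof.
elim: nu mu => [|b nu IH] mu; first by case: mu.
case: mu => [|m mu].
  by rewrite /= -/(bits nu); case: (bits (sorted_word _ _)).
case: b; rewrite /= ?add0n ?add1n; last first.
  rewrite columns_sorted eqseq_cons; case: m => //=.
  - rewrite cats0 count_map -IH.
    by apply: eq_count => w /=; rewrite eqseq_cons.
  - case: (count_mem true nu) => //= n; rewrite cats0 count_map.
    by rewrite (eq_count (a2 := pred0)) ?count_pred0.
  case: (count_mem true nu) => //= ; rewrite cats0 count_map.
  by rewrite (eq_count (a2 := pred0)) ?count_pred0.
case E: (count_mem false nu) IH => [|i] IH.
  rewrite bits_sorted_word columns_ones eqseq_cons.
  case: m => //=; rewrite cats0 count_map.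
    by rewrite (eq_count (a2 := pred0)) ?count_pred0.
  rewrite -IH bits_sorted_word.
  by apply: eq_count => w /=; rewrite eqseq_cons.
rewrite columns_sorted eqseq_cons; case: m => //=; rewrite cats0 count_map.
  by rewrite (eq_count (a2 := pred0)) ?count_pred0.
by rewrite -IH; apply: eq_count => w /=; rewrite eqseq_cons.
Qed.

Lemma puzzle_sum_sorted (R : comPzRingType) m (K : seq bool -> R) :
  puzzle_sum (sorted_word (count_mem false m) (count_mem true m)) m K = K m.
Proof.
by rewrite /puzzle_sum triangles_sorted big_cons big_nil addr0 on_bits_bits.
Qed.

Section Chain.
Variable R : comPzRingType.

Lemma eq_strip_sum (t : R) e K K' w : K =1 K' ->
  strip_sum t e K w = strip_sum t e K' w.
Proof. by move=> EK; apply: eq_bigr => p _; rewrite EK. Qed.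

Definition strips_sum (ts : seq R) (K : seq bool -> R) : seq bool -> R :=
  foldr (fun t => strip_sum t false) K ts.

Lemma strips_sum_rcons ts y K w :
  strips_sum (rcons ts y) K w = strips_sum ts (strip_sum y false K) w.
Proof. by rewrite /strips_sum foldr_rcons. Qed.

Lemma puzzle_strips_sum ts l m K :
  strips_sum ts (fun l' => puzzle_sum l' m K) l = puzzle_sum l m (strips_sum ts K).
Proof.
elim: ts l K => [|t ts IH] l K //=.
by rewrite -puzzle_strip_sum; apply: eq_strip_sum => w; exact: IH.
Qed.

(** For [K] the indicator of a word [n] this expands the skew Schur polynomial of [n] over [m] in
    Schur polynomials, with puzzle numbers as coefficients. *)
Lemma strips_sum_sorted ts m K :
  strips_sum ts (fun l => puzzle_sum l m K)
    (sorted_word (count_mem false m) (count_mem true m)) = strips_sum ts K m.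
Proof. by rewrite puzzle_strips_sum puzzle_sum_sorted. Qed.
End Chain.

Lemma size_strips e c w p : p \in strips e c w -> size p.2.1 = size w.
Proof.
elim: w p => [|b v IH] p /=; first by rewrite inE => /eqP ->.
by case/flatten_mapP=> q /IH qv /mapP [r _ ->] /=; rewrite qv.
Qed.

Lemma count_strips e c w p : p \in strips e c w ->
  (count_mem true p.2.1 + p.2.2 = count_mem true w + c)%N.
Proof.
elim: w p => [|b v IH] p /=; first by rewrite inE => /eqP ->.
case/flatten_mapP=> -[n [q d]] /IH /= qv /mapP [[m [b' d']] rq ->] /=.
rewrite -[RHS]addnA -qv; move: rq; rewrite /hop {IH}.
case: d {qv}; case: b; case: e => //; rewrite ?in_cons ?in_nil ?orbF //;
  do ?[case/orP]; move=> /eqP [_ -> ->] /=;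
  by rewrite ?(addn0, addnS, add0n, add1n).
Qed.

(** * Alternants and strips *)

Section ListDet.
Variable R : comNzRingType.
Implicit Types (pre post : seq (nat -> R)) (a b : nat -> R).

(** Rows are functions kept in a list, so that multilinear expansion is an edit of the form
    [pre ++ a :: post]. *)
Definition list_det (k : nat) (cs : seq (nat -> R)) : R :=
  \det (\matrix_(j < k, i < k) nth (fun=> 0) cs j i).

Lemma eq_list_det k cs cs' :
  (forall j i, (j < k)%N -> (i < k)%N ->
    nth (fun=> 0) cs j i = nth (fun=> 0) cs' j i) ->
  list_det k cs = list_det k cs'.
Proof. by move=> E; congr (\det _); apply/matrixP=> j i; rewrite !mxE E. Qed.

Lemma list_det_linear k pre a b (c : R) post : (size pre < k)%N ->
  list_det k (pre ++ (fun i => a i + c * b i) :: post) =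
  list_det k (pre ++ a :: post) + c * list_det k (pre ++ b :: post).
Proof.
move=> lt_pre; pose i0 := Ordinal lt_pre.
rewrite -[X in _ = X + _]mul1r; apply: (determinant_multilinear (i0 := i0)).
- by apply/rowP=> i; rewrite !mxE !nth_cat /= ltnn subnn /= mul1r.
- apply/matrixP=> j i; rewrite !mxE !nth_cat.
  have: val (lift i0 j) != val i0 by rewrite eq_sym neq_lift.
  rewrite /=; case: ltnP => // le_pre ne.
  by rewrite -(subnSK (m := size pre)) //= ltn_neqAle eq_sym ne.
apply/matrixP=> j i; rewrite !mxE !nth_cat.
have: val (lift i0 j) != val i0 by rewrite eq_sym neq_lift.
rewrite /=; case: ltnP => // le_pre ne.
by rewrite -(subnSK (m := size pre)) //= ltn_neqAle eq_sym ne.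
Qed.

Lemma list_det_alternate k pre a post : ((size pre).+1 < k)%N ->
  list_det k (pre ++ a :: a :: post) = 0.
Proof.
move=> lt_pre.
apply: (determinant_alternate (i1 := Ordinal (ltnW lt_pre)) (i2 := Ordinal lt_pre)).
  by rewrite -val_eqE /= neq_ltn ltnSn.
by move=> i; rewrite !mxE !nth_cat /= ltnn subnn ltnNge leqnSn subSnn.
Qed.

Lemma list_det_scale k (y : nat -> R) cs :
  list_det k [seq (fun i => y i * c i) | c <- cs] =
  (\prod_(i < k) y i) * list_det k cs.
Proof.
pose d := \row_(i < k) y i.
transitivity (\det ((\matrix_(j < k, i < k) nth (fun=> 0) cs j i) *m diag_mx d)).
  congr (\det _); apply/matrixP=> j i; rewrite mul_mx_diag !mxE mulrC.
  have [lt|ge] := ltnP j (size cs); first by rewrite (nth_map (fun=> 0)).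
  by rewrite !nth_default ?size_map // mulr0.
rewrite det_mulmx det_diag mulrC; congr (_ * _).
by apply: eq_bigr => i _; rewrite mxE.
Qed.

Lemma list_det_zero_last k cs : (forall j, (j <= k)%N -> nth (fun=> 0) cs j k = 0) ->
  list_det k.+1 cs = 0.
Proof.
move=> E; rewrite /list_det (expand_det_col _ ord_max) big1 // => j _.
by rewrite mxE E ?mul0r // -ltnS.
Qed.

Lemma list_det_drop_last k cs : size cs = k ->
  (forall c, c \in map (fun f => f k) cs -> c = 0) ->
  list_det k.+1 (rcons cs (fun=> 1)) = list_det k cs.
Proof.
move=> size_cs E; rewrite /list_det (expand_det_col _ ord_max).
rewrite (bigD1 ord_max) //= big1 ?addr0 => [|j ne].
  rewrite mxE nth_rcons size_cs ltnn eqxx mul1r /cofactor addnn -signr_odd odd_double.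
  rewrite expr0 mul1r; congr (\det _); apply/matrixP=> j i; rewrite !mxE.
  by rewrite nth_rcons size_cs !lift_max ltn_ord.
have lt_j : (j < k)%N by rewrite ltn_neqAle -ltnS ltn_ord andbT; move: ne; rewrite -val_eqE.
have := E (nth 0 [seq f k | f <- cs] j).
rewrite mem_nth ?size_map ?size_cs // => /(_ isT).
by rewrite (nth_map (fun=> 0)) ?size_cs // mxE nth_rcons size_cs lt_j => ->; rewrite mul0r.
Qed.

(** The number of letters to the right of a 1 is its part plus the number of later ones, which is
    its exponent in the alternant of the partition. *)
Fixpoint exponents (w : seq bool) : seq nat :=
  if w is b :: v then if b then size v :: exponents v else exponents v else [::].

Lemma size_exponents w : size (exponents w) = count_mem true w.
Proof. by elim: w => //= -[] w /= ->. Qed.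

Definition power_col (xs : seq R) (s i : nat) : R := nth 0 xs i ^+ s.

Definition alt (k : nat) (xs : seq R) (w : seq bool) : R :=
  list_det k [seq power_col xs s | s <- exponents w].

(** By multilinearity each row keeps its exponent or raises it by one, that is, its 1 stays or moves
    one step left; a choice with two equal rows vanishes, as [hop true] demands. A 1 pushed past the
    left end survives as a row of exponent [size w]. *)
Lemma vertical_strips_det k xs (u : R) w pre :
  (size pre + count_mem true w = k)%N ->
  list_det k (pre ++ [seq (fun i => power_col xs s i + u * power_col xs s.+1 i)
                         | s <- exponents w]) =
  \sum_(p <- strips true false w) u ^+ p.1 *
    (if p.2.2 then u * list_det k
        (pre ++ power_col xs (size w) :: [seq power_col xs s | s <- exponents p.2.1])
     else list_det k (pre ++ [seq power_col xs s | s <- exponents p.2.1])).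
Proof.
elim: w pre => [|b v IH] pre sz; first by rewrite /= big_cons big_nil mul1r addr0.
rewrite (sum_strips_cons _ _ _ _ _ (fun w (c : bool) => if c then u * list_det k
        (pre ++ power_col xs (size (b :: v)) :: [seq power_col xs s | s <- exponents w])
     else list_det k (pre ++ [seq power_col xs s | s <- exponents w]))).
case: b sz => /= sz.
  have lt_pre : (size pre < k)%N by rewrite -sz add1n addnS ltnS leq_addr.
  rewrite -cat_rcons IH; last by rewrite size_rcons addSnnS -sz.
  rewrite big_seq [RHS]big_seq.
  apply: eq_bigr => -[n [w c]] wv; have /= sw := size_strips wv.
  congr (_ * _); have /= cw := count_strips wv.
  (* A 1 carried out of [v] is a row of exponent [size v], equal to the unmoved row, so that only
     the moved row remains. *)
  case: c {wv} cw => cw; rewrite /= ?(big_cons, big_nil) /= sw cat_rcons list_det_linear //.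
    rewrite list_det_alternate ?add0r ?expr1 ?addr0 //.
    by rewrite -sz add1n addnS ltnS -(addn0 (count_mem _ v)) -cw addn1 addnS ltnS leq_addr.
  by rewrite expr0 !mul1r addr0.
rewrite IH // big_seq [RHS]big_seq.
apply: eq_bigr => -[n [w c]] /size_strips /= sw; congr (_ * _).
by case: c; rewrite /= ?(big_cons, big_nil) /= ?sw ?expr1 ?expr0 ?mul1r addr0.
Qed.
End ListDet.

(** * Enumeration of words and branching of alternants in the last variable *)

Fixpoint words (T : Type) (s : seq T) (n : nat) : seq (seq T) :=
  if n is n'.+1 then [seq x :: w | x <- s, w <- words s n'] else [:: [::]].

Lemma mem_words (T : eqType) (s : seq T) n w :
  (w \in words s n) = (size w == n) && all (mem s) w.
Proof.
elim: n w => [|n IH] [|x w] //=; first by apply/negP=> /flatten_mapP [? _ /mapP []].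
rewrite eqSS; apply/flatten_mapP/idP => [[y ys /mapP [v vn [-> ->]]]|].
  by move: vn; rewrite IH => /andP [-> ->]; rewrite andbT.
case/and3P=> sz xs ws; exists x => //; apply/mapP; exists w => //.
by rewrite IH sz.
Qed.

Lemma words_uniq (T : eqType) (s : seq T) n : uniq s -> uniq (words s n).
Proof.
move=> us; elim: n => //= n IH.
by apply: allpairs_uniq => // -[x v] [y w] _ _ /= [-> ->].
Qed.

Section Words.
Variables (T : Type) (s : seq T) (R : nmodType).

Lemma sum_words_cons n (F : seq T -> R) :
  \sum_(w <- words s n.+1) F w = \sum_(x <- s) \sum_(w <- words s n) F (x :: w).
Proof. by rewrite /= big_allpairs_dep. Qed.

Lemma sum_words_rcons n (F : seq T -> R) :
  \sum_(w <- words s n.+1) F w = \sum_(w <- words s n) \sum_(x <- s) F (rcons w x).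
Proof.
elim: n F => [|n IH] F.
  by rewrite sum_words_cons /= big_seq1; apply: eq_bigr => x _; rewrite big_seq1.
rewrite sum_words_cons [RHS]sum_words_cons.
by apply: eq_bigr => x _; rewrite IH.
Qed.

Lemma sum_words_cat m n (F : seq T -> R) :
  \sum_(w <- words s (m + n)) F w =
  \sum_(v <- words s m) \sum_(w <- words s n) F (v ++ w).
Proof.
elim: m F => [|m IH] F; first by rewrite /= big_seq1.
rewrite addSn sum_words_cons [RHS]sum_words_cons.
by apply: eq_bigr => x _; rewrite IH.
Qed.
End Words.

Notation bool_words := (words [:: false; true]).

Lemma mem_bool_words n w : (w \in bool_words n) = (size w == n).
Proof.
rewrite mem_words; case: eqP => //= _.
by apply/allP=> -[]; rewrite !inE.
Qed.

(* The reverse moves, along which a horizontal strip is removed. *)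
Definition unhop (c b : bool) : seq (nat * (bool * bool)) :=
  match c, b with
  | false, false => [:: (0, (false, false)); (0, (true, true))]
  | false, true => [:: (0, (true, false))]
  | true, false => [:: (1, (false, true))]
  | true, true => [:: (1, (false, false))]
  end%N.

Fixpoint unstrips (c : bool) (w : seq bool) : seq (nat * (seq bool * bool)) :=
  match w with
  | [::] => [:: (0%N, ([::], c))]
  | b :: v =>
      flatten [seq [seq ((p.1 + q.1)%N, (q.2.1 :: p.2.1, q.2.2)) | q <- unhop p.2.2 b]
              | p <- unstrips c v]
  end.

Lemma size_unstrips c w p : p \in unstrips c w -> size p.2.1 = size w.
Proof.
elim: w p => [|b v IH] p /=; first by rewrite inE => /eqP ->.
by case/flatten_mapP=> q /IH qv /mapP [r _ ->] /=; rewrite qv.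
Qed.

Lemma count_unstrips c w p : p \in unstrips c w ->
  (count_mem true p.2.1 + c = count_mem true w + p.2.2)%N.
Proof.
elim: w p => [|b v IH] p /=; first by rewrite inE => /eqP ->.
case/flatten_mapP=> -[n [q d]] /IH /= qv /mapP [[m [b' d']] rq ->] /=.
rewrite -addnA qv; move: rq; rewrite /unhop {IH}.
case: d {qv}; case: b => //; rewrite ?in_cons ?in_nil ?orbF //;
  do ?[case/orP]; move=> /eqP [_ -> ->] /=;
  by rewrite ?(addn0, addnS, addSn, add0n, add1n).
Qed.

Lemma nseq_rcons (T : Type) n (x : T) : nseq n.+1 x = rcons (nseq n x) x.
Proof. by elim: n => //= n ->. Qed.

Section Branching.
Variable R : comNzRingType.
Implicit Types (t y : R) (xs ts : seq R).

Lemma sum_unstrips_cons t c b v (K : seq bool -> bool -> R) :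
  \sum_(p <- unstrips c (b :: v)) t ^+ p.1 * K p.2.1 p.2.2 =
  \sum_(p <- unstrips c v) t ^+ p.1 *
    (\sum_(q <- unhop p.2.2 b) t ^+ q.1 * K (q.2.1 :: p.2.1) q.2.2).
Proof.
rewrite /= big_flatten big_map; apply: eq_bigr => p _.
by rewrite big_map mulr_sumr; apply: eq_bigr => q _; rewrite /= exprD mulrA.
Qed.

Lemma sum_strips_rcons t e c b v (K : seq bool -> bool -> R) :
  \sum_(p <- strips e c (rcons v b)) t ^+ p.1 * K p.2.1 p.2.2 =
  \sum_(q <- hop e c b) t ^+ q.1 *
    (\sum_(p <- strips e q.2.2 v) t ^+ p.1 * K (rcons p.2.1 q.2.1) p.2.2).
Proof.
elim: v K => [|a v IH] K.
  rewrite [rcons _ _]/= sum_strips_cons /= big_seq1 mul1r.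
  by apply: eq_bigr => q _; rewrite big_seq1 mul1r.
rewrite rcons_cons sum_strips_cons.
rewrite (IH (fun w c => \sum_(q <- hop e c a) t ^+ q.1 * K (q.2.1 :: w) q.2.2)).
apply: eq_bigr => q _; congr (_ * _).
by rewrite (sum_strips_cons _ _ _ _ _ (fun w c => K (rcons w _) c)).
Qed.

(** Transposition of the transition matrix: [unhop] lists the transitions of [hop false] by the
    letter written instead of the letter read. *)
Lemma strips_unstrips t n c (F : seq bool -> seq bool -> bool -> R) :
  \sum_(v <- bool_words n) (\sum_(p <- strips false c v) t ^+ p.1 * F v p.2.1 p.2.2) =
  \sum_(w <- bool_words n) (\sum_(p <- unstrips c w) t ^+ p.1 * F p.2.1 w p.2.2).
Proof.
elim: n F => [|n IH] F; first by rewrite /= !big_seq1.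
rewrite sum_words_cons.
under eq_bigr => a _ do under eq_bigr do rewrite sum_strips_cons.
under eq_bigr => a _ do rewrite (IH (fun v w c =>
  \sum_(q <- hop false c a) t ^+ q.1 * F (a :: v) (q.2.1 :: w) q.2.2)).
rewrite exchange_big sum_words_cons [RHS]exchange_big; apply: eq_bigr => w _ /=.
under [RHS]eq_bigr => b _ do rewrite (sum_unstrips_cons _ _ _ _ (fun v c => F v (b :: w) c)).
rewrite exchange_big [RHS]exchange_big; apply: eq_bigr => -[m [v d]] _ /=.
rewrite !(big_cons, big_nil) /= !addr0 -!mulrDr; congr (_ * _).
by case: d; rewrite /= !(big_cons, big_nil) /=; ring.
Qed.

(** If the last 1 were picked up, it would meet the 1 on its left, where [hop false] has no
    transition. *)
Lemma strip_sum_rcons2 y v (K : seq bool -> R) :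
  strip_sum y false K (rcons (rcons v true) true) =
  strip_sum y false (fun w => K (rcons w true)) (rcons v true).
Proof.
rewrite /strip_sum (sum_strips_rcons _ _ _ _ _ (fun w (c : bool) => if c then 0 else K w)).
rewrite /= !(big_cons, big_nil) /= !mul1r addr0.
rewrite [X in _ + X](sum_strips_rcons _ _ _ _ _
  (fun w (c : bool) => if c then 0 else K (rcons w false))).
by rewrite /= big_nil addr0.
Qed.

Lemma strip_sum_nseq y v j (K : seq bool -> R) :
  strip_sum y false K (v ++ nseq j.+1 true) =
  strip_sum y false (fun w => K (w ++ nseq j true)) (rcons v true).
Proof.
elim: j K => [|j IH] K.
  by rewrite cats1; apply: eq_strip_sum => w; rewrite cats0.
have -> : v ++ nseq j.+2 true = rcons (rcons (v ++ nseq j true) true) true.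
  by rewrite 2!nseq_rcons !rcons_cat.
rewrite strip_sum_rcons2 rcons_cat -nseq_rcons IH.
by apply: eq_strip_sum => w; rewrite rcons_cat -nseq_rcons.
Qed.

(** Each horizontal strip frees at most one more of the trailing ones, so [j] strips leave the last
    of [j.+1] in place: a tableau with [j] values has at most [j] rows. *)
Lemma strips_sum_nseq ts v j (K : seq bool -> R) : (size ts <= j)%N ->
  strips_sum ts K (v ++ nseq j.+1 true) =
  strips_sum ts (fun w => K (rcons w true)) (v ++ nseq j true).
Proof.
elim: ts v j K => [|t ts IH] v j K; first by move=> _; rewrite [RHS]/= rcons_cat -nseq_rcons.
case: j => // j; rewrite ltnS => le_ts.
rewrite -[LHS]/(strip_sum t false (strips_sum ts K) _) strip_sum_nseq.
rewrite -[RHS]/(strip_sum t false (strips_sum ts _) _) strip_sum_nseq.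
by apply: eq_strip_sum => w; apply: IH.
Qed.

Definition last_root_col xs k (s i : nat) : R :=
  (nth 0 xs i - nth 0 xs k) * nth 0 xs i ^+ s.

Lemma list_det_last_root xs k K s pre post : (size pre < K)%N ->
  list_det K (pre ++ power_col xs s.+1 :: post) =
  list_det K (pre ++ last_root_col xs k s :: post) +
  nth 0 xs k * list_det K (pre ++ power_col xs s :: post).
Proof.
move=> lt_pre; rewrite -list_det_linear //; apply: eq_list_det => j i _ _.
rewrite !nth_cat; case: ifP => // _; case: (j - size pre)%N => //=.
by rewrite /power_col /last_root_col exprS; ring.
Qed.

(** Each power [x ^ s] is divided repeatedly by [x - y]. The quotient rows vanish at the last
    variable; the remainder goes down until it meets the next exponent, where the determinant
    vanishes, or becomes the constant row. The second conclusion treats a word preceded by such a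
    remainder; the two are proved by one induction. The start state [~~ b] tells whether a remainder
    still has to supply the constant row. *)
Lemma branching_det xs k v b pre :
  (forall j, nth (fun=> 0) pre j k = 0) ->
  let y := nth 0 xs k in
  let K (p : seq bool) :=
    list_det k.+1 (pre ++ rcons [seq last_root_col xs k s | s <- exponents p] (fun=> 1)) in
  ((size pre + count_mem true (rcons v b) = k.+1)%N ->
   list_det k.+1 (pre ++ [seq power_col xs s | s <- exponents (rcons v b)]) =
   \sum_(p <- unstrips (~~ b) v) y ^+ p.1 * (if p.2.2 then 0 else K p.2.1)) /\
  ((size pre + count_mem true (rcons v b) = k)%N ->
   list_det k.+1 (pre ++ power_col xs (size v) ::
      [seq power_col xs s | s <- exponents (rcons v b)]) =
   \sum_(p <- unstrips (~~ b) v) y ^+ p.1 * (if p.2.2 then K p.2.1 else 0)).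
Proof.
move=> pre0 y; move: pre pre0; elim: v => [|a v IH] pre pre0 K.
  rewrite !big_seq1 /= !mul1r.
  case: b; rewrite /= /K ?cats0; split => sz.
  - by [].
  - by rewrite list_det_alternate // -sz addn1 !ltnS.
  - by rewrite list_det_zero_last // => j _; rewrite pre0.
  by [].
(* The row of a leading 1 splits into its quotient row, to which the first induction hypothesis
   applies, and [y] times its remainder, to which the second one applies. *)
have sum_true pre1 : (forall j, nth (fun=> 0) pre1 j k = 0) ->
    (size pre1 + count_mem true (rcons v b) = k)%N ->
    list_det k.+1 (pre1 ++ power_col xs (size v).+1 ::
      [seq power_col xs s | s <- exponents (rcons v b)]) =
    \sum_(p <- unstrips (~~ b) v) y ^+ p.1 * (if p.2.2
      then y * list_det k.+1 (pre1 ++ rcons [seq last_root_col xs k s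
                                            | s <- exponents p.2.1] (fun=> 1))
      else list_det k.+1 (pre1 ++ rcons [seq last_root_col xs k s
                                        | s <- exponents (true :: p.2.1)] (fun=> 1))).
  move=> pre10 sz; rewrite (list_det_last_root xs k); last by rewrite ltnS -sz leq_addr.
  have pre20 j : nth (fun=> 0) (rcons pre1 (last_root_col xs k (size v))) j k = 0.
    by rewrite nth_rcons; case: ifP => // _; case: eqP => // _;
      rewrite /last_root_col subrr mul0r.
  rewrite -cat_rcons (IH _ pre20).1; last by rewrite size_rcons addSn sz.
  rewrite (IH _ pre10).2 // mulr_sumr -big_split /= big_seq [RHS]big_seq.
  apply: eq_bigr => -[n [w c]] /size_unstrips /= ->.
  by case: c; rewrite ?cat_rcons /= -/y ?(mulr0, addr0, add0r) // mulrCA.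
split=> sz.
  rewrite (sum_unstrips_cons _ _ _ _ (fun p (c : bool) => if c then 0 else K p)).
  case: a sz => /= sz.
    rewrite size_rcons sum_true //; last by apply: succn_inj; rewrite -sz add1n addnS.
    apply: eq_bigr => -[n [w c]] _; congr (_ * _).
    by case: c; rewrite /= !(big_cons, big_nil) /= ?expr0 ?expr1 ?mul1r addr0.
  rewrite (IH _ pre0).1; last by rewrite -sz.
  apply: eq_bigr => -[n [w c]] _; congr (_ * _).
  by case: c; rewrite /= !(big_cons, big_nil) /= ?mulr0 ?mul1r ?addr0.
rewrite (sum_unstrips_cons _ _ _ _ (fun p (c : bool) => if c then K p else 0)).
case: a sz => /= sz.
  rewrite size_rcons list_det_alternate; last by rewrite ltnS -sz add1n addnS ltnS leq_addr.
  rewrite big1 // => -[n [w c]] _.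
  by case: c; rewrite /= !(big_cons, big_nil) /= !(mulr0, addr0).
rewrite sum_true //; apply: eq_bigr => -[n [w c]] _; congr (_ * _).
by case: c; rewrite /= !(big_cons, big_nil) /= ?mulr0 ?expr0 ?expr1 ?mul1r ?addr0 ?add0r.
Qed.

(** In the column of the last variable only the constant row is nonzero; once that row and column
    are removed, every column has a factor [x_i - y]. *)
Lemma alt_branching ts y v b :
  count_mem true (rcons v b) = (size ts).+1 ->
  alt (size ts).+1 (rcons ts y) (rcons v b) =
  (\prod_(i < size ts) (nth 0 ts i - y)) *
  \sum_(p <- unstrips (~~ b) v) y ^+ p.1 * (if p.2.2 then 0 else alt (size ts) ts p.2.1).
Proof.
move=> cnt; set k := size ts; rewrite /alt.
have [|E _] := @branching_det (rcons ts y) k v b [::]; first by move=> ?; rewrite nth_nil.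
rewrite {}E //.
rewrite big_distrr big_seq [RHS]big_seq /=; apply: eq_bigr => -[n [w c]] wv.
have /= := count_unstrips wv; rewrite nth_rcons ltnn eqxx /= mulrCA => cw.
congr (_ * _); case: c {wv} cw => cw; first by rewrite mulr0.
have {cw} cw : count_mem true w = k.
  move: cnt cw; rewrite -cats1 count_cat /= -/k.
  by case: b; lia.
rewrite list_det_drop_last ?size_map ?size_exponents //; last first.
  by move=> c; rewrite -map_comp => /mapP [s _ ->]; rewrite /= /last_root_col subrr mul0r.
rewrite -(list_det_scale k (fun i => nth 0 ts i - y)) -map_comp; apply: eq_list_det => j i _ lt_i.
have [lt_j|ge_j] := ltnP j (size (exponents w)); last by rewrite !nth_default ?size_map.
by rewrite !(nth_map 0%N) //= /last_root_col /power_col !nth_rcons ltnn eqxx lt_i.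
Qed.

Lemma sum_unstrips_sorted y i j (F : seq bool -> R) :
  \sum_(p <- unstrips false (sorted_word i j)) y ^+ p.1 * (if p.2.2 then 0 else F p.2.1) =
  F (sorted_word i j).
Proof.
elim: i F => [|i IH] F.
  rewrite /sorted_word /=; suff -> : unstrips false (nseq j true) =
    [:: (0%N, (nseq j true, false))] by rewrite big_seq1 mul1r.
  by elim: j => //= j ->.
rewrite -[sorted_word i.+1 j]/(false :: sorted_word i j).
rewrite (sum_unstrips_cons _ _ _ _ (fun w (c : bool) => if c then 0 else F w)).
rewrite -(IH (fun w => F (false :: w))); apply: eq_bigr => -[n [w c]] _.
by case: c; rewrite /= !(big_cons, big_nil) /= ?(mulr0, mul1r, addr0).
Qed.

Lemma count_sorted_word i j : count_mem true (sorted_word i j) = j.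
Proof. by rewrite count_cat !count_nseq /= mul0n mul1n. Qed.

(** The quotient-of-alternants formula for tableau sums, paired with an arbitrary [K]. The induction
    on the variables transposes the last strip and absorbs it by [alt_branching]. *)
Lemma alt_strips_sum ts n (K : seq bool -> R) :
  let k := size ts in
  alt k ts (sorted_word n k) * strips_sum ts K (sorted_word n k) =
  \sum_(w <- bool_words (n + k) | count_mem true w == k) alt k ts w * K w.
Proof.
move=> k; rewrite /k {k}; elim/last_ind: ts K => [|ts y IH] K.
  rewrite /sorted_word !cats0 addn0 /= big_mkcond (bigD1_seq (nseq n false)) /=;
    rewrite ?words_uniq ?mem_bool_words ?size_nseq // count_nseq /=.
  rewrite [X in _ + X]big_seq_cond big1 ?addr0 // => w.
  rewrite mem_bool_words => /andP [/eqP sw ne]; case: eqP => // cw; case/eqP: ne.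
  by rewrite -sw; apply/all_pred1P; rewrite all_count -[X in _ == X](count_predC (pred1 true) w)
    cw add0n; apply/eqP/eq_count => -[].
set k := size ts; rewrite size_rcons -/k.
have alt_sorted : alt k.+1 (rcons ts y) (sorted_word n k.+1) =
    (\prod_(i < k) (nth 0 ts i - y)) * alt k ts (sorted_word n k).
  have -> : sorted_word n k.+1 = rcons (sorted_word n k) true.
    by rewrite /sorted_word nseq_rcons -rcons_cat.
  by rewrite alt_branching ?sum_unstrips_sorted // -cats1 count_cat count_sorted_word addn1.
rewrite strips_sum_rcons strips_sum_nseq // -/(sorted_word n k) alt_sorted -mulrA.
rewrite -/k in IH; rewrite IH.
rewrite addnS [RHS]big_mkcond sum_words_rcons /=.
(* Here [b] is the last letter after the last strip; if it is 0, the final 1 has been picked up,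
   hence the start state [~~ b]. *)
pose G b (v w : seq bool) c :=
  if (count_mem true v == k) && ~~ c then alt k ts v * K (rcons w b) else 0.
transitivity ((\prod_(i < k) (nth 0 ts i - y)) *
  \sum_(b <- [:: false; true]) \sum_(v <- bool_words (n + k))
    \sum_(p <- strips false (~~ b) v) y ^+ p.1 * G b v p.2.1 p.2.2).
  congr (_ * _); rewrite exchange_big big_mkcond; apply: eq_bigr => v _ /=.
  rewrite /strip_sum (sum_strips_rcons _ _ _ _ _ (fun w (c : bool) => if c then 0 else K w)).
  rewrite /= !(big_cons, big_nil) /= !mul1r !addr0 addrC /G.
  case: eqP => cv /=; last by rewrite !big1 ?addr0 // => p _; rewrite mulr0.
  rewrite mulrDr !mulr_sumr; congr (_ + _); apply: eq_bigr => p _;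
    by rewrite mulrCA; case: p.2.2; rewrite /= ?mulr0.
rewrite (eq_bigr _ (fun b _ => strips_unstrips y (n + k) (~~ b) (G b))) /=.
rewrite exchange_big mulr_sumr /=; apply: eq_bigr => w _; rewrite mulr_sumr.
apply: eq_bigr => b _; case: eqP => [cw | cw].
  rewrite alt_branching // -mulrA mulr_suml; congr (_ * _).
  rewrite big_seq [RHS]big_seq; apply: eq_bigr => p /count_unstrips.
  rewrite /G -mulrA; case: p.2.2; first by rewrite andbF mul0r.
  rewrite addn0 andbT => cp; have -> : count_mem true p.2.1 = k; last by rewrite eqxx.
  by move: cw cp; rewrite -cats1 count_cat /=; case: b; lia.
rewrite [X in _ * X]big_seq [X in _ * X]big1 ?mulr0 // => p /count_unstrips; rewrite /G.
case: p.2.2; rewrite ?andbF ?mulr0 // addn0 andbT.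
case: eqP => [cp cp'|]; last by rewrite mulr0.
by case: cw; move: cp'; rewrite -cats1 count_cat cp /=; case: b; lia.
Qed.
End Branching.

(** * Leading terms of vertical strips *)

Fixpoint binary_value (w : seq bool) : nat :=
  if w is b :: v then (b * 2 ^ size v + binary_value v)%N else 0.

Lemma binary_value_cat v w :
  binary_value (v ++ w) = (binary_value v * 2 ^ size w + binary_value w)%N.
Proof. by elim: v => //= b v ->; rewrite size_cat expnD mulnDl mulnA addnA. Qed.

Lemma binary_value_lt w : (binary_value w < 2 ^ size w)%N.
Proof. by elim: w => //= -[] w /=; rewrite expnS; lia. Qed.

Lemma binary_value_ones j : (binary_value (nseq j true)).+1 = (2 ^ j)%N.
Proof. by elim: j => //= j IH; rewrite size_nseq expnS; lia. Qed.

Lemma binary_value_lt_pred w :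
  (count_mem true w < size w)%N -> ((binary_value w).+1 < 2 ^ size w)%N.
Proof.
elim: w => //= -[] w IH /=; rewrite expnS; last by have := binary_value_lt w; lia.
by rewrite add1n ltnS => /IH; lia.
Qed.

Section VerticalStripOrder.

(** The number [p.1 + p.2.2] is [c] plus the number of ones picked up. Shifting the whole word left
    doubles its value and adds [c]; the boolean summand records that any other strip gives a
    strictly smaller value. *)
Lemma strips_value c v p : p \in strips true c v ->
  (p.1 + p.2.2 <= c + count_mem true v)%N /\
  (binary_value p.2.1 + p.2.2 * 2 ^ size v + (p.1 + p.2.2 < c + count_mem true v)
     <= c + 2 * binary_value v)%N.
Proof.
elim: v p => [|b v IH] p; first by rewrite inE => /eqP -> /=; lia.
case/flatten_mapP=> -[n [w d]] wv; have /= [] := IH _ wv.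
have /= sw := size_strips wv; move: (count_mem true v) => k.
move=> le1 le2 /mapP [[m [b' d']] rq ->]; rewrite /= sw expnS.
have := expn_gt0 2 (size v); move: le1 le2 rq; rewrite /hop /=.
move: (2 ^ _)%N => s le1 le2 rq s0; move: rq le1 le2.
case: d {wv}; case: b => //; rewrite ?in_cons ?in_nil ?orbF //;
  do ?[case/orP]; move=> /eqP [-> -> ->] /=; lia.
Qed.

Variable R : nmodType.

Lemma strips_all_hop c v (F : seq bool -> R) :
  \sum_(p <- strips true c v | (p.1 + p.2.2 == c + count_mem true v)%N)
     F (p.2.2 :: p.2.1) = F (rcons v c).
Proof.
elim: v F => [|b v IH] F; first by rewrite /= big_cons big_nil /= addn0 add0n eqxx addr0.
rewrite /= -[F _](IH (fun w => F (b :: w))) big_flatten big_map.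
rewrite big_seq [RHS]big_seq_cond [RHS]big_mkcondr /=.
apply: eq_bigr => -[n [w d]] /strips_value [/=].
rewrite big_map; move: (count_mem true v) => k le _.
by case: d le; case: b; rewrite /= ?(big_cons, big_nil) /= ?addr0 => le;
  do ?[case: eqP => ?]; rewrite ?addr0 ?add0r //; lia.
Qed.

Lemma strips_no_hop v (F : seq bool -> R) :
  \sum_(p <- strips true false v | (p.1 + p.2.2 == 0)%N) F p.2.1 = F v.
Proof.
elim: v F => [|b v IH] F; first by rewrite /= big_cons big_nil /= addr0.
rewrite /= -[F _](IH (fun w => F (b :: w))) big_flatten big_map.
rewrite [RHS]big_mkcond /=; apply: eq_bigr => -[n [w d]] _; rewrite big_map.
by case: d; case: b; rewrite /= ?(big_cons, big_nil) /= ?(addr0, addn0, addn1, addn2).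
Qed.

Lemma sum_strips_cat e c v w (F : nat -> seq bool -> bool -> R) :
  \sum_(p <- strips e c (v ++ w)) F p.1 p.2.1 p.2.2 =
  \sum_(q <- strips e c w) \sum_(p <- strips e q.2.2 v)
     F (q.1 + p.1)%N (p.2.1 ++ q.2.1) p.2.2.
Proof.
elim: v F => [|b v IH] F.
  by apply: eq_bigr => q _; rewrite big_seq1 addn0.
rewrite /= big_flatten big_map.
under eq_bigr do rewrite big_map.
rewrite (IH (fun n w c => \sum_(q <- hop e c b) F (n + q.1)%N (q.2.1 :: w) q.2.2)).
apply: eq_bigr => q _; rewrite big_flatten big_map; apply: eq_bigr => p _.
by rewrite big_map; apply: eq_bigr => r _; rewrite addnA.
Qed.

Definition vertical_sum (r : nat) (K : seq bool -> R) (w : seq bool) : R :=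
  \sum_(p <- strips true false w | (p.1 == r) && ~~ p.2.2) K p.2.1.

Lemma vertical_sum_false r K w : vertical_sum r K (false :: w) =
  \sum_(p <- strips true false w | (p.1 + p.2.2 == r)%N) K (p.2.2 :: p.2.1).
Proof.
rewrite /vertical_sum /= big_flatten big_map [RHS]big_mkcond.
apply: eq_bigr => -[n [v d]] _; rewrite big_map.
by case: d; rewrite /= big_cons big_nil /= andbT addr0.
Qed.

(* Removing the first column of the partition of [v ++ false :: nseq j true]
   gives that of [false :: v ++ nseq j true]. *)
Lemma vertical_sum_lead v j (K : seq bool -> R) :
  let w := v ++ false :: nseq j true in
  exists2 s : seq (seq bool),
    vertical_sum (count_mem true v) K (false :: v ++ nseq j true) =
      K w + \sum_(x <- s) K x
  & forall x, x \in s -> [/\ size x = size w, count_mem true x = count_mem true w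
      & (binary_value x < binary_value w)%N].
Proof.
move=> w; set z := nseq j true.
(* A strip of the word is a strip [q] of the block of ones followed by a strip [p] of [v] that
   receives its carry. Under the size condition [cond], [full] forces [q] to move nothing and [p] to
   move everything: this is the leading word, and the witness collects all other pairs. *)
pose full (q p : nat * (seq bool * bool)) :=
  (p.1 + p.2.2 == q.2.2 + count_mem true v)%N.
pose cond (q p : nat * (seq bool * bool)) :=
  (q.1 + p.1 + p.2.2 == count_mem true v)%N.
pose word (q p : nat * (seq bool * bool)) := p.2.2 :: p.2.1 ++ q.2.1.
exists (flatten [seq [seq word q p | p <- strips true q.2.2 v & cond q p && ~~ full q p]
                | q <- strips true false z]).
  rewrite vertical_sum_false big_mkcond.
  rewrite (sum_strips_cat _ _ _ _ (fun n w (c : bool) =>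
    if (n + c == _)%N then K (c :: w) else 0)) big_flatten big_map /=.
  have -> : K w = \sum_(q <- strips true false z) \sum_(p <- strips true q.2.2 v)
      (if cond q p && full q p then K (word q p) else 0).
    rewrite /w -cat_rcons.
    apply: etrans (esym (strips_no_hop z (fun x => K (rcons v false ++ x)))) _.
    rewrite big_mkcond; apply: eq_bigr => -[n [y d]] _ /=; rewrite /cond /full /=.
    case: eqP => [/eqP|q0]; last first.
      by rewrite big1 // => p _; case: ifP => // /andP [/eqP ? /eqP ?]; lia.
    rewrite addn_eq0 => /andP [/eqP -> ]; case: d => // _.
    rewrite -(strips_all_hop false v (fun x => K (x ++ y))) big_mkcond.
    by apply: eq_bigr => p _; rewrite add0n andbb.
  rewrite -big_split; apply: eq_bigr => q _ /=.
  rewrite big_map big_filter [X in _ + X]big_mkcond -big_split.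
  apply: eq_bigr => p _ /=; rewrite -/(cond q p).
  by case: (cond q p); case: (full q p); rewrite /= ?addr0 ?add0r.
move=> x /flatten_mapP [[n1 [w1 c1]] qz /mapP [[n2 [w2 c2]]]].
rewrite mem_filter /full /cond /word /= => /andP [/andP [/eqP cnd nful] pv ->].
have /= sp := size_strips pv; have /= cp := count_strips pv.
have /= [le_p] := strips_value pv.
have -> : (n2 + c2 < c1 + count_mem true v)%N by rewrite ltn_neqAle nful.
have /= sq := size_strips qz.
have /= cq := count_strips qz.
have nz : count_mem true z = j by rewrite count_nseq mul1n.
have sz : size z = j by rewrite size_nseq.
rewrite nz in cq; rewrite sz in sq.
have := binary_value_lt w1; have := @binary_value_lt_pred w1.
rewrite /= /w !size_cat !count_cat !binary_value_cat /=.
rewrite ?size_cat sp sq -/z nz sz; have := binary_value_ones j; rewrite -/z !expnD expnS.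
have := expn_gt0 2 j; rewrite orTb.
move: (binary_value w1) (binary_value v) (binary_value w2) (binary_value z).
move: (2 ^ j)%N (2 ^ size v)%N (2 ^ 1)%N => y1 y2 y3 x1 x2 x3 x4.
move=> y1_gt0 hz hlt hw1 hv.
have {hv} := leq_mul hv (leqnn y1).
rewrite !mulnDl !mul1n -!mulnA (mulnCA x2) mul0n add0n => hv.
split; first by rewrite addnS.
  by move: cnd nful cp cq le_p; clear; case: c1; case: c2; lia.
(* A carry out of the block cancels the deficit of the prefix, but then the block has lost a 1 and
   its value is below [2 ^ j - 1]. *)
have {}hlt : c1 -> (x1.+1 < y1)%N.
  by move=> c1_true; apply: hlt; move: cq; rewrite c1_true addn0 addn1 => <-.
move: hv hlt hw1 hz y1_gt0.
move: (x3 * y1)%N (y2 * y1)%N (x2 * y1)%N => A B C; clear.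
by case: c1 => /=; [move=> ? /(_ isT)|move=> ? _]; lia.
Qed.
End VerticalStripOrder.

Lemma size_columns u m p : p \in columns u m -> size u = (size p.1).+1.
Proof.
elim: u p => [|x v IH] p //; case: v IH => [|y v] IH.
  by case/mapP=> s _ ->.
rewrite columns_cons => /flatten_mapP [q /IH qv /mapP [r _ ->]] /=.
by rewrite -qv.
Qed.

Lemma size_triangles u mu w : w \in triangles u mu ->
  size w = size mu /\ size u = size mu.
Proof.
elim: mu u w => [|m mu IH] u w; first by case: u => //; rewrite inE => /eqP ->.
case/flatten_mapP=> p /size_columns -> /mapP [v /IH [sv sp] ->].
by rewrite /= sv sp.
Qed.

(** * Multiplication of alternants by elementary symmetric polynomials *)

Section ConstantPolynomials.
Variable R : comNzRingType.

Lemma puzzle_sum_polyC l m (K : seq bool -> R) :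
  puzzle_sum l m (fun w => (K w)%:P) = (puzzle_sum l m K)%:P.
Proof.
rewrite /puzzle_sum rmorph_sum; apply: eq_bigr => w _.
by rewrite /on_bits; case: ifP.
Qed.

Lemma coef_strip_sum r w (K : seq bool -> R) :
  (strip_sum 'X true (fun w => (K w)%:P) w)`_r = vertical_sum r K w.
Proof.
rewrite /strip_sum /vertical_sum coef_sum [RHS]big_mkcond; apply: eq_bigr => p _.
case: p.2.2; first by rewrite mulr0 coef0 andbF.
by rewrite coefMC coefXn andbT eq_sym; case: eqP; rewrite ?mul1r ?mul0r.
Qed.

(** The sweep is applied over [{poly R}] with weight ['X]; the coefficient of degree [r] isolates
    the vertical strips with [r] boxes. *)
Lemma puzzle_vertical_sum r l m (K : seq bool -> R) :
  vertical_sum r (fun l' => puzzle_sum l' m K) l = puzzle_sum l m (vertical_sum r K).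
Proof.
rewrite -coef_strip_sum.
transitivity (strip_sum 'X true (fun l' => puzzle_sum l' m (fun w => (K w)%:P)) l)`_r.
  by congr (nth 0 (polyseq _) r); apply: eq_strip_sum => w; rewrite puzzle_sum_polyC.
rewrite puzzle_strip_sum /puzzle_sum coef_sum; apply: eq_bigr => w _.
by rewrite /on_bits; case: ifP => _; rewrite ?coef0 ?coef_strip_sum.
Qed.

Lemma list_det_polyC k (cs : seq (nat -> R)) :
  list_det k [seq (fun i => (c i)%:P) | c <- cs] = (list_det k cs)%:P.
Proof.
rewrite /list_det -det_map_mx; congr (\det _); apply/matrixP=> j i; rewrite !mxE.
have [lt|ge] := ltnP j (size cs); first by rewrite (nth_map (fun=> 0)).
by rewrite !nth_default ?size_map.
Qed.

Lemma list_det_power_polyC k (xs : seq R) es :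
  list_det k [seq power_col [seq x%:P | x <- xs] s | s <- es] =
  (list_det k [seq power_col xs s | s <- es])%:P.
Proof.
rewrite -list_det_polyC -map_comp; apply: eq_list_det => j i _ _.
have [lt|ge] := ltnP j (size es); last by rewrite !nth_default ?size_map.
rewrite !(nth_map 0%N) //= /power_col rmorphXn; congr (_ ^+ _).
have [lti|gei] := ltnP i (size xs); first by rewrite (nth_map 0).
by rewrite !nth_default ?size_map.
Qed.

Definition elementary (k : nat) (xs : seq R) (r : nat) : R :=
  (\prod_(i < k) (1 + 'X * (nth 0 xs i)%:P))`_r.

(** Scaling the column of [x_i] by [1 + 'X * x_i] turns [vertical_strips_det] into a product
    formula. The second sum is the defect due to the bounded length: the strips that push a 1 past
    the left end. *)
Lemma alt_elementary k xs r w : count_mem true w = k ->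
  elementary k xs r * alt k xs w = vertical_sum r (alt k xs) w +
    \sum_(p <- strips true false w | (p.1.+1 == r) && p.2.2)
      list_det k (power_col xs (size w) :: [seq power_col xs s | s <- exponents p.2.1]).
Proof.
move=> cw; pose ps := [seq x%:P | x <- xs].
have := @vertical_strips_det _ k ps 'X w [::] cw; rewrite /= => E.
have {}E : (\prod_(i < k) (1 + 'X * (nth 0 xs i)%:P)) * (alt k xs w)%:P =
    \sum_(p <- strips true false w) 'X ^+ p.1 *
    (if p.2.2 then 'X * (list_det k
        (power_col xs (size w) :: [seq power_col xs s | s <- exponents p.2.1]))%:P
     else (alt k xs p.2.1)%:P).
  rewrite /alt -list_det_power_polyC -(list_det_scale k (fun i => 1 + 'X * (nth 0 xs i)%:P)).
  rewrite -map_comp.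
  transitivity (list_det k [seq (fun i => power_col ps s i + 'X * power_col ps s.+1 i)
                           | s <- exponents w]).
    apply: eq_list_det => j i _ _.
    have [lt|ge] := ltnP j (size (exponents w)); last by rewrite !nth_default ?size_map.
    rewrite !(nth_map 0%N) //= /power_col exprS mulrDl mul1r -mulrA.
    congr (_ + 'X * (_ * _)).
    have [lti|gei] := ltnP i (size xs); first by rewrite (nth_map 0).
    by rewrite !nth_default ?size_map.
  rewrite E; apply: eq_bigr => p _; congr (_ * _); case: p.2.2.
    by rewrite -(list_det_power_polyC k xs (size w :: exponents p.2.1)).
  by rewrite list_det_power_polyC.
move/(congr1 (fun p : {poly R} => p`_r)): E; rewrite coefMC coef_sum => ->.
rewrite /vertical_sum [X in _ = X + _]big_mkcond [X in _ = _ + X]big_mkcond -big_split.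
apply: eq_bigr => -[n [v c]] _ /=; case: c; rewrite ?andbF ?andbT.
  by rewrite mulrA -exprSr coefMC coefXn eq_sym add0r; case: eqP; rewrite ?mul1r ?mul0r.
by rewrite coefMC coefXn eq_sym addr0; case: eqP; rewrite ?mul1r ?mul0r.
Qed.
End ConstantPolynomials.

(** * Alternants and Schur polynomials in the variables of the polynomial ring *)

Lemma exponents_lt w : all (fun s => s < size w)%N (exponents w).
Proof.
elim: w => //= b w IH; have {}IH : all (fun s => s < (size w).+1)%N (exponents w).
  by apply: sub_all IH => s /ltnW; rewrite ltnS.
by case: b => //=; rewrite ltnSn.
Qed.

Lemma exponents_sorted w : sorted gtn (exponents w).
Proof.
elim: w => //= -[] w IH //=; rewrite path_min_sorted //.
by have := exponents_lt w; apply: sub_all.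
Qed.

Lemma exponents_inj v w : size v = size w -> exponents v = exponents w -> v = w.
Proof.
elim: v w => [|a v IH] [|b w] //= [sz].
have notin (x : seq bool) (es : seq nat) : exponents x = size x :: es -> false.
  by move=> E; have := exponents_lt x; rewrite E /= ltnn.
case: a; case: b => E.
- by case: E => _ E; rewrite (IH w).
- by move: E; rewrite sz => /esym /notin.
- by move: E; rewrite -sz => /notin.
by rewrite (IH w).
Qed.

Lemma exponents_nseq_false n w : exponents (nseq n false ++ w) = exponents w.
Proof. by elim: n. Qed.

Section Polynomials.
Variable k : nat.
Notation poly := {mpoly int[k]}.

Definition vars : seq poly := [seq 'X_i | i <- enum 'I_k].

Lemma size_vars : size vars = k. Proof. by rewrite size_map size_enum_ord. Qed.

Lemma nth_vars (i : 'I_k) : nth 0 vars i = 'X_i.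
Proof. by rewrite (nth_map i) ?size_enum_ord // nth_ord_enum. Qed.

Definition power_det (l : seq nat) : poly :=
  list_det k [seq power_col vars s | s <- l].

Definition monom (l : seq nat) : 'X_{1..k} := [multinom nth 0%N l i | i < k].

Definition perm_monom (l : seq nat) (s : 'S_k) : 'X_{1..k} :=
  [multinom nth 0%N l ((s^-1)%g i) | i < k].

Lemma power_detE l : size l = k ->
  power_det l = \sum_(s : 'S_k) (-1) ^+ s * 'X_[perm_monom l s].
Proof.
move=> sl; apply: eq_bigr => s _; congr (_ * _).
rewrite mpolyXE_id [RHS](reindex_inj (@perm_inj _ s)) /=; apply: eq_bigr => j _.
by rewrite mxE (nth_map 0%N) ?sl // /power_col nth_vars mnmE -permM mulgV perm1.
Qed.

(** Only the identity permutation yields a monomial with decreasing exponents. The coefficients of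
    an expansion in alternants are therefore coefficients of the polynomial itself. *)
Lemma mcoeff_power_det (l l' : seq nat) : size l = k -> size l' = k ->
  sorted gtn l -> sorted gtn l' -> (power_det l)@_(monom l') = (l == l')%:R.
Proof.
move=> sl sl' ol ol'.
have gtr : transitive gtn by move=> x y z /= xy yz; exact: ltn_trans yz xy.
have irr : irreflexive gtn by move=> x; exact: ltnn.
rewrite power_detE // raddf_sum /=.
have term (s : 'S_k) : ((-1) ^+ s * 'X_[perm_monom l s] : poly)@_(monom l') =
    ((s == 1%g) && (l == l'))%:R.
  set m := perm_monom l s.
  have key : (s == 1%g) && (l == l') = (m == monom l').
    apply/andP/eqP => [[/eqP s1 /eqP <-]|E].
      by apply/mnmP=> i; rewrite !mnmE s1 invg1 perm1.
    have nthE (i : 'I_k) : nth 0%N l ((s^-1)%g i) = nth 0%N l' i.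
      by move/mnmP: E => /(_ i); rewrite !mnmE.
    have ll' : l = l'.
      apply: (irr_sorted_eq gtr irr ol ol') => x; apply/idP/idP => /(nthP 0%N) [j].
        rewrite sl => ltj <-; have := nthE (s (Ordinal ltj)).
        by rewrite -permM mulgV perm1 /= => ->; rewrite mem_nth ?sl'.
      by rewrite sl' => ltj <-; rewrite -(nthE (Ordinal ltj)) mem_nth ?sl.
    split; last by rewrite ll'.
    rewrite -(inj_eq invg_inj) invg1; apply/eqP/permP => i; rewrite perm1.
    apply/val_inj/eqP; rewrite -(nth_uniq 0%N _ _ (sorted_uniq gtr irr ol)) ?sl //=.
    by rewrite nthE -ll'.
  rewrite mulr_sign key; case: (boolP (m == monom l')) key => [/eqP Em|ne] key.
    by have /andP [/eqP -> _] := key; rewrite odd_perm1 mcoeffX Em eqxx.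
  by case: ifP; rewrite ?mcoeffN mcoeffX (negbTE ne) ?oppr0.
rewrite (eq_bigr _ (fun s _ => term s)) (bigD1 1%g) //= eqxx big1 ?addr0 //.
by move=> s /negbTE ->.
Qed.

Notation altw := (alt k vars).

Lemma mcoeff_alt v w : count_mem true v = k -> count_mem true w = k ->
  (altw v)@_(monom (exponents w)) = (exponents v == exponents w)%:R.
Proof.
by move=> cv cw; apply: mcoeff_power_det; rewrite ?size_exponents ?exponents_sorted.
Qed.

Lemma mcoeff_alt_ge w (m : 'X_{1..k}) i : count_mem true w = k ->
  (size w <= m i)%N -> (altw w)@_m = 0.
Proof.
move=> cw le_m; have sw := size_exponents w; rewrite cw in sw.
rewrite (_ : altw w = power_det (exponents w)) // power_detE // raddf_sum big1 // => s _ /=.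
rewrite mulr_sign; case: (eqVneq (perm_monom (exponents w) s) m) => [E|ne].
  move: le_m; rewrite -E mnmE leqNgt.
  by rewrite (allP (exponents_lt w)) // mem_nth ?sw.
by case: ifP; rewrite ?mcoeffN mcoeffX (negbTE ne) ?oppr0.
Qed.

Lemma alt_neq0 w : count_mem true w = k -> altw w != 0.
Proof.
move=> cw; apply/eqP => E; have := mcoeff_alt cw cw.
by rewrite E mcoeff0 eqxx => /eqP; rewrite eq_sym oner_eq0.
Qed.

(* The ideal of the polynomials all of whose monomials are divisible by some
   [X_i ^ n]: it is what a puzzle of size [n] does not see. *)
Definition overflow (n : nat) (p : poly) : Prop :=
  forall m : 'X_{1..k}, (forall i, m i < n)%N -> p@_m = 0.

Lemma overflow0 n : overflow n 0.
Proof. by move=> m _; rewrite mcoeff0. Qed.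

Lemma overflowD n p q : overflow n p -> overflow n q -> overflow n (p + q).
Proof. by move=> Ip Iq m lt; rewrite mcoeffD Ip ?Iq ?addr0. Qed.

Lemma overflowN n p : overflow n p -> overflow n (- p).
Proof. by move=> Ip m lt; rewrite mcoeffN Ip ?oppr0. Qed.

Lemma overflowB n p q : overflow n p -> overflow n q -> overflow n (p - q).
Proof. by move=> Ip Iq; apply/overflowD/overflowN. Qed.

Lemma overflow_sum n (I : eqType) (r : seq I) (P : pred I) F :
  (forall i, i \in r -> P i -> overflow n (F i)) ->
  overflow n (\sum_(i <- r | P i) F i).
Proof.
move=> IF; rewrite big_seq_cond; apply: (big_ind (overflow n)).
- exact: overflow0.
- exact: overflowD.
by move=> i /andP [ir Pi]; apply: IF.
Qed.

Lemma overflowM n p q : overflow n q -> overflow n (p * q).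
Proof.
move=> Iq m lt; rewrite mcoeffM big1 // => b /eqP E.
rewrite Iq ?mulr0 // => i; apply: leq_ltn_trans (lt i).
by move/mnmP: E => /(_ i); rewrite mnmDE => ->; rewrite leq_addl.
Qed.

Lemma overflow_power n cs : (0 < k)%N -> overflow n (list_det k (power_col vars n :: cs)).
Proof.
move=> k_gt0; rewrite /list_det (expand_det_row _ (Ordinal k_gt0)).
apply: overflow_sum => i _ _; rewrite mxE mulrC; apply: overflowM => m lt.
rewrite /= /power_col nth_vars mpolyXn mcoeffX; case: eqP => // E.
by have := lt i; rewrite -E mulmnE mnm1E eqxx mul1n ltnn.
Qed.

Lemma alt_sorted_word n : altw (sorted_word n k) = altw (nseq k true).
Proof. by rewrite /alt exponents_nseq_false. Qed.

Lemma count_ones j : count_mem true (nseq j true) = j.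
Proof. by rewrite count_nseq mul1n. Qed.

Lemma count_false_true (w : seq bool) :
  (count_mem false w + count_mem true w)%N = size w.
Proof. by elim: w => //= -[] w /=; lia. Qed.

(** The generating polynomial of semistandard tableaux: chains from the empty partition to that of
    [w], with one horizontal strip per variable. *)
Definition schur_poly (w : seq bool) : poly :=
  strips_sum vars (fun v => (v == w)%:R) (sorted_word (count_mem false w) k).

Lemma alt_schur_poly w : count_mem true w = k ->
  altw (nseq k true) * schur_poly w = altw w.
Proof.
move=> cw; have := alt_strips_sum vars (count_mem false w) (fun v => (v == w)%:R).
rewrite /= size_vars alt_sorted_word /schur_poly => ->.
have -> : (count_mem false w + k)%N = size w by rewrite -count_false_true cw.
rewrite big_mkcond (bigD1_seq w) ?words_uniq ?mem_bool_words //= cw !eqxx /=.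
rewrite mulr1n [X in X + _]mulr1 [X in _ + X]big1 ?addr0; first by [].
by move=> v /negbTE ->; rewrite mulr0n mulr0 if_same.
Qed.

Lemma mul_alt_inj p q : altw (nseq k true) * p = altw (nseq k true) * q -> p = q.
Proof. by apply: mulfI; rewrite alt_neq0 ?count_ones. Qed.

Lemma vertical_alt r w : count_mem true w = k ->
  overflow (size w) (vertical_sum r altw w - elementary k vars r * altw w).
Proof.
move=> cw; rewrite (alt_elementary _ _ cw) opprD addrA subrr add0r.
apply/overflowN/overflow_sum => p /count_strips cp /andP [_ c].
by apply: overflow_power; move: cp; rewrite cw c; lia.
Qed.

(** A leading 0 absorbs any carried 1, so no strip is lost and the rule is exact. The default [true]
    of [head] excludes the empty word. *)
Lemma vertical_schur r w : count_mem true w = k -> head true w = false ->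
  vertical_sum r schur_poly w = elementary k vars r * schur_poly w.
Proof.
move=> cw hw; apply: mul_alt_inj; rewrite mulrCA (alt_schur_poly cw).
rewrite (alt_elementary _ _ cw) [X in _ + X]big1_seq ?addr0.
  rewrite /vertical_sum big_distrr big_seq_cond [RHS]big_seq_cond /=.
  apply: eq_bigr => p /and3P [/count_strips cp _ /negbTE c].
  by rewrite alt_schur_poly // -cw; move: cp; rewrite c !addn0.
case: w hw {cw} => [//|b w /= ->] p /andP [/andP [_ c]].
case/flatten_mapP => -[n [v d]] _ /mapP [q]; move: c.
by case: d => /= c; rewrite ?inE => /eqP -> E; rewrite E in c.
Qed.

Lemma schur_poly_ones n : schur_poly (sorted_word n k) = 1.
Proof.
apply: mul_alt_inj; rewrite alt_schur_poly ?mulr1 ?alt_sorted_word //.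
exact: count_sorted_word.
Qed.

End Polynomials.

Lemma piece_rot a b c : piece a b c = piece b c a.
Proof. by case: a; case: b; case: c. Qed.

(** * Triangular puzzles count Littlewood-Richardson numbers *)

Section Conservation.
Variables (f g h : label -> int).
Hypothesis piece_sum0 : forall x d s, piece x d s -> f x + g d + h s = 0.

(** A discrete Stokes formula: by [piece_rot] a down triangle satisfies the same relation as an up
    triangle, so the inner edges cancel. *)
Lemma columns_conserved u m p : p \in columns u m ->
  \sum_(x <- u) f x + g m + h p.2 = \sum_(y <- p.1) f y.
Proof.
elim: u p => [|x v IH] p //; case: v IH => [|y v] IH.
  case/mapP=> s; rewrite mem_filter => /andP [/piece_sum0 E _] -> /=.
  by rewrite big_seq1 big_nil.
rewrite columns_cons => /flatten_mapP [q /IH qv /mapP [r]].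
rewrite mem_filter => /andP [/hasP [d _ /andP [/piece_sum0 E1]]].
rewrite piece_rot => /piece_sum0 E2 _ -> /=.
rewrite big_cons [RHS]big_cons -qv; move: E1 E2.
move: (f x) (f r.1) (h r.2) (h q.2) (g d) (g m) => a1 a2 a3 a4 a5 a6.
by move: (\sum_(i <- y :: v) f i) => S; lia.
Qed.

Lemma triangles_conserved u mu w : w \in triangles u mu ->
  \sum_(x <- u) f x + \sum_(m <- mu) g m + \sum_(s <- w) h s = 0.
Proof.
elim: mu u w => [|m mu IH] u w.
  by case: u => //; rewrite inE => /eqP ->; rewrite !big_nil.
case/flatten_mapP=> p /columns_conserved pu /mapP [v /IH E ->].
rewrite !big_cons -[RHS]E -pu; ring.
Qed.
End Conservation.

Lemma sum_count (P : pred label) (s : seq label) :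
  \sum_(x <- s) (P x : nat)%:Z = (count P s)%:Z.
Proof. by elim: s => [|x s IH]; rewrite ?big_nil // big_cons IH. Qed.

(** The three weights sum to zero on each of the five pieces. When [mu] and the other sides are
    binary, this says that the NW and South sides have equally many zeros. *)
Lemma triangles_count_left u mu w : w \in triangles u mu ->
  count (predC1 L1) u = (count_mem L10 mu + count_mem L0 w)%N.
Proof.
have pc x d s : piece x d s ->
    (x != L1 : nat)%:Z + (- (d == L10 : nat)%:Z) + (- (s == L0 : nat)%:Z) = 0.
  by case: x; case: d; case: s.
move/(@triangles_conserved (fun x => (x != L1 : nat)%:Z)
  (fun x => (- (x == L10 : nat)%:Z)) (fun x => (- (x == L0 : nat)%:Z)) pc).
rewrite ?sumrN (sum_count (predC1 L1)) (sum_count (pred1 L10)) (sum_count (pred1 L0)).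
have lin (a b c : nat) : a%:Z - b%:Z - c%:Z = 0 :> int -> a = (b + c)%N by lia.
exact: lin.
Qed.

Lemma triangles_count_right u mu w : w \in triangles u mu ->
  count (predC1 L1) mu = (count_mem L10 w + count_mem L0 u)%N.
Proof.
have pc x d s : piece x d s ->
    (- (x == L0 : nat)%:Z) + (d != L1 : nat)%:Z + (- (s == L10 : nat)%:Z) = 0.
  by case: x; case: d; case: s.
move/(@triangles_conserved (fun x => (- (x == L0 : nat)%:Z))
  (fun x => (x != L1 : nat)%:Z) (fun x => (- (x == L10 : nat)%:Z)) pc).
rewrite ?sumrN (sum_count (predC1 L1)) (sum_count (pred1 L10)) (sum_count (pred1 L0)).
have lin (a b c : nat) : - c%:Z + a%:Z - b%:Z = 0 :> int -> a = (b + c)%N by lia.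
exact: lin.
Qed.

Lemma triangles_count_bottom u mu w : w \in triangles u mu ->
  count (predC1 L1) w = (count_mem L10 u + count_mem L0 mu)%N.
Proof.
have pc x d s : piece x d s ->
    (- (x == L10 : nat)%:Z) + (- (d == L0 : nat)%:Z) + (s != L1 : nat)%:Z = 0.
  by case: x; case: d; case: s.
move/(@triangles_conserved (fun x => (- (x == L10 : nat)%:Z))
  (fun x => (- (x == L0 : nat)%:Z)) (fun x => (x != L1 : nat)%:Z) pc).
rewrite ?sumrN (sum_count (predC1 L1)) (sum_count (pred1 L10)) (sum_count (pred1 L0)).
have lin (a b c : nat) : - b%:Z - c%:Z + a%:Z = 0 :> int -> a = (b + c)%N by lia.
exact: lin.
Qed.

Lemma count_bits_L0 w : count_mem L0 (bits w) = count_mem false w.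
Proof. by rewrite count_map; apply: eq_count => -[]. Qed.

Lemma count_bits_neq1 w : count (predC1 L1) (bits w) = count_mem false w.
Proof. by rewrite count_map; apply: eq_count => -[]. Qed.

Lemma count_bits_L10 w : count_mem L10 (bits w) = 0%N.
Proof. by rewrite count_map (eq_count (a2 := pred0)) ?count_pred0 // => -[]. Qed.

Lemma count_triangles_bits l m w : bits w \in triangles (bits l) (bits m) ->
  count_mem true w = count_mem true l.
Proof.
move=> wt; have [] := size_triangles wt; have := triangles_count_left wt.
rewrite count_bits_neq1 count_bits_L10 count_bits_L0 !size_map.
rewrite -!count_false_true; lia.
Qed.

Section PuzzleProduct.
Variable k : nat.
Notation altw := (alt k (vars k)).

Lemma trailing_ones (w : seq bool) : exists j,
  w = nseq j true \/ exists v, w = v ++ false :: nseq j true.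
Proof.
elim/last_ind: w => [|w [] [j [->|[v ->]]]]; first by exists 0%N; left.
- by exists j.+1; left; rewrite nseq_rcons.
- by exists j.+1; right; exists v; rewrite nseq_rcons rcons_cat.
- by exists 0%N; right; exists (nseq j true); rewrite cats1.
by exists 0%N; right; exists (v ++ false :: nseq j true); rewrite cats1.
Qed.

Lemma no_ones (w : seq bool) : count_mem true w = 0%N -> w = nseq (size w) false.
Proof. by elim: w => //= -[] w IH //= /IH {1}->. Qed.

Lemma overflow_puzzle_sum l m (K K' : seq bool -> {mpoly int[k]}) :
  (forall w, size w = size m -> count_mem true w = count_mem true l ->
     overflow (size m) (K w - K' w)) ->
  overflow (size m) (puzzle_sum l m K - puzzle_sum l m K').
Proof.
move=> E; rewrite /puzzle_sum -sumrB; apply: overflow_sum => w wt _.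
rewrite /on_bits; case: ifP => [_|/negbT w10].
  by rewrite subrr; apply: overflow0.
have wb := bits_is_one w10; apply: E.
  by have [] := size_triangles wt; rewrite !size_map.
by apply: (@count_triangles_bits l m); rewrite wb.
Qed.

(** Induction on the binary value of [l]. By [vertical_sum_lead], [l] is the leading word when
    vertical strips of size [r] are added to the smaller word [z], and all other words are smaller
    too. Puzzle sums and products by Schur polynomials obey the same rule for these strips, up to
    overflow. *)
Lemma puzzle_product l m : size l = size m -> count_mem true l = k ->
  count_mem true m = k ->
  overflow (size m) (puzzle_sum l m altw - schur_poly k l * altw m).
Proof.
move=> slm cl cm; have [n] := ubnP (binary_value l).
elim: n l slm cl => // n IH l slm cl; rewrite ltnS => le_n.
have sorted_case i : l = sorted_word i k ->
    overflow (size m) (puzzle_sum l m altw - schur_poly k l * altw m).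
  move=> El; have Ei : count_mem false m = i.
    move: slm; rewrite El size_cat !size_nseq -(count_false_true m) cm; lia.
  rewrite El schur_poly_ones mul1r.
  have -> : sorted_word i k = sorted_word (count_mem false m) (count_mem true m).
    by rewrite Ei cm.
  by rewrite puzzle_sum_sorted subrr; apply: overflow0.
have [j [El|[v El]]] := trailing_ones l.
  apply: (sorted_case 0%N); rewrite El /sorted_word /=.
  by rewrite -cl El count_ones.
have [v0|v_pos] := posnP (count_mem true v).
  apply: (sorted_case (size v).+1); rewrite El {1}(no_ones v0) /sorted_word.
  have -> : k = j by rewrite -cl El count_cat v0 /= count_ones.
  by rewrite -cat_rcons -nseq_rcons.
have [s Es Hs] := vertical_sum_lead v j
  (fun x => puzzle_sum x m altw - schur_poly k x * altw m).
set z := false :: v ++ nseq j true in Es; set r := count_mem true v in Es.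
have sz : size z = size m by rewrite -slm El /= !size_cat /= addnS.
have cz : count_mem true z = k by rewrite -cl El /= !count_cat.
have lt_z : (binary_value z < n)%N.
  apply: leq_trans le_n; rewrite El /= !binary_value_cat /= size_nseq.
  have := binary_value_ones j; have := expn_gt0 2 j; rewrite expnS.
  have : (0 < binary_value v)%N.
    rewrite lt0n; apply: contraTneq v_pos.
    by elim: (v) => //= -[] x IHx //=; have := expn_gt0 2 (size x); lia.
  move: (2 ^ j)%N (binary_value v) (binary_value (nseq j true)) => a b c.
  by move=> b0 a0 <-; nia.
have Iz := IH z sz cz lt_z.
set d := fun x => puzzle_sum x m altw - schur_poly k x * altw m in Es.
have -> : puzzle_sum l m altw - schur_poly k l * altw m =
    vertical_sum r d z - \sum_(x <- s) d x by rewrite Es El addrK.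
apply: overflowB; last first.
  apply: overflow_sum => x xs _; have [sx cx lt_x] := Hs x xs.
  apply: IH; rewrite ?sx ?cx -?El //.
  by apply: leq_trans le_n; rewrite El.
(* The first difference is the defect of the rule on South words, the second a multiple of the
   induction hypothesis at [z]. *)
have -> : vertical_sum r d z =
   (puzzle_sum z m (vertical_sum r altw) -
    puzzle_sum z m (fun w => elementary k (vars k) r * altw w)) +
   elementary k (vars k) r * (puzzle_sum z m altw - schur_poly k z * altw m).
  have -> : puzzle_sum z m (fun w => elementary k (vars k) r * altw w) =
      elementary k (vars k) r * puzzle_sum z m altw.
    rewrite /puzzle_sum mulr_sumr; apply: eq_bigr => w _.
    by rewrite /on_bits; case: ifP; rewrite ?mulr0.
  rewrite mulrBr addrA subrK -puzzle_vertical_sum mulrA -vertical_schur //.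
  by rewrite /vertical_sum mulr_suml -sumrB.
apply: overflowD; last exact: overflowM.
apply: overflow_puzzle_sum => w <- cw; apply: vertical_alt.
by rewrite cw cz.
Qed.
End PuzzleProduct.

Definition puzzle_count (l m n : seq bool) : int := puzzle_sum l m (fun w => (w == n)%:R).

Lemma puzzle_sum_count (R : comNzRingType) N l m (K : seq bool -> R) : size m = N ->
  puzzle_sum l m K =
  \sum_(w <- bool_words N | count_mem true w == count_mem true l) K w *~ puzzle_count l m w.
Proof.
move=> sm.
transitivity (\sum_(w <- bool_words N | count_mem true w == count_mem true l)
    \sum_(t <- triangles (bits l) (bits m)) K w *~ on_bits (fun v => (v == w)%:R) t).
  rewrite exchange_big; apply: eq_big_seq => t tt /=.
  case: (boolP (L10 \in t)) => t10.
    by rewrite /on_bits t10 big1 // => w _; rewrite mulr0z.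
  have bt := bits_is_one t10; have bin : bits (map is_one t) \in triangles (bits l) (bits m).
    by rewrite bt.
  have [st _] := size_triangles bin; rewrite !size_map in st.
  have ct := count_triangles_bits bin.
  rewrite /on_bits (negbTE t10) big_mkcond (bigD1_seq (map is_one t)) ?words_uniq //=.
    rewrite ct !eqxx mulr1z big1 ?addr0 // => w ne; rewrite (eq_sym _ w) (negbTE ne).
    by case: ifP => // _; rewrite mulr0z.
  by rewrite mem_bool_words size_map st sm.
by apply: eq_bigr => w _; rewrite /puzzle_count /puzzle_sum mulrz_sumr.
Qed.

(** * Comparison with the definition of the coefficients *)

Section LR.
Variable k : nat.
Notation altw := (alt k (vars k)).

(** The exponents of [n] are below [size m], so this coefficient does not see the overflow in
    [puzzle_product]. *)
Lemma mcoeff_product l m n : size l = size m -> size n = size m ->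
  count_mem true l = k -> count_mem true m = k -> count_mem true n = k ->
  puzzle_count l m n = (schur_poly k l * altw m)@_(monom k (exponents n)).
Proof.
move=> slm snm cl cm cn.
have small (i : 'I_k) : (monom k (exponents n) i < size m)%N.
  by rewrite mnmE -snm (allP (exponents_lt n)) // mem_nth // size_exponents cn.
have := puzzle_product slm cl cm small.
rewrite mcoeffB => /eqP; rewrite subr_eq0 => /eqP <-.
rewrite /puzzle_count /puzzle_sum raddf_sum; apply: eq_big_seq => w wt /=.
rewrite /on_bits; case: ifP => [_|/negbT w10]; first by rewrite raddf0.
have bin : bits (map is_one w) \in triangles (bits l) (bits m) by rewrite bits_is_one.
have [sw _] := size_triangles bin; rewrite !size_map in sw.
rewrite mcoeff_alt ?(count_triangles_bits bin) //.
have -> // : (exponents (map is_one w) == exponents n) = (map is_one w == n).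
by apply/eqP/eqP => [|-> //]; apply: exponents_inj; rewrite size_map sw snm.
Qed.

Lemma nth_string_part w j : (j < count_mem true w)%N ->
  (nth 0 (string_part w) j + ((count_mem true w).-1 - j))%N = nth 0%N (exponents w) j.
Proof.
elim: w j => // -[] w IH j /=; last exact: IH.
case: j => [|j] /=; first by rewrite subn0 count_false_true.
rewrite add1n ltnS => lt_j; rewrite -IH //; congr (_ + _)%N.
by rewrite add0n subnS -!subn1 subnAC.
Qed.

Lemma alternantE w : count_mem true w = k -> alternant k (string_part w) = altw w.
Proof.
move=> cw; rewrite /alternant -det_tr; congr (\det _); apply/matrixP=> j i; rewrite !mxE.
by rewrite (nth_map 0%N) ?size_exponents ?cw // /power_col nth_vars -nth_string_part cw.
Qed.

Lemma alternant0 : alternant k (nseq k 0%N) = altw (nseq k true).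
Proof.
rewrite -alternantE ?count_ones //; congr alternant.
by elim: (k) => //= n ->; rewrite count_nseq.
Qed.

Lemma tofrac_alt_neq0 : tofrac (altw (nseq k true)) != 0.
Proof. by rewrite tofrac_eq0 alt_neq0 ?count_ones. Qed.

Lemma schurE w : count_mem true w = k ->
  schur k (string_part w) = tofrac (schur_poly k w).
Proof.
move=> cw; rewrite /schur alternant0 alternantE // -(alt_schur_poly cw) tofracM.
by rewrite mulrAC mulfV ?mul1r // tofrac_alt_neq0.
Qed.
End LR.

Lemma string_part_inj v w : size v = size w -> count_mem true v = count_mem true w ->
  string_part v = string_part w -> v = w.
Proof.
move=> sz cnt E; apply: exponents_inj => //.
apply: (@eq_from_nth _ 0%N); rewrite !size_exponents // => j lt_j.
by rewrite -!nth_string_part ?E -?cnt.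
Qed.

Lemma size_string_part w : size (string_part w) = count_mem true w.
Proof. by elim: w => //= -[] w /= ->. Qed.

Lemma string_part_sorted w : sorted geq (string_part w).
Proof.
elim: w => //= -[] w IH //=; rewrite path_min_sorted //.
elim: w {IH} => //= -[] w IH /=; rewrite ?add0n ?leqnn //=.
by apply: sub_all IH => x /leq_trans; apply; rewrite leq_addl.
Qed.

Lemma alt_nseq_false (R : comNzRingType) k (xs : seq R) n w :
  alt k xs (nseq n false ++ w) = alt k xs w.
Proof. by rewrite /alt exponents_nseq_false. Qed.

Section LRExpansion.
Variables (k : nat) (s t : seq bool).
Hypotheses (sst : size s = size t) (cs : count_mem true s = k) (ct : count_mem true t = k).
Notation altw := (alt k (vars k)).
Let F := schur_poly k s * altw t.

Definition part_monom (nu : seq nat) : 'X_{1..k} :=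
  [multinom (nth 0 nu i + (k.-1 - i))%N | i < k].

Lemma part_monom_string w : count_mem true w = k ->
  part_monom (string_part w) = monom k (exponents w).
Proof.
by move=> cw; apply/mnmP=> i; rewrite !mnmE -nth_string_part cw.
Qed.

Lemma product_alternants : exists2 ws : seq (seq bool),
    uniq (map string_part ws) /\ {in ws, forall w, count_mem true w = k}
  & F = \sum_(w <- ws) altw w *~ F@_(monom k (exponents w)).
Proof.
(* Leading zeros change neither alternants nor Schur polynomials. With [msize F] of them every
   monomial of [F] is below the overflow bound, and the identity becomes exact. *)
pose M := msize F; pose s' := nseq M false ++ s; pose t' := nseq M false ++ t.
have ss' : size s' = size t' by rewrite !size_cat sst.
have cs' : count_mem true s' = k by rewrite count_cat count_nseq cs.
have ct' : count_mem true t' = k by rewrite count_cat count_nseq ct.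
have as' : altw s' = altw s := alt_nseq_false _ _ _ _.
have at' : altw t' = altw t := alt_nseq_false _ _ _ _.
have schur_s' : schur_poly k s' = schur_poly k s.
  apply: mul_alt_inj. rewrite (alt_schur_poly cs').  rewrite (alt_schur_poly cs). exact: as'.
have prodF : puzzle_sum s' t' altw = F.
  apply/mpolyP=> m; case: (boolP [forall i, (m i < size t')%N]) => [/forallP lt_m|].
    have := puzzle_product ss' cs' ct' lt_m; rewrite mcoeffB schur_s' at' => /eqP.
    by rewrite subr_eq0 => /eqP.
  rewrite negb_forall => /existsP [i]; rewrite -leqNgt => le_i.
  have -> : F@_m = 0.
    apply: memN_msupp_eq0; apply: msize_mdeg_ge; rewrite mdegE.
    rewrite (bigD1 i) //=; apply: leq_trans (leq_addr _ _); apply: leq_trans le_i.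
    by rewrite size_cat size_nseq leq_addr.
  rewrite /puzzle_sum raddf_sum big_seq big1 // => w wt /=.
  rewrite /on_bits; case: ifP => [_|/negbT w10]; first by rewrite raddf0.
  have bin : bits (map is_one w) \in triangles (bits s') (bits t') by rewrite bits_is_one.
  have [sw _] := size_triangles bin; rewrite !size_map in sw.
  apply: (@mcoeff_alt_ge _ _ _ i); first by rewrite (count_triangles_bits bin).
  by rewrite size_map sw.
exists [seq w <- bool_words (size t') | count_mem true w == k].
  split; last by move=> w; rewrite mem_filter => /andP [/eqP].
  rewrite map_inj_in_uniq ?filter_uniq ?words_uniq // => v w.
  rewrite !mem_filter !mem_bool_words => /andP [/eqP cv /eqP sv] /andP [/eqP cw /eqP sw].
  by apply: string_part_inj; rewrite ?sv ?sw ?cv ?cw.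
rewrite -{1}prodF (puzzle_sum_count _ _ (erefl (size t'))) cs' big_filter.
rewrite big_seq_cond [RHS]big_seq_cond; apply: eq_bigr => w /andP [].
rewrite mem_bool_words => /eqP sw /eqP cw; congr (_ *~ _).
by rewrite (mcoeff_product ss' sw cs' ct' cw) schur_s' at'.
Qed.

Lemma product_schur : schur k (string_part s) * schur k (string_part t) =
  tofrac F / tofrac (altw (nseq k true)).
Proof.
by rewrite (schurE cs) /schur (alternantE ct) alternant0 mulrA -tofracM.
Qed.

(** The choice in [lr_coef] has the expansion property only if some expansion exists; the alternants
    of [product_alternants] provide one. *)
Lemma lr_expansion_exists : exists c, lr_expansion k (string_part s) (string_part t) c.
Proof.
have [ws [uws cws] EF] := product_alternants.
pose S : {fset seq nat} := seq_fset tt (map string_part ws).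
pose c : {fsfun seq nat -> int with 0} := [fsfun nu in S => F@_(part_monom nu) | 0].
have memS x : (x \in S) = (x \in map string_part ws) by rewrite seq_fsetE.
exists c; split=> [nu|].
  move=> /(fsubsetP (finsupp_sub _ _ _)); rewrite memS => /mapP [w wws ->].
  by rewrite /is_part size_string_part (cws w) // eqxx string_part_sorted.
rewrite product_schur.
transitivity (\sum_(nu <- map string_part ws) schur k nu *~ c nu).
  rewrite big_map {1}EF raddf_sum mulr_suml; apply: eq_big_seq => w wws /=.
  have -> : c (string_part w) = F@_(monom k (exponents w)).
    by rewrite fsfunE memS map_f // part_monom_string ?(cws _ wws).
  by rewrite raddfMz /= /schur (alternantE (cws _ wws)) alternant0 mulrzAl.
have perm_c : perm_eq (finsupp c) [seq nu <- map string_part ws | nu \in finsupp c].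
  apply: uniq_perm; rewrite ?fset_uniq ?filter_uniq // => nu.
  rewrite mem_filter; case: (boolP (nu \in finsupp c)) => //= nuc.
  by have := fsubsetP (finsupp_sub _ _ _) _ nuc; rewrite memS.
rewrite (perm_big _ perm_c) big_filter [RHS]big_mkcond /=; apply: eq_bigr => nu _.
by case: finsuppP; rewrite ?mulr0z.
Qed.

(** Uniqueness: after clearing the denominator, the alternants of distinct partitions are separated
    by their decreasing monomials. *)
Lemma lr_expansion_coef c nu : lr_expansion k (string_part s) (string_part t) c ->
  is_part k nu -> c nu = F@_(part_monom nu).
Proof.
case=> c_part; rewrite product_schur => EF nu_part.
pose es (nu : seq nat) := mkseq (fun i => nth 0 nu i + (k.-1 - i))%N k.
have size_es nu' : size (es nu') = k by rewrite size_mkseq.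
have alternant_es nu' : alternant k nu' = power_det k (es nu').
  rewrite /alternant -det_tr; congr (\det _); apply/matrixP=> j i; rewrite !mxE.
  by rewrite (nth_map 0%N) ?size_es // /power_col nth_vars nth_mkseq.
have es_sorted nu' : is_part k nu' -> sorted gtn (es nu').
  case/andP=> /eqP snu so; apply/(sortedP 0%N) => i; rewrite size_es => lt_i.
  rewrite /es !nth_mkseq //; last exact: ltnW.
  have := sortedP 0%N so i; rewrite snu => /(_ lt_i) /=; lia.
have es_inj nu' : is_part k nu' -> es nu' = es nu -> nu' = nu.
  move=> /andP [/eqP snu' _] E; case/andP: nu_part => /eqP snu _.
  apply: (@eq_from_nth _ 0%N); rewrite ?snu // snu' => i lt_i.
  have := congr1 (fun l => nth 0%N l i) E; rewrite !nth_mkseq //.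
  by move/eqP; rewrite eqn_add2r => /eqP.
have {}EF : F = \sum_(nu' <- finsupp c) alternant k nu' *~ c nu'.
  apply/eqP; rewrite -tofrac_eq; apply/eqP.
  apply: (mulIf (invr_neq0 (tofrac_alt_neq0 k))).
  rewrite EF raddf_sum mulr_suml; apply: eq_bigr => nu' _ /=.
  by rewrite raddfMz /= -mulrzAl /schur alternant0.
have monom_es : part_monom nu = monom k (es nu).
  by apply/mnmP=> i; rewrite !mnmE nth_mkseq.
rewrite EF raddf_sum /= (eq_big_seq (fun nu' => c nu' *+ (nu' == nu))); last first.
  move=> nu' /c_part part'; rewrite raddfMz /= alternant_es monom_es.
  rewrite mcoeff_power_det ?es_sorted ?size_es //.
  have -> : (es nu' == es nu) = (nu' == nu).
    by apply/eqP/eqP => [/es_inj -> //|->].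
  by case: (nu' == nu); rewrite ?mul0rz ?intz.
case: (finsuppP c nu) => [nuc|nuc].
  by rewrite big_seq big1 // => nu' nuc'; case: eqP nuc nuc' => // -> /negbTE ->.
rewrite (bigD1_seq nu) ?fset_uniq //= eqxx big1 ?addr0 // => nu' /negbTE ->.
by rewrite mulr0n.
Qed.
End LRExpansion.

Lemma LR_puzzle_count s t u : size s = size t -> size u = size t ->
  count_mem true t = count_mem true s -> count_mem true u = count_mem true s ->
  LR s t u = puzzle_count s t u.
Proof.
move=> sst sut ct cu; rewrite /LR /lr_coef.
have spec := ClassicalEpsilon.epsilon_spec (inhabits [fsfun]) _
  (lr_expansion_exists sst erefl ct).
rewrite (lr_expansion_coef sst erefl ct spec).
  by rewrite part_monom_string // (mcoeff_product sst sut erefl ct cu).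
by rewrite /is_part size_string_part cu eqxx string_part_sorted.
Qed.

(** The polynomial in [mcoeff_product] is symmetric in the two words, since each alternant is the
    common Vandermonde factor times its Schur polynomial. *)
Lemma puzzle_countC s t u : size s = size t -> size u = size t ->
  count_mem true t = count_mem true s -> count_mem true u = count_mem true s ->
  puzzle_count s t u = puzzle_count t s u.
Proof.
move=> sst sut ct cu; have sus : size u = size s by rewrite sst.
have Est := mcoeff_product sst sut erefl ct cu.
have Ets := mcoeff_product (esym sst) sus ct erefl cu.
rewrite Est Ets; have := alt_schur_poly ct.
have := alt_schur_poly (erefl (count_mem true s)).
move: (schur_poly _ s) (schur_poly _ t) (alt _ _ s) (alt _ _ t) => p q a b <- <-.
by rewrite mulrCA [q * _]mulrCA [q * p]mulrC.
Qed.

(** * Cutting words *)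

Section Skew.
Variable R : comNzRingType.
Implicit Types (t : R) (ts : seq R).

(** The skew Schur polynomial of [n] over [m]. *)
Definition skew ts (n m : seq bool) : R := strips_sum ts (fun w => (w == n)%:R) m.

Lemma sum_strips_cat_weighted t c v w (K : seq bool -> bool -> R) :
  \sum_(p <- strips false c (v ++ w)) t ^+ p.1 * K p.2.1 p.2.2 =
  \sum_(q <- strips false c w) t ^+ q.1 *
    \sum_(p <- strips false q.2.2 v) t ^+ p.1 * K (p.2.1 ++ q.2.1) p.2.2.
Proof.
rewrite (sum_strips_cat _ _ _ _ (fun n x c => t ^+ n * K x c)).
apply: eq_bigr => q _; rewrite mulr_sumr; apply: eq_bigr => p _.
by rewrite exprD mulrA.
Qed.

(** Strips move ones to the left, so the number of ones in a prefix never decreases. *)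
Lemma skew_prefix_overflow ts u v n1 n2 : size u = size n1 ->
  (count_mem true n1 < count_mem true u)%N -> skew ts (n1 ++ n2) (u ++ v) = 0.
Proof.
elim: ts u v => [|t ts IH] u v su lt_u.
  rewrite /skew /= eqseq_cat //; case: eqP lt_u => // ->; by rewrite ltnn.
rewrite /skew /= /strip_sum.
rewrite (sum_strips_cat_weighted _ _ _ _ (fun w (c : bool) => if c then 0 else
   strips_sum ts (fun w => (w == n1 ++ n2)%:R) w)).
rewrite big1 // => q _; rewrite big_seq big1 ?mulr0 // => p pu.
case: ifP => [_|c]; first by rewrite mulr0.
rewrite [strips_sum _ _ _]IH ?mulr0 ?(size_strips pu) //.
have := count_strips pu; rewrite c addn0 => ->.
by apply: leq_trans lt_u _; rewrite leq_addr.
Qed.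

(** With equal counts no 1 can cross the cut, so the strips of the two halves are independent. *)
Lemma skew_cat ts u v n1 n2 : size u = size n1 -> count_mem true u = count_mem true n1 ->
  skew ts (n1 ++ n2) (u ++ v) = skew ts n1 u * skew ts n2 v.
Proof.
elim: ts u v => [|t ts IH] u v su cu.
  by rewrite /skew /= eqseq_cat //; case: eqP; case: eqP; rewrite ?(mulr0, mul0r, mulr1).
rewrite {1}/skew /= /strip_sum.
rewrite (sum_strips_cat_weighted _ _ _ _ (fun w (c : bool) => if c then 0 else
   strips_sum ts (fun w => (w == n1 ++ n2)%:R) w)).
transitivity (\sum_(q <- strips false false v) t ^+ q.1 *
  (if q.2.2 then 0 else skew (t :: ts) n1 u * skew ts n2 q.2.1)).
  apply: eq_bigr => q _; congr (_ * _); case: ifP => c.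
    rewrite big_seq big1 // => p pu; case: ifP => [_|c']; first by rewrite mulr0.
    rewrite [strips_sum _ _ _]skew_prefix_overflow ?mulr0 ?(size_strips pu) //.
    by have := count_strips pu; rewrite c' addn0 addn1 cu => ->.
  rewrite {2}/skew /= /strip_sum mulr_suml big_seq [RHS]big_seq.
  apply: eq_bigr => p pu; rewrite -mulrA; congr (_ * _).
  case: ifP => [_|c']; first by rewrite mul0r.
  rewrite [LHS]IH ?(size_strips pu) //.
  by have := count_strips pu; rewrite c' !addn0 => ->.
rewrite {3}/skew /= /strip_sum mulr_sumr; apply: eq_bigr => q _.
by rewrite mulrCA; case: ifP; rewrite ?mulr0.
Qed.

Lemma strips_zeros n : strips false false (nseq n false) = [:: (0%N, (nseq n false, false))].
Proof. by elim: n => //= n ->. Qed.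

Lemma skew_zeros ts n : skew ts (nseq n false) (nseq n false) = 1.
Proof.
elim: ts => [|t ts IH]; first by rewrite /skew /= eqxx.
by rewrite /skew /= /strip_sum strips_zeros big_seq1 mul1r.
Qed.

Lemma skew_ones ts n : skew ts (nseq n true) (nseq n true) = 1.
Proof.
elim: ts => [|t ts IH]; first by rewrite /skew /= eqxx.
rewrite -[RHS]IH /skew /=; move: (strips_sum ts _) => K; rewrite /strip_sum {IH}.
elim: n K => [|n IH] K; first by rewrite big_seq1 mul1r.
rewrite (sum_strips_cons _ _ _ _ _ (fun w (c : bool) => if c then 0 else K w)).
rewrite -[RHS](IH (fun w => K (true :: w))); apply: eq_bigr => p _; congr (_ * _).
by case: p.2.2; rewrite /= ?big_nil // !big_cons big_nil /= mulr0 !addr0 mul1r.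
Qed.

(** Leading zeros and trailing ones change a partition only by zero parts; they bring words to a
    common size and a common number of ones. *)
Definition pad (i j : nat) (w : seq bool) := nseq i false ++ w ++ nseq j true.

Lemma skew_pad ts i j n m : size n = size m -> count_mem true n = count_mem true m ->
  skew ts (pad i j n) (pad i j m) = skew ts n m.
Proof.
by move=> sz cnt; rewrite /pad !skew_cat ?skew_zeros ?skew_ones ?mul1r ?mulr1.
Qed.

Lemma strips_sum_skew ts (K : seq bool -> R) m :
  strips_sum ts K m =
  \sum_(w <- bool_words (size m) | count_mem true w == count_mem true m) K w * skew ts w m.
Proof.
elim: ts K m => [|t ts IH] K m.
  rewrite big_mkcond (bigD1_seq m) ?words_uniq ?mem_bool_words //= /skew /= !eqxx mulr1.
  rewrite big1 ?addr0 // => w ne; rewrite (eq_sym m) (negbTE ne).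
  by case: ifP => // _; rewrite mulr0.
rewrite [LHS]/= /strip_sum.
transitivity (\sum_(p <- strips false false m) t ^+ p.1 *
  (if p.2.2 then 0 else \sum_(w <- bool_words (size m) | count_mem true w == count_mem true m)
     K w * skew ts w p.2.1)).
  rewrite big_seq [RHS]big_seq; apply: eq_bigr => p pm; congr (_ * _).
  case: ifP => // c; rewrite IH (size_strips pm).
  by have := count_strips pm; rewrite c !addn0 => ->.
rewrite /skew /= /strip_sum.
under [RHS]eq_bigr do rewrite mulr_sumr.
rewrite [RHS]exchange_big; apply: eq_bigr => p _ /=.
case: p.2.2; first by rewrite mulr0 big1 // => w _; rewrite !mulr0.
by rewrite mulr_sumr; apply: eq_bigr => w _; rewrite mulrCA.
Qed.

Lemma puzzle_sum_rmorph l m n :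
  puzzle_sum l m (fun w => (w == n)%:R) = (puzzle_count l m n)%:~R :> R.
Proof.
rewrite /puzzle_count /puzzle_sum rmorph_sum; apply: eq_bigr => w _.
by rewrite /on_bits; case: ifP => // _; rewrite rmorph_nat.
Qed.

Lemma skew_expansion ts n m : skew ts n m =
  \sum_(w <- bool_words (size m) | count_mem true w == count_mem true m)
    (puzzle_count w m n)%:~R *
    skew ts w (sorted_word (count_mem false m) (count_mem true m)).
Proof.
rewrite /skew -strips_sum_sorted strips_sum_skew count_sorted_word.
rewrite size_cat !size_nseq count_false_true.
by apply: eq_bigr => w _; rewrite puzzle_sum_rmorph.
Qed.
End Skew.

Section Recursion.
Variable k : nat.
Notation altw := (alt k (vars k)).

Lemma schur_poly_skew w : count_mem true w = k ->
  schur_poly k w = skew (vars k) w (sorted_word (count_mem false w) k).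
Proof. by []. Qed.

Lemma pad_sorted i j m n : pad i j (sorted_word m n) = sorted_word (i + m) (n + j).
Proof. by rewrite /pad /sorted_word !nseqD !catA. Qed.

Lemma schur_poly_pad i j w : (count_mem true w + j)%N = k ->
  schur_poly k (pad i j w) =
  skew (vars k) w (sorted_word (count_mem false w) (count_mem true w)).
Proof.
move=> cw; have cp : count_mem true (pad i j w) = k.
  by rewrite !count_cat !count_nseq mul0n mul1n.
have cf : count_mem false (pad i j w) = (i + count_mem false w)%N.
  by rewrite !count_cat !count_nseq mul0n mul1n addn0.
rewrite schur_poly_skew // cf.
have -> : sorted_word (i + count_mem false w) k =
    pad i j (sorted_word (count_mem false w) (count_mem true w)).
  by rewrite pad_sorted cw.
rewrite skew_pad ?count_sorted_word //.
by rewrite size_cat !size_nseq count_false_true.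
Qed.

Lemma alt_skew n m : count_mem true m = k ->
  altw (nseq k true) * skew (vars k) n m =
  \sum_(w <- bool_words (size m) | count_mem true w == k)
    (puzzle_count w m n)%:~R * altw w.
Proof.
move=> cm; rewrite skew_expansion mulr_sumr cm big_seq_cond [RHS]big_seq_cond.
apply: eq_bigr => w /andP []; rewrite mem_bool_words => /eqP sw /eqP cw.
rewrite mulrCA -(alt_schur_poly cw) schur_poly_skew //.
congr (_ * (_ * skew _ _ (sorted_word _ _))).
by apply/eqP; rewrite -(eqn_add2r k) -{1}cm -cw !count_false_true sw.
Qed.

(** This turns identities between skew polynomials into identities between puzzle numbers. *)
Lemma mcoeff_alt_skew n m x : count_mem true m = k -> size x = size m ->
  count_mem true x = k ->
  puzzle_count x m n =
  (altw (nseq k true) * skew (vars k) n m)@_(monom k (exponents x)).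
Proof.
move=> cm sx cx; rewrite alt_skew // raddf_sum /= big_mkcond.
rewrite (bigD1_seq x) ?words_uniq ?mem_bool_words ?sx //= cx eqxx big_seq_cond big1 ?addr0.
  by rewrite mulrzl raddfMz /= mcoeff_alt // eqxx -mulrzl mulr1 mulrzz mul1r.
move=> w /andP []; rewrite mem_bool_words => /eqP sw ne; case: eqP => // cw.
rewrite mulrzl raddfMz /= mcoeff_alt //; case: eqP => [/exponents_inj E|_].
  by case/eqP: ne; apply: E; rewrite sw.
by rewrite mul0rz.
Qed.
End Recursion.

Lemma count_pad (b : bool) i j w :
  count_mem b (pad i j w) = (count_mem b w + (if b then j else i))%N.
Proof.
by case: b; rewrite !count_cat !count_nseq /= ?mul0n ?mul1n ?addn0 // addnC.
Qed.

Lemma size_pad i j w : size (pad i j w) = (i + size w + j)%N.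
Proof. by rewrite !size_cat !size_nseq addnA. Qed.

Lemma mcoeffMz k (p : {mpoly int[k]}) (z : int) m : (z%:~R * p)@_m = z * p@_m.
Proof. by rewrite mulrzl raddfMz /= -mulrzr mulrC intz. Qed.

(** Common padding leaves the skew polynomial unchanged, so only Schur polynomials of words of the
    size of [a] occur, and those are the Schur polynomials of their padded words. *)
Lemma puzzle_count_pad i j x a y : size y = size a -> count_mem true y = count_mem true a ->
  size x = size (pad i j a) -> count_mem true x = count_mem true (pad i j a) ->
  puzzle_count x (pad i j a) (pad i j y) =
  \sum_(w <- bool_words (size a) | count_mem true w == count_mem true a)
    puzzle_count w a y * (pad i j w == x)%:R.
Proof.
move=> sy cy sx cx; set k := count_mem true (pad i j a) in cx.
rewrite (mcoeff_alt_skew _ (erefl k) sx cx) skew_pad // skew_expansion.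
rewrite mulr_sumr raddf_sum /= big_seq_cond [RHS]big_seq_cond; apply: eq_bigr => w /andP [].
rewrite mem_bool_words => /eqP sw /eqP cw.
have fw : count_mem false w = count_mem false a.
  by apply/eqP; rewrite -(eqn_add2r (count_mem true a)) -{1}cw !count_false_true sw.
have ck : (count_mem true w + j)%N = k by rewrite cw /k count_pad.
rewrite mulrCA mcoeffMz; congr (_ * _).
rewrite -cw -fw -(schur_poly_pad i ck) alt_schur_poly ?count_pad //.
rewrite mcoeff_alt ?count_pad //.
have -> // : (exponents (pad i j w) == exponents x) = (pad i j w == x).
by apply/eqP/eqP => [|->//]; apply: exponents_inj; rewrite sx !size_pad sw.
Qed.

(** The skew polynomial of [al ++ nu] over [pa ++ p] is the Schur polynomial of [al] times the skew
    polynomial of [nu] over [p]. The second factor is expanded over [w], and padding gives [al] and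
    [w] the same size before they are multiplied. *)
Lemma puzzle_count_cat al nu p x : let pa := sorted_word (count_mem false al) (count_mem true al) in
  size nu = size p -> count_mem true nu = count_mem true p ->
  size x = size (al ++ p) -> count_mem true x = count_mem true (al ++ p) ->
  puzzle_count x (pa ++ p) (al ++ nu) =
  \sum_(w <- bool_words (size p) | count_mem true w == count_mem true p)
    puzzle_count w p nu *
    puzzle_count (pad (count_mem false p) (count_mem true p) al)
                 (pad (count_mem false al) (count_mem true al) w) x.
Proof.
move=> pa snu cnu sx cx; set k := count_mem true (al ++ p) in cx.
have cpa : count_mem true (pa ++ p) = k.
  by rewrite /k /pa [LHS]count_cat [RHS]count_cat count_sorted_word.
have spa : size pa = size al by rewrite size_cat !size_nseq count_false_true.
have sx' : size x = size (pa ++ p) by rewrite sx [LHS]size_cat [RHS]size_cat spa.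
rewrite (mcoeff_alt_skew _ cpa sx' cx) skew_cat /pa ?count_sorted_word //.
rewrite [skew _ nu p]skew_expansion mulrA mulr_sumr raddf_sum /=.
rewrite big_seq_cond [RHS]big_seq_cond; apply: eq_bigr => w /andP [].
rewrite mem_bool_words => /eqP sw /eqP cw.
have fw : count_mem false w = count_mem false p.
  by apply/eqP; rewrite -(eqn_add2r (count_mem true p)) -{1}cw !count_false_true sw.
have ca : (count_mem true al + count_mem true p)%N = k by rewrite /k count_cat.
have ck : (count_mem true w + count_mem true al)%N = k by rewrite cw addnC.
rewrite mulrCA mcoeffMz; congr (_ * _).
have -> : skew (vars k) w (sorted_word (count_mem false p) (count_mem true p)) =
    schur_poly k (pad (count_mem false al) (count_mem true al) w).
  by rewrite (schur_poly_pad _ ck) fw cw.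
rewrite -(schur_poly_pad (count_mem false p) ca) mulrAC alt_schur_poly ?count_pad //.
rewrite mulrC -mcoeff_product ?count_pad ?size_pad //.
- by rewrite sw -!count_false_true; lia.
- by rewrite sx size_cat sw -!count_false_true; lia.
Qed.

(** * Regions between two zigzags *)

Local Open Scope nat_scope.

Arguments words : simpl never.

Fixpoint zigzag0 (s : label) (u v : seq label) (e : bool * label) : nat :=
  match u with
  | [::] => (v == [::]) && (e == (false, s))
  | x :: u' => \sum_(d <- labels | piece x d s)
      match v with
      | [::] => (u' == [::]) && (e == (true, d))
      | y :: v' => \sum_(t <- labels | piece t y d) zigzag0 t u' v' e
      end
  end.

Definition zigzag120 (d : label) (u v : seq label) (e : bool * label) : nat :=
  match v with
  | [::] => (u == [::]) && (e == (true, d))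
  | y :: v' => \sum_(t <- labels | piece t y d) zigzag0 t u v' e
  end.

(* The number of fillings of the triangles between the columns of 60-degree
   edges [u] and [v] (read upwards), from the edge [b] to the edge [e]; such an
   edge is a pair of a label and a boolean: false for a horizontal edge, true
   for one in direction 120. *)
Definition zigzag (b : bool * label) (u v : seq label) (e : bool * label) : nat :=
  if b.1 then zigzag120 b.2 u v e else zigzag0 b.2 u v e.

Lemma zigzag0_cons s x u v e :
  zigzag0 s (x :: u) v e = \sum_(d <- labels | piece x d s) zigzag120 d u v e.
Proof. by []. Qed.

(** A bottom edge in direction 120 makes the next column one edge longer, a top edge in this
    direction one edge shorter. *)
Fixpoint region (bots tops : seq (bool * label)) (u v : seq label) : nat :=
  match bots, tops with
  | b :: bs, t :: ts =>
      \sum_(w <- words labels (size u + b.1 - t.1)) zigzag b u w t * region bs ts w v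
  | [::], [::] => u == v
  | _, _ => 0
  end.

Lemma sum_labels_eq (F : label -> nat) a :
  \sum_(l <- labels) (l == a) * F l = F a.
Proof. by case: a; rewrite /labels !big_cons big_nil /=; lia. Qed.

Lemma zigzag_cat (c : bool) (b : bool * label) u1 u2 v1 v2 e : size u1 + b.1 = size v1 + c ->
  zigzag b (u1 ++ u2) (v1 ++ v2) e =
  \sum_(l <- labels) zigzag b u1 v1 (c, l) * zigzag (c, l) u2 v2 e.
Proof.
have H0 s u w : size u = size w + c -> zigzag0 s (u ++ u2) (w ++ v2) e =
    \sum_(l <- labels) zigzag0 s u w (c, l) * zigzag (c, l) u2 v2 e.
  elim: u s w => [|x u IH] s w.
    case: w; case: (c) => // _.
    rewrite -[LHS](sum_labels_eq (fun l => zigzag (false, l) u2 v2 e)).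
    by apply: eq_bigr => l _; rewrite /= xpair_eqE.
  move=> sz; rewrite cat_cons zigzag0_cons.
  under [RHS]eq_bigr do rewrite zigzag0_cons big_distrl.
  rewrite [RHS]exchange_big; apply: eq_bigr => d _ /=.
  case: w sz => [|y w] sz.
    case: u {IH} sz => //; case: (c) => // _.
    rewrite -[LHS](sum_labels_eq (fun l => zigzag (true, l) u2 v2 e)).
    by apply: eq_bigr => l _; rewrite /= xpair_eqE.
  rewrite /=; under [RHS]eq_bigr do rewrite big_distrl.
  rewrite [RHS]exchange_big; apply: eq_bigr => t _ /=.
  by apply: IH; case: sz.
case: b => -[] s; rewrite /zigzag /= => sz; last by apply: H0; rewrite addn0 in sz.
case: v1 sz => [|y w] sz.
  case: u1 sz => [|x u1] sz; last by move: sz; rewrite /=; case: (c); lia.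
  move: sz; case: (c) => // _.
  rewrite -[LHS](sum_labels_eq (fun l => zigzag (true, l) u2 v2 e)).
  by apply: eq_bigr => l _; rewrite /= xpair_eqE.
rewrite /=; under [RHS]eq_bigr do rewrite big_distrl.
rewrite [RHS]exchange_big; apply: eq_bigr => t _ /=.
by apply: H0; move: sz; rewrite /=; lia.
Qed.

(* The height of the right column, where no subtraction may be truncated. *)
Fixpoint end_height (h : nat) (bs ts : seq bool) : option nat :=
  match bs, ts with
  | b :: bs', t :: ts' => if t <= h + b then end_height (h + b - t) bs' ts' else None
  | [::], [::] => Some h
  | _, _ => None
  end.

Notation sides := (unzip1 (S := bool) (T := label)).

Lemma region_append bs1 ts1 bs2 ts2 u v h :
  end_height (size u) (sides bs1) (sides ts1) = Some h ->
  region (bs1 ++ bs2) (ts1 ++ ts2) u v =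
  \sum_(w <- words labels h) region bs1 ts1 u w * region bs2 ts2 w v.
Proof.
elim: bs1 ts1 u => [|b bs IH] [|t ts] u //=.
  case=> <-; rewrite (bigD1_seq u) ?words_uniq //=; last first.
    by rewrite mem_words eqxx /=; apply/allP=> l _; apply: mem_labels.
  rewrite eqxx mul1n big1 ?addn0 // => w ne.
  by rewrite eq_sym (negbTE ne).
case: ifP => // le_t hE.
under [RHS]eq_bigr do rewrite big_distrl.
rewrite [RHS]exchange_big big_seq [RHS]big_seq; apply: eq_bigr => w.
rewrite mem_words => /andP [/eqP sw _]; rewrite -sw in hE.
by rewrite (IH _ _ hE) big_distrr; apply: eq_bigr => x _; rewrite /= mulnA.
Qed.

(** The cut follows a broken line from the left column to the right one, with one edge per strip
    whose direction is given by [cs]; the sum is over its labels. *)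
Lemma region_cut bs cs ts u1 u2 v1 v2 :
  end_height (size u1) (sides bs) cs = Some (size v1) ->
  end_height (size u2) cs (sides ts) = Some (size v2) ->
  region bs ts (u1 ++ u2) (v1 ++ v2) =
  \sum_(M <- words labels (size cs))
     region bs (zip cs M) u1 v1 * region (zip cs M) ts u2 v2.
Proof.
elim: cs bs ts u1 u2 => [|c cs IH] [|b bs] [|t ts] u1 u2 //=.
  by case=> s1 _; rewrite (_ : words _ _ = [:: [::]]) // big_seq1 eqseq_cat // mulnb.
case: ifP => // le_c h1; case: ifP => // le_t h2.
have -> : size (u1 ++ u2) + b.1 - t.1 = (size u1 + b.1 - c) + (size u2 + c - t.1).
  rewrite size_cat; move: le_c le_t.
  move: (nat_of_bool b.1) (nat_of_bool t.1) (nat_of_bool c); lia.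
rewrite sum_words_cat [RHS]sum_words_cons /=.
under [RHS]eq_bigr => l _ do under eq_bigr => M _ do rewrite big_distrl /=.
under [RHS]eq_bigr => l _ do rewrite exchange_big /=.
rewrite [RHS]exchange_big big_seq [RHS]big_seq /=; apply: eq_bigr => w1.
rewrite mem_words => /andP [/eqP sw1 _]; rewrite -sw1 in h1.
under [RHS]eq_bigr => l _ do under eq_bigr => M _ do rewrite big_distrr /=.
under [RHS]eq_bigr => l _ do rewrite exchange_big /=.
rewrite [RHS]exchange_big big_seq [RHS]big_seq /=; apply: eq_bigr => w2.
rewrite mem_words => /andP [/eqP sw2 _]; rewrite -sw2 in h2.
rewrite (IH _ _ _ _ h1 h2) (@zigzag_cat c); last by rewrite sw1 subnK.
rewrite big_distrl; apply: eq_bigr => l _ /=; rewrite big_distrr.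
by apply: eq_bigr => M _ /=; rewrite -!mulnA; congr (_ * _); rewrite mulnCA.
Qed.

Lemma count_sum (T : eqType) (a : T) (s : seq T) :
  count_mem a s = \sum_(x <- s) (x == a).
Proof. by elim: s => [|x s IH] /=; rewrite ?big_nil // big_cons IH. Qed.

Lemma count_rhombi x y s t : count_mem (y, s) (rhombi x t) =
  \sum_(d <- labels | piece x d s) piece t y d.
Proof.
by case: x; case: t; case: y; case: s; rewrite /labels !(big_cons, big_nil).
Qed.

Lemma zigzag_columns s u w m : zigzag0 s u w (true, m) = count_mem (w, s) (columns u m).
Proof.
elim: u w s => [|x u IH] w s; first by case: w.
rewrite zigzag0_cons; case: u IH => [|x' u] IH.
  rewrite /columns count_map /up_bottoms count_filter.
  case: w => [|y w].
    by case: x {IH}; case: s; case: m; rewrite /zigzag120 /labels !(big_cons, big_nil).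
  rewrite (@eq_count _ _ pred0) ?count_pred0 // big1 // => d _.
  by rewrite /zigzag120 /= big1 // => t _; rewrite andbF.
rewrite columns_cons count_sum big_flatten big_map.
case: w => [|y w].
  rewrite [LHS]big1 // [RHS]big1 // => c _; rewrite big_map big1 // => r _.
transitivity (\sum_(d <- labels | piece x d s) \sum_(t <- labels | piece t y d)
   \sum_(c <- columns (x' :: u) m) (c == (w, t))).
  by apply: eq_bigr => d _; apply: eq_bigr => t _; rewrite IH count_sum.
under eq_bigr do rewrite exchange_big.
rewrite exchange_big; apply: eq_bigr => -[v t] _ /=; rewrite big_map /=.
transitivity ((v == w) * count_mem (y, s) (rhombi x t)); last first.
  rewrite count_sum big_distrr; apply: eq_bigr => r _ /=.
  case: r => y' s'; rewrite !xpair_eqE eqseq_cons mulnb; congr nat_of_bool.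
  by case: (y' == y); case: (v == w); rewrite ?andbF.
rewrite count_rhombi big_distrr; apply: eq_bigr => d _ /=.
rewrite big_mkcond /= -[RHS](sum_labels_eq (fun t' => (v == w) * piece t' y d) t).
apply: eq_bigr => t' _; rewrite xpair_eqE (eq_sym t).
by case: (v == w); case: (t' == t); case: (piece t' y d).
Qed.

Lemma region_triangles nu mu u :
  region (map (pair false) nu) (map (pair true) mu) u [::] = count_mem nu (triangles u mu).
Proof.
elim: mu nu u => [|m mu IH] [|s nu] u; rewrite ?count_sum.
- by case: u => [|x u] /=; rewrite ?big_cons big_nil.
- by case: u => [|x u] /=; rewrite ?big_cons big_nil.
- by rewrite big_flatten big_map big1 // => c _; rewrite big_map big1.
rewrite big_flatten big_map /= addn0 subn1.
under eq_bigr do rewrite IH /zigzag zigzag_columns count_sum big_distrl.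
rewrite exchange_big big_seq [RHS]big_seq; apply: eq_bigr => c /size_columns su /=.
rewrite (bigD1_seq c.1) ?words_uniq //=; last first.
  by rewrite mem_words su eqxx; apply/allP=> l _; apply: mem_labels.
rewrite big1 ?addn0 => [|w ne]; last by rewrite -pair_eqE /= eq_sym (negbTE ne).
rewrite big_map -pair_eqE /= eqxx /= count_sum big_distrr; apply: eq_bigr => w _ /=.
by rewrite eqseq_cons mulnb.
Qed.

Lemma end_heightE h bs cs : size bs = size cs ->
  (forall i, count_mem true (take i cs) <= h + count_mem true (take i bs)) ->
  end_height h bs cs = Some (h + count_mem true bs - count_mem true cs).
Proof.
elim: bs cs h => [|b bs IH] [|c cs] h //=; first by rewrite addn0 subn0.
case=> sz le_c.
have le1 := le_c 1; rewrite /= !take0 /= !addn0 in le1.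
have le_cb : c <= h + b by move: le1; case: (b); case: (c).
rewrite le_cb IH //.
  by congr (Some _); move: le_cb; case: (b); case: (c); rewrite /=; lia.
move=> i; have := le_c i.+1; move: le_cb; case: (b); case: (c); rewrite /=; lia.
Qed.

Lemma count_take_nseq i (b : bool) n s : count_mem true (take i (nseq n b ++ s)) =
  b * minn i n + count_mem true (take (i - n) s).
Proof.
by elim: n i => [|n IH] [|i] //=; rewrite ?minn0 ?muln0 ?subn0 ?take0 // IH subSS;
  case: (b) => //=; rewrite ?mul1n ?minnSS.
Qed.

Lemma unzip1_pair (b : bool) (s : seq label) : sides (map (pair b) s) = nseq (size s) b.
Proof. by elim: s => //= x s ->. Qed.

Lemma zip_nseq (b : bool) (s : seq label) : zip (nseq (size s) b) s = map (pair b) s.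
Proof. by elim: s => //= x s ->. Qed.

Lemma region_empty b x y : size x = size y ->
  region (map (pair b) x) (map (pair b) y) [::] [::] = (x == y).
Proof.
elim: x y => [|s x IH] [|t y] //=; case=> sz.
rewrite add0n subnn (_ : words _ _ = [:: [::]]) // big_seq1 IH // eqseq_cons -mulnb.
by case: b {IH}; rewrite /zigzag /= xpair_eqE /= (eq_sym t).
Qed.

Lemma sum_words_pick n a (F : seq label -> nat) : size a = n ->
  \sum_(w <- words labels n) (w == a) * F w = F a.
Proof.
move=> sa; rewrite (bigD1_seq a) ?words_uniq //=; last first.
  by rewrite mem_words sa eqxx; apply/allP=> l _; apply: mem_labels.
by rewrite eqxx mul1n big1 ?addn0 // => w /negbTE ->.
Qed.

(** * Unique fillings of the corner triangles *)

Lemma puzzle_countE l m n :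
  puzzle_count l m n = Posz (count_mem (bits n) (triangles (bits l) (bits m))).
Proof.
rewrite /puzzle_count /puzzle_sum; elim: (triangles _ _) => [|t s IH] /=.
  by rewrite big_nil.
rewrite big_cons {}IH PoszD; congr (_ + _)%R.
rewrite /on_bits; case: (boolP (L10 \in t)) => [t10|t10].
  by case: eqP t10 => // ->; rewrite (negbTE (bits_binary n)).
rewrite -{2}(bits_is_one t10) (inj_eq bits_inj).
by case: (_ == n).
Qed.

Lemma puzzle_count_sorted m n :
  puzzle_count (sorted_word (count_mem false m) (count_mem true m)) m n = Posz (m == n).
Proof. by rewrite /puzzle_count puzzle_sum_sorted; case: (m == n). Qed.

Lemma no_L10 (s : seq label) : count_mem L10 s = 0 -> L10 \notin s.
Proof. by rewrite -has_pred1 has_count => ->. Qed.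

(** Commutativity moves the sorted word to the NW side when [w] is binary. Conservation of labels
    excludes [L10] from any other South side. *)
Lemma count_triangles_sorted_right g w :
  count_mem w (triangles (bits g) (bits (sorted_word (count_mem false g) (count_mem true g)))) =
  (w == bits g).
Proof.
set id := sorted_word _ _.
have sid : size id = size g by rewrite size_cat !size_nseq count_false_true.
have cid : count_mem true id = count_mem true g by rewrite count_sorted_word.
have fid : count_mem false id = count_mem false g.
  by apply/eqP; rewrite -(eqn_add2r (count_mem true g)) -{1}cid !count_false_true sid.
have binary v : size v = size g -> count_mem true v = count_mem true g ->
    count_mem (bits v) (triangles (bits g) (bits id)) = (v == g).
  move=> sv cv; have := puzzle_countE g id v.
  rewrite puzzle_countC ?sid ?cid // puzzle_count_sorted eq_sym => /eqP.
  by rewrite eqz_nat => /eqP <-.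
case: (boolP (w \in triangles (bits g) (bits id))) => wt; last first.
  rewrite (count_memPn wt); case: eqP wt => // ->.
  by rewrite -has_pred1 has_count binary // eqxx.
have w10 : L10 \notin w.
  apply: no_L10; have := triangles_count_right wt.
  by rewrite count_bits_neq1 count_bits_L0 fid; lia.
rewrite -(bits_is_one w10) in wt *; rewrite (inj_eq bits_inj) binary //.
  by have [] := size_triangles wt; rewrite !size_map => ->.
exact: count_triangles_bits wt.
Qed.

Lemma count_triangles_sorted_left g w :
  count_mem (bits g) (triangles w (bits (sorted_word (count_mem false g) (count_mem true g)))) =
  (w == bits g).
Proof.
set id := sorted_word _ _.
have sid : size id = size g by rewrite size_cat !size_nseq count_false_true.
have cid : count_mem true id = count_mem true g by rewrite count_sorted_word.
have fid : count_mem false id = count_mem false g.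
  by apply/eqP; rewrite -(eqn_add2r (count_mem true g)) -{1}cid !count_false_true sid.
have binary v : size v = size g -> count_mem true v = count_mem true g ->
    count_mem (bits g) (triangles (bits v) (bits id)) = (v == g).
  move=> sv cv; have := puzzle_countE v id g.
  rewrite puzzle_countC ?sid ?cid // {1}/id -cv.
  have -> : count_mem false g = count_mem false v.
    by apply/eqP; rewrite -(eqn_add2r (count_mem true g)) -{2}cv !count_false_true sv.
  by rewrite puzzle_count_sorted => /eqP; rewrite eqz_nat => /eqP <-.
case: (boolP (bits g \in triangles w (bits id))) => wt; last first.
  rewrite (count_memPn wt); case: eqP wt => // ->.
  by rewrite -has_pred1 has_count binary // eqxx.
have w10 : L10 \notin w.
  apply: no_L10; have := triangles_count_bottom wt.
  by rewrite count_bits_neq1 count_bits_L0 fid; lia.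
rewrite -(bits_is_one w10) in wt *; rewrite (inj_eq bits_inj) binary //.
  by have [] := size_triangles wt; rewrite !size_map => -> ->.
by rewrite (count_triangles_bits wt).
Qed.

Definition identity_word (w : seq bool) : seq bool :=
  sorted_word (count_mem false w) (count_mem true w).

Lemma size_identity_word w : size (identity_word w) = size w.
Proof. by rewrite size_cat !size_nseq count_false_true. Qed.

Lemma identity_word_rev w : identity_word (rev w) = identity_word w.
Proof. by rewrite /identity_word !count_rev. Qed.

Lemma bits_cat v w : bits (v ++ w) = bits v ++ bits w.
Proof. exact: map_cat. Qed.

Lemma sides_cat s t : sides (s ++ t) = sides s ++ sides t.
Proof. exact: map_cat. Qed.

Lemma zip_bits (b : bool) w : zip (nseq (size w) b) (bits w) = map (pair b) (bits w).
Proof. by rewrite -(zip_nseq b (bits w)) size_map. Qed.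

Lemma end_height_nseq h n (b c : bool) : c * n <= h + b * n ->
  end_height h (nseq n b) (nseq n c) = Some (h + b * n - c * n).
Proof.
move=> le; rewrite end_heightE ?size_nseq ?count_nseq // => [|i].
  by case: b {le}; case: c.
have := count_take_nseq i c n [::]; have := count_take_nseq i b n [::].
rewrite !cats0 => -> ->; move: le; case: b; case: c; rewrite /= ?mul1n ?mul0n; lia.
Qed.

(** Below the path [M] there is a triangle with sorted NW side, followed under [ze] by a region of
    height zero in which the path is the boundary itself. *)
Lemma corner_SW al ze M : size M = size al + size ze ->
  region (map (pair false) (bits (al ++ ze)))
    (zip (nseq (size al) true ++ nseq (size ze) false) M) (bits (identity_word al)) [::] =
  (M == bits (al ++ ze)).
Proof.
move=> sM; rewrite -(cat_take_drop (size al) M).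
set M1 := take _ M; set M2 := drop _ M.
have s1 : size M1 = size al by rewrite size_takel // sM leq_addr.
have s2 : size M2 = size ze by rewrite size_drop sM addKn.
rewrite zip_cat ?size_nseq // -{1}s1 -{1}s2 !zip_nseq bits_cat (map_cat (pair false)).
rewrite (@region_append _ _ _ _ _ _ 0); last first.
  rewrite !unzip1_pair s1 !size_map ?size_identity_word.
  by rewrite end_height_nseq; [congr (Some _)|]; rewrite /=; lia.
rewrite (_ : words _ _ = [:: [::]]) // big_seq1 region_triangles.
rewrite /identity_word count_triangles_sorted region_empty ?size_map //.
by rewrite mulnb eqseq_cat ?size_map // (eq_sym M2).
Qed.

Lemma corner_N ga de M : size M = size ga + size de ->
  region (zip (nseq (size ga) false ++ nseq (size de) true) M)
    (map (pair true) (bits (identity_word ga ++ de))) (bits ga) [::] =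
  (M == bits (ga ++ de)).
Proof.
move=> sM; rewrite -(cat_take_drop (size ga) M).
set M1 := take _ M; set M2 := drop _ M.
have s1 : size M1 = size ga by rewrite size_takel // sM leq_addr.
have s2 : size M2 = size de by rewrite size_drop sM addKn.
rewrite zip_cat ?size_nseq // -{1}s1 -{1}s2 !zip_nseq
  (bits_cat (identity_word ga)) (bits_cat ga) (map_cat (pair true)).
rewrite (@region_append _ _ _ _ _ _ 0); last first.
  rewrite !unzip1_pair s1 !size_map ?size_identity_word.
  by rewrite end_height_nseq; [congr (Some _)|]; rewrite /=; lia.
rewrite (_ : words _ _ = [:: [::]]) // big_seq1 region_triangles.
rewrite /identity_word count_triangles_sorted_right region_empty ?size_map //.
by rewrite mulnb eqseq_cat ?size_map.
Qed.

Lemma count_triangles_identity_left g w :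
  count_mem (bits g) (triangles w (bits (identity_word g))) = (w == bits g).
Proof. exact: count_triangles_sorted_left. Qed.

(* The triangle on the right-hand side is the hexagon with three corner triangles
   added, each of which has exactly one filling. *)
Lemma hexagon_triangle al be ga de ep ze :
  size al + size be = size de + size ep -> size be + size ga = size ep + size ze ->
  size ga + size de = size ze + size al ->
  region (map (pair true) (bits al) ++ map (pair false) (bits ze))
         (map (pair false) (bits ga) ++ map (pair true) (bits de))
         (bits be) (bits ep) =
  count_mem (bits (al ++ ze ++ ep))
    (triangles (bits (identity_word al ++ be ++ ga))
               (bits (identity_word ga ++ de ++ identity_word ep))).
Proof.
move=> hab hbc hcd; rewrite -region_triangles.
rewrite catA (catA (identity_word ga)) (bits_cat (_ ++ _)) (bits_cat (_ ++ de)).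
rewrite (map_cat (pair false)) (map_cat (pair true)).
(* First cut: the column of height [size ep] that bounds the SE corner triangle. *)
rewrite [RHS](@region_append _ _ _ _ _ _ (size ep)); last first.
  rewrite !unzip1_pair !size_map !(size_identity_word, size_cat).
  have -> : size al + size ze = size ga + size de by rewrite addnC.
  by rewrite end_height_nseq; [congr (Some _)|]; rewrite /=; lia.
transitivity (\sum_(w <- words labels (size ep)) (w == bits ep) *
  region (map (pair false) (bits (al ++ ze)))
    (map (pair true) (bits (identity_word ga ++ de)))
    (bits (identity_word al ++ be ++ ga)) w); last first.
  by apply: eq_bigr => w _; rewrite region_triangles mulnC count_triangles_identity_left.
rewrite sum_words_pick ?size_map //.
rewrite (bits_cat (identity_word al)) -[bits ep in RHS]cat0s.
have cnt (b : bool) n : count_mem true (nseq n b) = b * n by rewrite count_nseq; case: b.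
(* Second cut: the path along the SW and South sides of the hexagon, above the SW corner
   triangle. *)
rewrite [RHS](@region_cut _ (nseq (size al) true ++ nseq (size ze) false)).
- rewrite size_cat !size_nseq.
  transitivity (\sum_(M <- words labels (size al + size ze)) (M == bits (al ++ ze)) *
    region (zip (nseq (size al) true ++ nseq (size ze) false) M)
       (map (pair true) (bits (identity_word ga ++ de))) (bits (be ++ ga)) (bits ep)).
    rewrite sum_words_pick ?size_map ?size_cat // bits_cat zip_cat ?size_nseq ?size_map //.
    rewrite !zip_bits.
    rewrite (bits_cat be) -[bits ep in RHS]cats0.
    (* Third cut: the path along the North and NE sides of the hexagon, below the top corner
       triangle. *)
    rewrite [RHS](@region_cut _ (nseq (size ga) false ++ nseq (size de) true)).
    + rewrite size_cat !size_nseq.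
      transitivity (\sum_(M <- words labels (size ga + size de)) (M == bits (ga ++ de)) *
        region (map (pair true) (bits al) ++ map (pair false) (bits ze))
          (zip (nseq (size ga) false ++ nseq (size de) true) M) (bits be) (bits ep)).
        rewrite sum_words_pick ?size_map ?size_cat // bits_cat zip_cat ?size_nseq ?size_map //.
        by rewrite !zip_bits.
      rewrite big_seq [RHS]big_seq; apply: eq_bigr => M.
      by rewrite mem_words => /andP [/eqP sM _]; rewrite mulnC corner_N.
    + rewrite sides_cat !unzip1_pair !size_map end_heightE.
      * by congr (Some _); rewrite !count_cat !cnt; lia.
      * by rewrite !size_cat !size_nseq; lia.
      move=> i; have := count_take_nseq (i - size ga) true (size de) [::].
      have := count_take_nseq (i - size al) false (size ze) [::].
      by rewrite !cats0 !count_take_nseq => -> ->; rewrite /=; lia.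
    rewrite unzip1_pair !size_map !(size_identity_word, size_cat) end_heightE.
    + by congr (Some _); rewrite !count_cat !cnt /=; lia.
    + by rewrite !size_cat !size_nseq.
    move=> i; have := count_take_nseq (i - size ga) true (size de) [::].
    have := count_take_nseq i true (size ga + size de) [::].
    by rewrite !cats0 !count_take_nseq => -> ->; rewrite /=; lia.
  rewrite big_seq [RHS]big_seq; apply: eq_bigr => M.
  by rewrite mem_words => /andP [/eqP sM _]; rewrite corner_SW.
- rewrite unzip1_pair !size_map !(size_identity_word, size_cat) end_heightE.
  + by congr (Some _); rewrite !count_cat !cnt /=; lia.
  + by rewrite !size_cat !size_nseq.
  move=> i; have := count_take_nseq (i - size al) false (size ze) [::].
  have := count_take_nseq i false (size al + size ze) [::].
  by rewrite !cats0 !count_take_nseq => -> ->; rewrite /=; lia.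
rewrite unzip1_pair !size_map !(size_identity_word, size_cat) end_heightE.
- by congr (Some _); rewrite !count_cat !cnt /=; lia.
- by rewrite !size_cat !size_nseq; lia.
move=> i; have := count_take_nseq (i - size al) false (size ze) [::].
have := count_take_nseq i true (size ga + size de) [::].
by rewrite !cats0 !count_take_nseq => -> ->; rewrite /=; lia.
Qed.

(** * Edges and triangles of the hexagon *)

(* Between the columns of abscissas x and x + 1, the edges that are not 60-degree
   ones form a zigzag; [zigzag_edge x y j] numbers them upwards, the horizontal
   ones being even, and [zigzag_piece x y j] is the triangle between numbers j
   and j + 1. *)
Definition zigzag_edge (x y j : nat) : edge :=
  (if odd j then D120 else D0, (x, y + j./2)).

Definition zigzag_piece (x y j : nat) : seq edge :=
  if odd j then down_triangle (x, y + j./2) else up_triangle (x, y + j./2).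

Definition allowed (g : edge -> label) (t : seq edge) : bool :=
  map g t \in allowed_pieces.

(** The traversal of [zigzag] with its inner labels given as [Z], so that a recursive count becomes
    a sum of boolean tests over labelings. *)
Fixpoint strip_ok (b : bool) (s : label) (Z u v : seq label) (e : bool * label) : bool :=
  match Z with
  | [::] => [&& u == [::], v == [::] & e == (b, s)]
  | d :: Z' =>
      if b then
        if v is y :: v' then piece d y s && strip_ok false d Z' u v' e else false
      else
        if u is x :: u' then piece x d s && strip_ok true d Z' u' v e else false
  end.

Lemma zigzag_strip b s u v e :
  zigzag (b, s) u v e =
  \sum_(Z <- words labels (size u + size v)) strip_ok b s Z u v e.
Proof.
have [n] := ubnP (size u + size v); elim: n => // n IH in b s u v *.
case: b => /= le_n.
  case: v le_n => [|y v] le_n.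
    case: u le_n => [|x u] le_n; first by rewrite /words big_seq1.
    rewrite addn0 /= sum_words_cons big1 // => l _.
    by rewrite big1.
  rewrite /= addnS sum_words_cons /zigzag /= big_mkcond; apply: eq_bigr => t _.
  case: ifP => _; last by rewrite big1.
  by rewrite -(IH false t u v) //; move: le_n => /=; lia.
case: u le_n => [|x u] le_n.
  case: v le_n => [|y v] le_n; first by rewrite /words big_seq1 /zigzag /=.
  by rewrite add0n /= sum_words_cons /zigzag /= big1 // => l _; rewrite big1.
rewrite /= addSn sum_words_cons /zigzag /= big_mkcond; apply: eq_bigr => t _.
case: ifP => _; last by rewrite big1.
by rewrite -(IH true t u v) //; move: le_n => /=; lia.
Qed.

Lemma strip_ok_map (g : edge -> label) x y j n l :
  strip_ok (odd j) (g (zigzag_edge x y j)) (map g (map (zigzag_edge x y) (iota j.+1 n)))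
    (map g [seq (D60, (x, y + k)) | k <- iota (uphalf j) (uphalf (j + n) - uphalf j)])
    (map g [seq (D60, (x.+1, y + k)) | k <- iota j./2 ((j + n)./2 - j./2)])
    (odd (j + n), l) =
  all (allowed g) (map (zigzag_piece x y) (iota j n)) && (l == g (zigzag_edge x y (j + n))).
Proof.
elim: n j => [|n IH] j.
  by rewrite addn0 !subnn /= xpair_eqE eqxx.
rewrite [iota j.+1 _]/= [iota j n.+1]/= [LHS]/=.
have := IH j.+1; rewrite addSn -addnS.
rewrite [map _ (iota j n.+1)]/= [all _ _]/= -andbA => <-.
case: (boolP (odd j)) => oj.
  have -> : (j + n.+1)./2 - j./2 = ((j + n.+1)./2 - (j.+1)./2).+1 by lia.
  rewrite /= {1}/allowed /zigzag_piece oj /= pieceE /zigzag_edge oj /=.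
  have -> : uphalf j = (j./2).+1 by lia.
  by rewrite addnS oj.
have -> : uphalf (j + n.+1) - uphalf j = (uphalf (j + n.+1) - uphalf j.+1).+1 by lia.
rewrite /= {1}/allowed /zigzag_piece (negbTE oj) /= pieceE /zigzag_edge /= (negbTE oj) /=.
have -> : uphalf j = j./2 by lia.
by [].
Qed.

Definition lookup (es : seq edge) (ls : seq label) (e : edge) : label :=
  nth L0 ls (index e es).

Lemma map_lookup es ls : uniq es -> size ls = size es -> map (lookup es ls) es = ls.
Proof.
move=> ues sz; apply: (@eq_from_nth _ L0); rewrite size_map // => i lt_i.
by rewrite (nth_map (D0, (0, 0))) // /lookup index_uniq.
Qed.

Lemma lookup_cat es1 es2 ls1 ls2 e : size ls1 = size es1 ->
  lookup (es1 ++ es2) (ls1 ++ ls2) e =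
  if e \in es1 then lookup es1 ls1 e else lookup es2 ls2 e.
Proof.
move=> sz; rewrite /lookup index_cat nth_cat sz; case: (boolP (e \in es1)) => ein.
  by rewrite index_mem ein.
by rewrite ltnNge leq_addr addKn.
Qed.

Lemma map_lookup_left es1 es2 ls1 ls2 : uniq es1 -> size ls1 = size es1 ->
  map (lookup (es1 ++ es2) (ls1 ++ ls2)) es1 = ls1.
Proof.
move=> us sz; rewrite -[in RHS](map_lookup us sz); apply/eq_in_map => e es.
by rewrite lookup_cat ?es.
Qed.

Lemma lookup_right es1 es2 ls1 ls2 : uniq (es1 ++ es2) -> size ls1 = size es1 ->
  {in es2, lookup (es1 ++ es2) (ls1 ++ ls2) =1 lookup es2 ls2}.
Proof.
rewrite cat_uniq => /and3P [_ /hasPn dis _] sz e es.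
by rewrite lookup_cat // (negbTE (dis e es)).
Qed.

Lemma all_flatten (T : Type) (p : pred T) ss : all p (flatten ss) = all (all p) ss.
Proof. by elim: ss => //= s ss IH; rewrite all_cat IH. Qed.

Section Columns.

Variables (Y H : nat -> nat) (b t : nat -> bool).

Definition column x : seq edge := [seq (D60, (x, Y x + k)) | k <- iota 0 (H x)].
(** Edges of strip [x] are numbered from the ordinate [Y x.+1] of the right column, so the bottom
    edge has number [b x] and this is the number of the top one. *)
Definition strip_end x := (H x.+1).*2 + t x.
Definition strip x : seq edge :=
  map (zigzag_edge x (Y x.+1)) (iota (b x) (strip_end x - b x).+1).
Arguments strip : simpl never.
Definition strip_pieces x : seq (seq edge) :=
  map (zigzag_piece x (Y x.+1)) (iota (b x) (strip_end x - b x)).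
Definition bottom_edge x := zigzag_edge x (Y x.+1) (b x).
Definition top_edge x := zigzag_edge x (Y x.+1) (strip_end x).

Definition right_edges x n : seq edge :=
  flatten [seq strip i ++ column i.+1 | i <- iota x n].

Definition compatible (x : nat) :=
  (Y x == Y x.+1 + b x) && (H x + b x == H x.+1 + t x).

Lemma strip_end_le x : compatible x -> strip_end x = b x + (H x + H x.+1).
Proof. by case/andP=> _ /eqP h; rewrite /strip_end; lia. Qed.

Lemma zigzag_count g x l : compatible x ->
  strip_ok (b x) (g (bottom_edge x)) (map g (behead (strip x)))
    (map g (column x)) (map g (column x.+1)) (t x, l) =
  all (allowed g) (strip_pieces x) && (l == g (top_edge x)).
Proof.
move=> cx; have eE := strip_end_le cx; have /andP [/eqP yE /eqP hE] := cx.
have := strip_ok_map g x (Y x.+1) (b x) (strip_end x - b x) l.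
have -> : b x + (strip_end x - b x) = strip_end x by rewrite eE addKn.
have -> : odd (b x) = b x by case: (b x).
have -> : odd (strip_end x) = t x by rewrite oddD odd_double; case: (t x).
have -> : uphalf (b x) = b x by case: (b x).
have -> : (nat_of_bool (b x))./2 = 0 by case: (b x).
have -> : uphalf (strip_end x) - b x = H x by rewrite eE; lia.
have -> : (strip_end x)./2 - 0 = H x.+1 by rewrite /strip_end; lia.
rewrite /strip [behead _]/= => <-; congr (strip_ok _ _ _ _ _ _).
rewrite /column yE -[iota (b x) _]/(iota (b x) (H x)) -[in RHS](addn0 (b x)).
by rewrite iotaDl -map_comp; congr (map g _); apply: eq_map => k /=; rewrite addnA.
Qed.

Definition filling (x n : nat) (bots tops v : seq label) (g : edge -> label) : bool :=
  [&& map g (map bottom_edge (iota x n)) == bots,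
      map g (map top_edge (iota x n)) == tops, map g (column (x + n)) == v &
      all (allowed g) (flatten (map strip_pieces (iota x n)))].

Lemma bottom_in_strip x : bottom_edge x \in strip x.
Proof. by apply/mapP; exists (b x : nat); rewrite // mem_iota; lia. Qed.

Lemma top_in_strip x : compatible x -> top_edge x \in strip x.
Proof.
move=> cx; apply/mapP; exists (strip_end x); rewrite // mem_iota.
by rewrite (strip_end_le cx); lia.
Qed.

Lemma strip_pieces_eq g g' x : compatible x ->
  {in column x ++ strip x ++ column x.+1, g =1 g'} ->
  all (allowed g) (strip_pieces x) = all (allowed g') (strip_pieces x).
Proof.
move=> cx eg; have := zigzag_count g (g (top_edge x)) cx.
have sub (es : seq edge) : {subset es <= column x ++ strip x ++ column x.+1} ->
    map g es = map g' es.
  by move=> sb; apply/eq_in_map => e /sb; apply: eg.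
have top_in := top_in_strip cx; have bot_in := bottom_in_strip x.
rewrite (sub (column x)) => [|e ex]; last by rewrite mem_cat ex.
rewrite (sub (column x.+1)) => [|e ex]; last by rewrite !mem_cat ex !orbT.
rewrite (sub (behead (strip x))) => [|e ex]; last by rewrite !mem_cat (mem_behead ex) orbT.
rewrite (eg (top_edge x)) ?mem_cat ?top_in ?orbT //.
rewrite (eg (bottom_edge x)) ?mem_cat ?bot_in ?orbT //.
by rewrite zigzag_count // eqxx !andbT => ->.
Qed.

Lemma right_edges_cons x n :
  right_edges x n.+1 = strip x ++ column x.+1 ++ right_edges x.+1 n.
Proof. by rewrite /right_edges /= catA. Qed.

Lemma filling_eq x n bots tops v g g' :
  (forall i, x <= i < x + n -> compatible i) ->
  {in column x ++ right_edges x n, g =1 g'} ->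
  filling x n bots tops v g = filling x n bots tops v g'.
Proof.
have sub (es : seq edge) : {subset es <= column x ++ right_edges x n} ->
    {in column x ++ right_edges x n, g =1 g'} -> map g es = map g' es.
  by move=> sb eg; apply/eq_in_map => e /sb; apply: eg.
move=> comp eg; rewrite /filling.
have in_strip i : x <= i < x + n ->
    {subset column i ++ strip i ++ column i.+1 <= column x ++ right_edges x n}.
  move=> ri e; rewrite [in X in _ -> X]mem_cat mem_cat => /orP [ei|ei]; last first.
    apply/orP; right; apply/flatten_mapP; exists i => //; rewrite mem_iota //.
  have [xi|ne] := eqVneq x i; first by rewrite xi ei.
  apply/orP; right; apply/flatten_mapP; exists i.-1.
    by rewrite mem_iota; lia.
  by rewrite mem_cat prednK ?ei ?orbT //; lia.
have edge_in i e : x <= i < x + n -> e \in strip i -> e \in column x ++ right_edges x n.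
  by move=> ri ei; apply: (in_strip i ri); rewrite !mem_cat ei orbT.
congr [&& _, _, _ & _].
- rewrite sub // => e /mapP [i]; rewrite mem_iota => ri ->.
  exact: edge_in (bottom_in_strip i).
- rewrite sub // => e /mapP [i]; rewrite mem_iota => ri ->.
  exact: edge_in (top_in_strip (comp i ri)).
- rewrite sub // => e ei; case: n => [|n] in in_strip edge_in sub eg comp ei *.
    by rewrite addn0 in ei; rewrite mem_cat ei.
  apply: (in_strip (x + n)); first by lia.
  by rewrite !mem_cat -addnS ei !orbT.
rewrite !all_flatten !all_map; apply: eq_in_all => i; rewrite mem_iota => ri /=.
by apply: strip_pieces_eq (comp i ri) _ => e /(in_strip i ri); apply: eg.
Qed.

Lemma filling_cons x n s l bots tops v g : compatible x ->
  filling x n.+1 (s :: bots) (l :: tops) v g =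
  (g (bottom_edge x) == s) &&
  strip_ok (b x) (g (bottom_edge x)) (map g (behead (strip x)))
    (map g (column x)) (map g (column x.+1)) (t x, l) && filling x.+1 n bots tops v g.
Proof.
move=> cx; rewrite /filling zigzag_count // addSnnS /= !eqseq_cons all_cat (eq_sym l).
by rewrite -!andbA; do !bool_congr.
Qed.

Lemma size_column x : size (column x) = H x.
Proof. by rewrite size_map size_iota. Qed.

Lemma region_filling x n bots tops u v :
  (forall i, x <= i < x + n -> compatible i) -> uniq (column x ++ right_edges x n) ->
  size bots = n -> size tops = n -> size u = H x ->
  region (zip (map b (iota x n)) bots) (zip (map t (iota x n)) tops) u v =
  \sum_(ls <- words labels (size (right_edges x n)))
     filling x n bots tops v (lookup (column x ++ right_edges x n) (u ++ ls)).
Proof.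
elim: n x bots tops u => [|n IH] x bots tops u comp.
  case: bots tops => [|//] [|//] un _ _ su.
  rewrite (_ : words _ _ = [:: [::]]) // big_seq1 /filling /= addn0 andbT.
  by rewrite map_lookup_left // ?size_column //; move: un; rewrite cats0.
case: bots tops => [//|s bots] [//|l tops] un [sb] [st] su.
have cx : compatible x by apply: comp; lia.
have [/andP [/eqP yE /eqP hE] eE] := (cx, strip_end_le cx).
have us : uniq (strip x ++ column x.+1 ++ right_edges x.+1 n).
  by move: un; rewrite right_edges_cons cat_uniq => /and3P [].
have us' : uniq (column x.+1 ++ right_edges x.+1 n).
  by move: us; rewrite cat_uniq => /and3P [].
rewrite right_edges_cons !size_cat size_column size_map size_iota [region _ _ _ _]/= su.
have -> : strip_end x - b x = H x + H x.+1 by lia.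
have -> : H x + b x - t x = H x.+1 by lia.
rewrite sum_words_cat sum_words_cons.
(* The prescribed bottom label becomes a variable [a], because the bottom edge belongs to the listed
   edges of the strip. *)
transitivity (\sum_(a <- labels) (a == s) *
  \sum_(w <- words labels (H x.+1)) zigzag (b x, a) u w (t x, l) *
  region (zip (map b (iota x.+1 n)) bots) (zip (map t (iota x.+1 n)) tops) w v).
  by rewrite (sum_labels_eq (fun a => \sum_(w <- _) zigzag (b x, a) u w _ * _)).
apply: eq_bigr => a _.
under [RHS]eq_bigr do rewrite sum_words_cat.
rewrite [RHS]exchange_big big_distrr big_seq [RHS]big_seq /=; apply: eq_bigr => w.
rewrite mem_words => /andP [/eqP sw _].
rewrite IH // => [|i ri]; last by apply: comp; lia.
rewrite zigzag_strip su sw big_distrl big_distrr /= big_seq [RHS]big_seq.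
apply: eq_bigr => Z; rewrite mem_words => /andP [/eqP sZ _].
rewrite mulnA big_distrr; apply: eq_bigr => ls _ /=.
set es1 := column x; set es2 := strip x; set es3 := column x.+1 ++ _.
set g := lookup (es1 ++ _) _.
have sZ2 : size (a :: Z) = size es2 by rewrite /= sZ size_map size_iota; lia.
have gE : {in es2 ++ es3, g =1 lookup (es2 ++ es3) ((a :: Z) ++ w ++ ls)}.
  rewrite right_edges_cons in un.
  have su' : size u = size es1 by rewrite size_column.
  exact: (lookup_right ((a :: Z) ++ w ++ ls) un su').
have g1 : map g es1 = u.
  by apply: map_lookup_left; rewrite ?size_column //; move: un; rewrite cat_uniq => /and3P [].
have g2 : map g es2 = a :: Z.
  rewrite -[RHS](@map_lookup_left es2 es3 _ (w ++ ls)) //; last first.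
    by move: us; rewrite cat_uniq => /and3P [].
  by apply/eq_in_map => e ein; rewrite gE // mem_cat ein.
have g3 : {in es3, g =1 lookup es3 (w ++ ls)}.
  move=> e ein; have e23 : e \in es2 ++ es3 by rewrite mem_cat ein orbT.
  rewrite (gE _ e23).
  exact: (lookup_right (w ++ ls) us sZ2).
have g3' : map g (column x.+1) = w.
  have u3 : uniq (column x.+1) by move: us'; rewrite cat_uniq => /and3P [].
  rewrite -(size_column x.+1) in sw.
  rewrite -[RHS](map_lookup_left (right_edges x.+1 n) ls u3 sw).
  by apply/eq_in_map => e ein; rewrite g3 // mem_cat ein.
rewrite filling_cons // g1 g3' (_ : map g (behead es2) = Z); last by rewrite -behead_map g2.
have -> : g (bottom_edge x) = a by move: g2; rewrite /es2 /strip /= => -[].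
rewrite (filling_eq bots tops v _ g3) ?mulnb // => i ri.
by apply: comp; lia.
Qed.

End Columns.

Lemma zigzag_edge_inj x y : injective (zigzag_edge x y).
Proof.
move=> i j [oij]; move/addnI => hij.
rewrite -(odd_double_half i) -(odd_double_half j) hij; congr (nat_of_bool _ + _).
by move: oij; case: (odd i); case: (odd j).
Qed.

Section Columns.

Variables (Y H : nat -> nat) (b t : nat -> bool).

Lemma mem_column x e : (e \in column Y H x) =
  [&& e.1 == D60, e.2.1 == x & Y x <= e.2.2 < Y x + H x].
Proof.
case: e => d [i j] /=; apply/mapP/and3P => [[k]|[/eqP -> /eqP -> rj]].
  by rewrite mem_iota => rk [-> -> ->]; rewrite !eqxx; split=> //; lia.
by exists (j - Y x); [rewrite mem_iota; lia|rewrite subnKC //; lia].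
Qed.

Lemma mem_strip x e : (e \in strip Y H b t x) ->
  [&& e.1 != D60, e.2.1 == x & Y x.+1 <= e.2.2].
Proof. by case/mapP=> j _ -> /=; rewrite eqxx leq_addr; case: odd. Qed.

Lemma mem_stripE x e : compatible Y H b t x -> (e \in strip Y H b t x) =
  (e.2.1 == x) && match e.1 with
                  | D60 => false
                  | D0 => Y x <= e.2.2 <= Y x.+1 + H x.+1
                  | D120 => Y x.+1 <= e.2.2 < Y x.+1 + (H x.+1 + t x)
                  end.
Proof.
move=> cx; have eE := strip_end_le cx; have /andP [/eqP yE /eqP hE] := cx.
have e_le : b x <= strip_end H t x by rewrite eE leq_addr.
have in_iota j : (j \in iota (b x) (strip_end H t x - b x).+1) = (b x <= j <= (H x.+1).*2 + t x).
  by rewrite mem_iota addnS subnKC.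
case: e => -[] [i j] /=; apply/mapP/andP => [[k]|[/eqP -> rj]] //.
- rewrite in_iota /zigzag_edge => rk [ok -> ->]; rewrite eqxx; split=> //.
  by move: ok rk; rewrite yE; case: ifP => // ok _; case: (b x); case: (t x); lia.
- exists ((j - Y x.+1).*2); last by rewrite /zigzag_edge odd_double doubleK subnKC //; lia.
  by rewrite in_iota; move: rj; rewrite yE; case: (b x); case: (t x); lia.
- by rewrite /zigzag_edge => _ []; case: ifP.
- rewrite in_iota /zigzag_edge => rk [ok -> ->]; rewrite eqxx; split=> //.
  by move: ok rk; case: ifP => // ok _; case: (b x); case: (t x); lia.
exists ((j - Y x.+1).*2.+1).
  by rewrite in_iota; move: rj; case: (b x); case: (t x); lia.
by rewrite /zigzag_edge /= odd_double /= uphalf_double subnKC //; lia.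
Qed.

Lemma mem_strip_pieces x s : compatible Y H b t x ->
  (s \in strip_pieces Y H b t x) <->
  (exists2 y, s = up_triangle (x, y) & Y x <= y < Y x + H x) \/
  (exists2 y, s = down_triangle (x, y) & Y x.+1 <= y < Y x.+1 + H x.+1).
Proof.
move=> cx; have eE := strip_end_le cx; have /andP [/eqP yE /eqP hE] := cx.
have e_le : b x <= strip_end H t x by rewrite eE leq_addr.
have in_iota j : (j \in iota (b x) (strip_end H t x - b x)) = (b x <= j < (H x.+1).*2 + t x).
  by rewrite mem_iota subnKC.
split=> [/mapP [j]|[[y -> ry]|[y -> ry]]].
- rewrite in_iota /zigzag_piece => rj ->; have jE := odd_double_half j.
  case: ifP jE => [oj|ej] jE; [right|left]; exists (Y x.+1 + j./2) => //.
    by move: rj jE; case: (b x); case: (t x); lia.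
  by move: rj jE hE; rewrite yE; case: (b x); case: (t x); lia.
- apply/mapP; exists ((y - Y x.+1).*2).
    by rewrite in_iota; move: ry hE; rewrite yE; case: (b x); case: (t x); lia.
  by rewrite /zigzag_piece odd_double doubleK subnKC //; lia.
apply/mapP; exists ((y - Y x.+1).*2.+1).
  by rewrite in_iota; move: ry; case: (b x); case: (t x); lia.
by rewrite /zigzag_piece /= odd_double /= uphalf_double subnKC //; lia.
Qed.

Lemma mem_right_edges x n e : e \in right_edges Y H b t x n ->
  x + (e.1 == D60) <= e.2.1.
Proof.
case/flatten_mapP=> i; rewrite mem_iota mem_cat => ri /orP [/mem_strip|].
  by case/and3P=> /negbTE -> /eqP -> _; lia.
by rewrite mem_column => /and3P [-> /eqP -> _]; lia.
Qed.

Lemma uniq_right_edges x n : uniq (column Y H x ++ right_edges Y H b t x n).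
Proof.
have uc i : uniq (column Y H i) by rewrite map_inj_uniq ?iota_uniq // => j k [] /addnI.
elim: n x => [|n IH] x; first by rewrite cats0.
rewrite cat_uniq uc andTb; apply/andP; split.
  apply/hasPn => e /mem_right_edges le_x; apply: contraTN le_x.
  by rewrite mem_column => /and3P [-> /eqP -> _]; rewrite addn1 ltnn.
rewrite right_edges_cons cat_uniq IH andbT; apply/andP; split.
  by rewrite map_inj_uniq ?iota_uniq //; apply: zigzag_edge_inj.
apply/hasPn => e; rewrite mem_cat => ein; apply/negP => /mem_strip /and3P [d60 /eqP ex _].
case/orP: ein => [|/mem_right_edges]; first by rewrite mem_column (negbTE d60).
by rewrite ex; lia.
Qed.

End Columns.

Lemma label_at_ffun es (g : edge -> label) e : e \in es ->
  label_at [ffun d : seq_sub es => g (val d)] e = Some (g e).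
Proof. by move=> ein; rewrite /label_at insubT /= ffunE. Qed.

(** A labeling is identified with the list of its values along a duplicate-free enumeration [L],
    which may follow the column order of [region]. *)
Lemma card_puzzles (es : seq edge) (ts : seq (seq edge)) bd w L :
  uniq L -> L =i es -> {subset bd <= es} ->
  (forall s, s \in ts -> {subset s <= es}) ->
  #|[set f : {ffun seq_sub es -> label} | is_puzzle ts bd w f]| =
  \sum_(ls <- words labels (size L))
    ((map (lookup L ls) bd == bits w) && all (allowed (lookup L ls)) ts).
Proof.
move=> uL Les bd_es ts_es; rewrite cardsE -sum1_card big_mkcond /=.
pose F ls := [ffun e : seq_sub es => lookup L ls (val e)].
rewrite (perm_big (map F (words labels (size L)))) /=; last first.
  apply: uniq_perm; first exact: index_enum_uniq.
    rewrite map_inj_in_uniq ?words_uniq // => u v.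
    rewrite !mem_words => /andP [/eqP su _] /andP [/eqP sv _] eF.
    rewrite -(map_lookup uL su) -(map_lookup uL sv); apply/eq_in_map => e eL.
    rewrite Les in eL.
    have := label_at_ffun (lookup L u) eL; rewrite -/(F u) eF label_at_ffun //.
    by case.
  move=> f; rewrite mem_index_enum; symmetry; apply/mapP.
  have sz : size [seq odflt L0 (label_at f e) | e <- L] = size L by rewrite size_map.
  exists [seq odflt L0 (label_at f e) | e <- L].
    by rewrite mem_words sz eqxx; apply/allP => l _; apply: mem_labels.
  apply/ffunP => e; rewrite ffunE; have eL : val e \in L by rewrite Les ssvalP.
  have /eq_in_map/(_ _ eL) -> := map_lookup uL sz.
  by rewrite /label_at valK.
rewrite big_map; apply: eq_bigr => ls _.
rewrite unfold_in /is_puzzle.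
have -> : [seq label_at (F ls) e | e <- bd] = map Some (map (lookup L ls) bd).
  by rewrite -map_comp; apply/eq_in_map => e /bd_es; apply: label_at_ffun.
have -> : [seq Some (label_of_bit b) | b <- w] = map Some (bits w).
  by rewrite /bits -map_comp.
have someI : injective (@Some label) by move=> ? ? [].
rewrite (inj_eq (inj_map someI)).
rewrite -[all (allowed _) ts](@eq_in_all _ (fun s => [seq label_at (F ls) e | e <- s]
   \in [seq map Some p | p <- allowed_pieces])) => [|s sin]; first by case: (_ && _).
have -> : [seq label_at (F ls) e | e <- s] = map Some (map (lookup L ls) s).
  by rewrite -map_comp; apply/eq_in_map => e /(ts_es s sin); apply: label_at_ffun.
by rewrite mem_map //; apply: inj_map.
Qed.

Lemma eq_rev (T : eqType) (s t : seq T) : (rev s == t) = (s == rev t).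
Proof. by rewrite -(inj_eq (can_inj revK)) revK. Qed.

Lemma mkseq_iota (T : Type) (f h : nat -> T) m n : (forall i, i < n -> f i = h (m + i)) ->
  mkseq f n = map h (iota m n).
Proof.
move=> fh; rewrite -[m in iota m]addn0 iotaDl -map_comp.
by apply/eq_in_map => i; rewrite mem_iota => /fh.
Qed.

Lemma mkseq_rev_iota (T : Type) (f h : nat -> T) m n :
  (forall i, i < n -> f i = h (m + (n - i.+1))) -> mkseq f n = rev (map h (iota m n)).
Proof.
move=> fh; apply: (@eq_from_nth _ (f 0)); rewrite ?size_rev !size_map !size_iota // => i lt_i.
rewrite nth_rev size_map size_iota // !(nth_map 0) ?size_iota; try lia.
by rewrite !nth_iota ?add0n; [exact: fh|lia..].
Qed.

Lemma map_iota_const (T : Type) (a : T) (f : nat -> T) m n :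
  (forall i, m <= i < m + n -> f i = a) -> map f (iota m n) = nseq n a.
Proof.
elim: n m => //= n IH m fa; rewrite fa; last by lia.
by rewrite IH // => i ri; apply: fa; lia.
Qed.

Section Hexagon.

Variables A B C D E Z : nat.
Hypotheses (hab : A + B = D + E) (hbc : B + C = E + Z) (hcd : C + D = Z + A).

(** The truncation is intended: the lower boundary descends along the SW side for [A] strips and
    then stays at ordinate 0 along the South side. *)
Definition hex_base (x : nat) := A - x.
Definition hex_height (x : nat) := minn (A + B) (A + B + C - x) - (A - x).
Definition hex_bottom (x : nat) := x < A.
Definition hex_top (x : nat) := C <= x.

Notation hex_column := (column hex_base hex_height).
Notation hex_strip := (strip hex_base hex_height hex_bottom hex_top).
Notation hex_bottom_edge := (bottom_edge hex_base hex_bottom).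
Notation hex_top_edge := (top_edge hex_base hex_height hex_top).
Notation hex_right_edges := (right_edges hex_base hex_height hex_bottom hex_top).
Notation hex_pieces := (strip_pieces hex_base hex_height hex_bottom hex_top).
Notation hex_list := (hex_column 0 ++ hex_right_edges 0 (C + D)).

Lemma hex_compatible x : x < C + D ->
  compatible hex_base hex_height hex_bottom hex_top x.
Proof.
move=> lt_x; apply/andP; split; apply/eqP.
  by rewrite /hex_base /hex_bottom; lia.
by rewrite /hex_height /hex_bottom /hex_top; lia.
Qed.

Lemma mem_hex_box x y : ((x, y) \in hex_box A B C D) = (x <= C + D) && (y <= A + B).
Proof.
apply/allpairsP/andP => [[[i j] [ri rj [-> ->]]]|[lx ly]].
  by move: ri rj; rewrite !mem_iota /=; lia.
by exists (x, y); rewrite !mem_iota; split=> //=; lia.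
Qed.

Lemma mem_hex_edges e : (e \in hex_edges A B C D) = all (in_hex A B C D) (edge_ends e).
Proof.
rewrite mem_filter andb_idr // => ends_in; case: e ends_in => d [x y] ends_in.
apply/allpairsP; exists (d, (x, y)); split=> //=; first by case: d {ends_in}.
rewrite mem_hex_box.
by case: d ends_in; rewrite /= /in_hex /=; lia.
Qed.

Lemma hex_topE x : x <= C + D -> hex_base x + hex_height x = minn (A + B) (A + B + C - x).
Proof. by rewrite /hex_base /hex_height; lia. Qed.

Lemma mem_hex_list : hex_list =i hex_edges A B C D.
Proof.
have strip_in x e : x < C + D -> (e \in hex_strip x) =
    (e.2.1 == x) && (e.1 != D60) && all (in_hex A B C D) (edge_ends e).
  move=> lt_x; rewrite mem_stripE ?hex_compatible // addnA hex_topE //.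
  case: e => -[] [i j] /=; rewrite ?andbF // andbT; case: eqP => //= ->.
    by rewrite /in_hex /hex_base /=; lia.
  by rewrite /in_hex /hex_base /hex_top /=; lia.
have column_in x e : x <= C + D -> (e \in hex_column x) =
    (e.2.1 == x) && (e.1 == D60) && all (in_hex A B C D) (edge_ends e).
  move=> le_x; rewrite mem_column hex_topE //; case: e => -[] [i j] /=; rewrite ?andbF //.
  by case: eqP => //= ->; rewrite /in_hex /hex_base /=; lia.
move=> e; rewrite mem_hex_edges mem_cat column_in //; apply/idP/idP.
  case/orP=> [/andP [] //|/flatten_mapP [i]]; rewrite mem_iota mem_cat => ri.
  by rewrite strip_in ?column_in; [case/orP => /andP []| |]; lia.
move=> e_in; rewrite e_in !andbT; case: (boolP (e.1 == D60)) => d60.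
  rewrite andbT; case: eqP => // x0; apply/flatten_mapP; exists e.2.1.-1.
    rewrite mem_iota; move: e_in; case: e d60 x0 => d [x y] /= /eqP -> /=.
    by rewrite /in_hex /=; lia.
  rewrite mem_cat column_in ?e_in ?d60 ?andbT; last first.
    by move: e_in; case: e d60 x0 => d [x y] /= /eqP -> /=; rewrite /in_hex /=; lia.
  by rewrite prednK ?eqxx ?orbT //; lia.
have lt_x : e.2.1 < C + D.
  by move: e_in d60; case: e => -[] [x y]; rewrite //= /in_hex /=; lia.
rewrite andbF; apply/flatten_mapP; exists e.2.1; first by rewrite mem_iota; lia.
by rewrite mem_cat strip_in // eqxx d60 e_in.
Qed.

Lemma mem_hex_triangles s :
  (s \in hex_triangles A B C D) <->
  exists x y, s \in [:: up_triangle (x, y); down_triangle (x, y)] /\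
    all (in_hex A B C D) (flatten (map edge_ends s)).
Proof.
rewrite mem_filter; split=> [/andP [s_in]|[x [y [sE s_in]]]].
  by rewrite mem_cat => /orP [] /mapP [[x y] _ sE]; exists x, y; rewrite !inE {1 2}sE eqxx ?orbT.
rewrite s_in; have xy_in : (x, y) \in hex_box A B C D.
  rewrite mem_hex_box; move: sE s_in; rewrite !inE.
  by case/orP => /eqP -> /=; rewrite /in_hex /=; lia.
have [->|->] : s = up_triangle (x, y) \/ s = down_triangle (x, y).
- by move: sE; rewrite !inE => /orP [] /eqP; [left|right].
- by rewrite mem_cat; apply/orP; left; apply: map_f.
by rewrite mem_cat; apply/orP; right; apply: map_f.
Qed.

Lemma mem_hex_pieces : flatten (map hex_pieces (iota 0 (C + D))) =i hex_triangles A B C D.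
Proof.
move=> s; apply/flatten_mapP/idP => [[x]|].
  rewrite mem_iota => lt_x /mem_strip_pieces []; first exact: hex_compatible.
    case=> y ->; rewrite hex_topE ?(ltnW lt_x) // => ry; apply/mem_hex_triangles; exists x, y.
    by rewrite mem_head; split=> //; move: ry; rewrite /hex_base /= /in_hex /=; lia.
  case=> y ->; rewrite hex_topE // => ry; apply/mem_hex_triangles; exists x, y.
  by rewrite !inE eqxx orbT; split=> //; move: ry; rewrite /hex_base /= /in_hex /=; lia.
case/mem_hex_triangles=> x [y []]; rewrite !inE => /orP [] /eqP -> s_in.
  have lt_x : x < C + D by move: s_in; rewrite /= /in_hex /=; lia.
  exists x; first by rewrite mem_iota.
  apply/mem_strip_pieces; first exact: hex_compatible.
  left; exists y; rewrite ?hex_topE ?(ltnW lt_x) //.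
  by move: s_in; rewrite /hex_base /= /in_hex /=; lia.
have lt_x : x < C + D by move: s_in; rewrite /= /in_hex /=; lia.
exists x; first by rewrite mem_iota.
apply/mem_strip_pieces; first exact: hex_compatible.
right; exists y; rewrite ?hex_topE //.
by move: s_in; rewrite /hex_base /= /in_hex /=; lia.
Qed.

Lemma hex_triangles_edges s : s \in hex_triangles A B C D ->
  {subset s <= hex_edges A B C D}.
Proof.
case/mem_hex_triangles=> x [y [_ /allP s_in]] e es; rewrite mem_hex_edges.
by apply/allP=> p pe; apply: s_in; apply/flatten_mapP; exists e.
Qed.

Lemma hex_boundaryE : hex_boundary A B C D E Z =
  rev (map hex_bottom_edge (iota 0 A)) ++ hex_column 0 ++
  map hex_top_edge (iota 0 C) ++ map hex_top_edge (iota C D) ++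
  rev (hex_column (C + D)) ++ rev (map hex_bottom_edge (iota A Z)).
Proof.
congr (_ ++ _ ++ _ ++ _ ++ _ ++ _).
- apply: mkseq_rev_iota => i lt_i; rewrite /bottom_edge /zigzag_edge /hex_base /hex_bottom.
  by rewrite (_ : _ < A = true) /=; [congr (_, (_, _)); lia|lia].
- rewrite /column (_ : hex_height 0 = B); last by rewrite /hex_height; lia.
  by apply: mkseq_iota => i _; rewrite /hex_base subn0.
- apply: mkseq_iota => i lt_i; have := @hex_topE i.+1; rewrite /top_edge /zigzag_edge /strip_end.
  rewrite /hex_top (_ : C <= _ = false) /=; last by lia.
  by rewrite addn0 odd_double doubleK => ->; [congr (_, (_, _)); lia|lia].
- apply: mkseq_iota => i lt_i; have := @hex_topE (C + i).+1.
  rewrite /top_edge /zigzag_edge /strip_end.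
  rewrite /hex_top (_ : C <= _ = true) /=; last by lia.
  by rewrite addn1 /= odd_double uphalf_double => ->; [congr (_, (_, _)); lia|lia].
- rewrite /column (_ : hex_height _ = E); last by rewrite /hex_height; lia.
  by apply: mkseq_rev_iota => i lt_i; rewrite /hex_base; congr (_, (_, _)); lia.
apply: mkseq_rev_iota => i lt_i; rewrite /bottom_edge /zigzag_edge /hex_base /hex_bottom.
by rewrite (_ : _ < A = false) /=; [congr (_, (_, _)); lia|lia].
Qed.

Lemma hex_fillingE al be ga de ep ze g :
  size al = A -> size be = B -> size ga = C -> size de = D -> size ep = E -> size ze = Z ->
  (map g (hex_boundary A B C D E Z) == bits (al ++ be ++ ga ++ de ++ ep ++ ze)) &&
    all (allowed g) (hex_triangles A B C D) =
  (map g (hex_column 0) == bits be) &&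
  filling hex_base hex_height hex_bottom hex_top 0 (C + D)
    (bits (rev al ++ rev ze)) (bits (ga ++ de)) (bits (rev ep)) g.
Proof.
move=> sa sb sc sd se sz; rewrite hex_boundaryE /filling (eq_all_r mem_hex_pieces).
have mZA (h : nat -> edge) : map h (iota 0 (C + D)) = map h (iota 0 A) ++ map h (iota A Z).
  by rewrite hcd addnC iotaD map_cat.
rewrite (mZA hex_bottom_edge) iotaD !map_cat !bits_cat !map_rev !add0n /bits !map_rev.
have sH0 : hex_height 0 = B by rewrite /hex_height; lia.
have sHm : hex_height (C + D) = E by rewrite /hex_height; lia.
rewrite !eqseq_cat ?size_rev ?size_map ?size_column ?size_iota ?sH0 ?sHm ?sb ?se //.
by rewrite !eq_rev -!andbA; do !bool_congr.
Qed.

Lemma hex_boundary_edges : {subset hex_boundary A B C D E Z <= hex_edges A B C D}.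
Proof.
move=> e; rewrite /hex_boundary !mem_cat mem_hex_edges.
case/or4P=> [/mapP|/mapP|/mapP|/or3P [] /mapP] [i]; rewrite mem_iota => lt_i -> /=;
  by rewrite /in_hex /=; lia.
Qed.

Lemma map_hex_bottom : map hex_bottom (iota 0 (C + D)) = nseq A true ++ nseq Z false.
Proof.
rewrite hcd addnC iotaD map_cat.
by congr (_ ++ _); apply: map_iota_const => i; rewrite /hex_bottom; lia.
Qed.

Lemma map_hex_top : map hex_top (iota 0 (C + D)) = nseq C false ++ nseq D true.
Proof.
rewrite iotaD map_cat.
by congr (_ ++ _); apply: map_iota_const => i; rewrite /hex_top; lia.
Qed.

End Hexagon.

(** Clockwise reading runs against the left-to-right and upward orientation of [region] on the SW,
    SE and South sides, hence the three reversals. *)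
Lemma Hex_region al be ga de ep ze :
  size al + size be = size de + size ep -> size be + size ga = size ep + size ze ->
  size ga + size de = size ze + size al ->
  Hex al be ga de ep ze =
  region (map (pair true) (bits (rev al)) ++ map (pair false) (bits (rev ze)))
         (map (pair false) (bits ga) ++ map (pair true) (bits de))
         (bits be) (bits (rev ep)).
Proof.
move=> hab hbc hcd; rewrite /Hex.
rewrite (card_puzzles _ (uniq_right_edges _ _ _ _ _ _) (mem_hex_list hab hbc hcd)); first last.
- exact: hex_triangles_edges hab hbc hcd.
- exact: hex_boundary_edges hab hbc hcd.
rewrite size_cat size_column sum_words_cat.
under eq_bigr => u _ do under eq_bigr => ls _ do rewrite (hex_fillingE hab hbc hcd) //.
set Y := hex_base _; set H := hex_height _ _ _; set b := hex_bottom _; set t := hex_top _.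
set R := right_edges _ _ _ _ _ _.
transitivity (\sum_(u <- words labels (H 0)) (u == bits be) * \sum_(ls <- words labels (size R))
  filling Y H b t 0 (size ga + size de)
    (bits (rev al ++ rev ze)) (bits (ga ++ de)) (bits (rev ep))
    (lookup (column Y H 0 ++ R) (u ++ ls))).
  rewrite big_seq [RHS]big_seq; apply: eq_bigr => u; rewrite mem_words => /andP [/eqP su _].
  rewrite big_distrr; apply: eq_bigr => ls _ /=; rewrite map_lookup_left ?mulnb ?size_column //.
  by rewrite map_inj_uniq ?iota_uniq // => j k [] /addnI.
have sH0 : H 0 = size be by rewrite /H /hex_height; lia.
rewrite sum_words_pick ?size_map // -region_filling.
- rewrite (map_hex_bottom hab hbc hcd) (map_hex_top hab hbc hcd) !bits_cat.
  rewrite !zip_cat ?size_nseq ?size_map ?size_rev //.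
  by rewrite -(size_rev al) -(size_rev ze) !zip_bits.
- by move=> i /andP [_ ri]; apply: (hex_compatible hab hbc hcd).
- exact: uniq_right_edges.
- by rewrite size_map size_cat !size_rev hcd addnC.
- by rewrite size_map size_cat.
by rewrite size_map.
Qed.

(* The formula for hexagonal puzzles *)
Local Close Scope nat_scope.

Lemma sum_bool_words (R : nmodType) n (P : pred (seq bool)) (F : seq bool -> R) :
  \sum_(w <- bool_words n | P w) F w = \sum_(w : n.-tuple bool | P w) F w.
Proof.
rewrite (perm_big (map val (index_enum {: n.-tuple bool}))) ?big_map //.
apply: uniq_perm; first exact: words_uniq.
  by rewrite map_inj_uniq ?index_enum_uniq //; apply: val_inj.
move=> w; rewrite mem_bool_words; apply/idP/mapP => [sw|[u _ ->]]; last by rewrite size_tuple.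
by exists (Tuple sw); rewrite ?mem_index_enum.
Qed.

Lemma binstr_counts i j s : s \in binstr (i + j) j ->
  [/\ size s = i + j, count_mem true s = j & count_mem false s = i]%N.
Proof.
rewrite inE => /andP [/eqP sz /eqP ct]; split=> //.
by apply/eqP; rewrite -(eqn_add2r j) -{1}ct count_false_true sz.
Qed.

Theorem proposition9
  (a0 a1 b0 b1 c0 c1 d0 d1 e0 e1 z0 z1 : nat)
  (hbc0 : (b0 + c0 = e0 + z0)%N) (hbc1 : (b1 + c1 = e1 + z1)%N)
  (hab0 : (a0 + b0 = d0 + e0)%N) (hab1 : (a1 + b1 = d1 + e1)%N)
  (hcd0 : (c0 + d0 = z0 + a0)%N) (hcd1 : (c1 + d1 = z1 + a1)%N)
  (alpha beta gamma delta epsilon zeta : seq bool)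
  (halpha : alpha \in binstr (a0 + a1) a1)
  (hbeta : beta \in binstr (b0 + b1) b1)
  (hgamma : gamma \in binstr (c0 + c1) c1)
  (hdelta : delta \in binstr (d0 + d1) d1)
  (hepsilon : epsilon \in binstr (e0 + e1) e1)
  (hzeta : zeta \in binstr (z0 + z1) z1) :
  (Hex alpha beta gamma delta epsilon zeta)%:Z =
  \sum_(mu : (b0 + b1 + c0 + c1).-tuple bool
          | tval mu \in binstr (b0 + b1 + c0 + c1) (b1 + c1))
   \sum_(theta : (a0 + b0 + a1 + z1).-tuple bool
          | (tval theta \in binstr (a0 + b0 + a1 + z1) (a1 + z1)) &&
            (nseq a0 false ++ mu ++ nseq a1 true ==
             nseq c0 false ++ theta ++ nseq e1 true))
      LR (nseq b0 false ++ rev alpha ++ nseq z1 true) theta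
         (nseq c1 true ++ delta ++ nseq e0 false)
      * LR (beta ++ gamma) mu (rev (epsilon ++ zeta)).
Proof.
have [sal tal fal] := binstr_counts halpha; have [sbe tbe fbe] := binstr_counts hbeta.
have [sga tga fga] := binstr_counts hgamma; have [sde tde fde] := binstr_counts hdelta.
have [sep tep fep] := binstr_counts hepsilon; have [sze tze fze] := binstr_counts hzeta.
rewrite Hex_region ?sal ?sbe ?sga ?sde ?sep ?sze; [|lia..].
rewrite hexagon_triangle ?size_rev ?sal ?sbe ?sga ?sde ?sep ?sze; [|lia..].
rewrite !identity_word_rev -rev_cat.
set p := beta ++ gamma; set nu := rev (epsilon ++ zeta).
set x := identity_word gamma ++ _.
set a := nseq b0 false ++ rev alpha ++ nseq z1 true.
set y := nseq c1 true ++ delta ++ nseq e0 false.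
(* The NE side of the big triangle, sorted at both ends by the glued corners, is
   [1^{c1} delta 0^{e0}] padded by [0^{c0}] and [1^{e1}]. *)
have xE : x = pad c0 e1 y.
  rewrite /x /y /pad /identity_word /sorted_word fga tga fep tep.
  by rewrite -!catA.
have sp : size p = (b0 + b1 + c0 + c1)%N by rewrite size_cat sbe sga; lia.
have tp : count_mem true p = (b1 + c1)%N by rewrite count_cat tbe tga.
have fp : count_mem false p = (b0 + c0)%N by rewrite count_cat fbe fga.
have snu : size nu = size p by rewrite size_rev size_cat sep sze sp; lia.
have tnu : count_mem true nu = count_mem true p by rewrite count_rev count_cat tep tze tp.
have sa : size a = (a0 + b0 + a1 + z1)%N by rewrite !size_cat !size_nseq size_rev sal; lia.
have ta : count_mem true a = (a1 + z1)%N by rewrite !count_cat !count_nseq count_rev tal /=; lia.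
have sy : size y = size a by rewrite sa !size_cat !size_nseq sde; lia.
have ty : count_mem true y = count_mem true a by rewrite ta !count_cat !count_nseq tde /=; lia.
have sx : size x = size (rev alpha ++ p) by rewrite xE size_pad sy sa size_cat size_rev sal sp; lia.
have tx : count_mem true x = count_mem true (rev alpha ++ p).
  by rewrite xE count_pad ty ta count_cat count_rev tal tp; lia.
have s_id : size (identity_word alpha ++ p) = size (rev alpha ++ p).
  by rewrite !(size_identity_word, size_cat) size_rev.
have t_id : count_mem true (identity_word alpha ++ p) = count_mem true (rev alpha ++ p).
  by rewrite !count_cat !count_nseq count_rev /= mul0n mul1n.
have s_nu : size (rev alpha ++ nu) = size (rev alpha ++ p).
  by rewrite (size_cat (rev alpha) nu) snu size_cat.
have t_nu : count_mem true (rev alpha ++ nu) = count_mem true (rev alpha ++ p).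
  by rewrite (count_cat _ (rev alpha) nu) tnu -count_cat.
(* Commutativity makes the NW word, which starts with the sorted word of [alpha], the lower word of
   a skew polynomial that can be cut after this prefix. *)
rewrite -puzzle_countE puzzle_countC ?s_id ?t_id ?s_nu ?t_nu //.
rewrite -identity_word_rev puzzle_count_cat // !count_rev tal fal tp fp sp.
rewrite sum_bool_words; apply: eq_big => mu; first by rewrite inE size_tuple eqxx.
move=> /eqP tmu.
(* Since [b1 + c1 = e1 + z1], part of this padding goes into [a] and what is left is the padding of
   [y]. *)
have -> : pad (b0 + c0) (b1 + c1) (rev alpha) = pad c0 e1 a.
  by rewrite /a /pad (addnC b0) hbc1 (addnC e1) !nseqD -!catA.
rewrite xE (@puzzle_countC (pad c0 e1 a)) ?size_pad ?count_pad ?size_tuple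
  ?sy ?sa ?size_rev ?sal ?ty ?ta ?count_rev ?tal ?tmu //; [|lia..].
(* The expansion over [theta]; its indicator factor is the condition that links [mu] and [theta]. *)
rewrite puzzle_count_pad //; first last.
- by rewrite (count_pad _ c0) ta count_pad tmu; lia.
- by rewrite (size_pad c0) sa size_pad size_tuple; lia.
rewrite sa ta sum_bool_words mulr_sumr [RHS]big_mkcondr /=.
apply: eq_big => theta; first by rewrite inE size_tuple eqxx.
move=> /eqP ttheta; rewrite -/(pad a0 a1 mu) -/(pad c0 e1 theta) (eq_sym (pad a0 a1 mu)).
rewrite LR_puzzle_count ?size_tuple ?sa ?sy ?ty ?ta //.
rewrite LR_puzzle_count ?size_tuple ?snu ?sp ?tnu ?tp //.
rewrite (@puzzle_countC a theta) ?size_tuple ?sy ?ty ?ta //.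
rewrite (@puzzle_countC p mu) ?size_tuple ?snu ?tnu ?tp //.
by case: eqP => _; rewrite ?mulr0 // mulr1 mulrC.
Qed.
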